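(* Let $k,l\in\mathbb{Z}$ be weights, $d,e\geq0$ integers (depths), and $n\geq0$ an integer. Exclude the case in which both $d-k$ and $e-l$ are non-negative integers and $n$ is larger than both $d-k$ and $e-l$ but $n\leq d+e-k-l+1$. Then, up to multiplication by a global scalar, there is exactly one (nonzero) linear combination $[f,g]_{n;k,d;l,e}=\sum_{r=0}^{n}c_{r}\,\partial_{\tau}^{r}f\otimes\partial_{\tau}^{n-r}g$ with constant coefficients $c_{r}\in\mathbb{C}$ having the property that whenever $\Gamma$ is a Fuchsian group, $\rho,\eta$ are finite-dimensional representations of $\Gamma$, $f\in\widetilde{\mathcal{M}}_{k}^{*,\leq d}(\rho)$ and $g\in\widetilde{\mathcal{M}}_{l}^{*,\leq e}(\eta)$, one has $[f,g]_{n;k,d;l,e}\in\widetilde{\mathcal{M}}_{k+l+2n}^{*,\leq d+e}(\rho\otimes\eta)$. One normalization is $c_{r}=(-1)^{r}\binom{n}{r}\prod_{j=r}^{n-1}(k-d+j)\prod_{q=n-r}^{n-1}(l-e+q)$ (empty products equal $1$). Here $*$ can be any of $an$, $sing$, $mer$, $hol$, and, if $\Gamma$ has cusps, also $cusp$ or $wh$. Moreover, if $\Gamma$ has cusps, $n\geq1$ and $*=hol$, then $[f,g]_{n;k,d;l,e}\in\widetilde{\mathcal{M}}_{k+l+2n}^{cusp,\leq d+e}(\rho\otimes\eta)$.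
   Context: $\mathcal{H}$ is the upper half-plane, $\tau=x+iy$, $SL_{2}(\mathbb{R})$ acts by fractional linear transformations, $j_{\gamma}(\tau)=c\tau+d$ and $j_{\gamma}'=c$ for $\gamma=\begin{pmatrix}a&b\\c&d\end{pmatrix}$. A Fuchsian group is a discrete subgroup $\Gamma\leq SL_{2}(\mathbb{R})$ of finite covolume. For a finite-dimensional representation $\rho$ of $\Gamma$ on $V_{\rho}$, a quasi-modular form of weight $k$ and depth at most $d$ is a function $f:\mathcal{H}\to V_{\rho}$ with functions $f_{0}=f,\ldots,f_{d}$ such that $f(\gamma\tau)=\sum_{r=0}^{d}j_{\gamma}(\tau)^{k-r}(j_{\gamma}')^{r}\rho(\gamma)f_{r}(\tau)$ for all $\gamma\in\Gamma$. The space $\widetilde{\mathcal{M}}_{k}^{*,\leq d}(\rho)$ consists of such $f$ with regularity $*$: $an$ = real-analytic, $sing$ = real-analytic outside a discrete set, $hol$ = holomorphic, $mer$ = meromorphic; when $\Gamma$ has cusps, $cusp$ and $wh$ denote the cusp forms and weakly holomorphic forms (holomorphic on $\mathcal{H}$ with the usual respective conditions at the cusps). Tensor products of quasi-modular forms take values in $V_{\rho}\otimes V_{\eta}$ with representation $\rho\otimes\eta$. *)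

(* Defs.v *)
From HB Require Import structures.
From mathcomp Require Import all_boot all_order all_algebra.
From mathcomp Require Import complex mxtens.
From mathcomp Require Import all_classical all_reals all_analysis.
Import Order.TTheory GRing.Theory Num.Theory.
Import numFieldNormedType.Exports.

Set Implicit Arguments.
Unset Strict Implicit.
Unset Printing Implicit Defensive.

Local Open Scope classical_set_scope.
Local Open Scope ring_scope.
Local Open Scope complex_scope.

(* The topology of the complex numbers is that of R[i]^o, hence the casts to
   R[i]^o below.  All functions are total on R[i]; only their values on the
   upper half-plane (and off the singular set, if there is one) matter. *)

Definition upper_half_plane {R : realType} : set R[i] :=
  [set z | 0 < complex.Im z].

Definition mobius {R : realType} (g : 'M[R]_2) (z : R[i]) : R[i] :=
  ((g 0 0)%:C * z + (g 0 1)%:C) / ((g 1 0)%:C * z + (g 1 1)%:C).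

Definition autj {R : realType} (g : 'M[R]_2) (z : R[i]) : R[i] :=
  (g 1 0)%:C * z + (g 1 1)%:C.

Definition autj' {R : realType} (g : 'M[R]_2) : R[i] := (g 1 0)%:C.

(** Fuchsian groups, cusps, representations *)

Definition SL2_subgroup {R : realType} (Gamma : set 'M[R]_2) : Prop :=
  [/\ forall g, Gamma g -> \det g = 1,
      Gamma 1%:M,
      forall g h, Gamma g -> Gamma h -> Gamma (g *m h)
    & forall g, Gamma g -> Gamma (invmx g)].

(* A point (x, y) of R * R stands for x + i y; the hyperbolic area is
   dx dy / y^2. *)
Definition fundamental_set {R : realType} (Gamma : set 'M[R]_2)
    (D : set (R * R)) : Prop :=
  [/\ measurable D,
      forall p, D p -> 0 < p.2
    & forall z, upper_half_plane z ->
        exists! p, D p /\ exists2 g, Gamma g & p.1 +i* p.2 = mobius g z].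

Definition finite_covolume {R : realType} (Gamma : set 'M[R]_2) : Prop :=
  exists2 D : set (R * R), fundamental_set Gamma D &
    (\int[lebesgue_measure \x lebesgue_measure]_(p in D)
        (((p.2 : R) ^- 2)%:E) < +oo)%E.

Definition fuchsian {R : realType} (Gamma : set 'M[R]_2) : Prop :=
  [/\ SL2_subgroup Gamma, Gamma `<=` isolated Gamma & finite_covolume Gamma].

Definition parabolic {R : realType} (g : 'M[R]_2) : Prop :=
  [/\ g <> 1%:M, g <> - 1%:M & (\tr g) ^+ 2 = 4].

(* The cusps of Gamma are the points sigma(oo), for s = sigma in SL_2(R), that
   are fixed by some parabolic element of Gamma. *)
Definition cusp_at {R : realType} (Gamma : set 'M[R]_2) (s : 'M[R]_2) : Prop :=
  \det s = 1 /\
  exists g, [/\ Gamma g, parabolic g & (invmx s *m g *m s) 1 0 = 0].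

Definition has_cusps {R : realType} (Gamma : set 'M[R]_2) : Prop :=
  exists s, cusp_at Gamma s.

Definition representation {R : realType} (Gamma : set 'M[R]_2) (m : nat)
    (rho : 'M[R]_2 -> 'M[R[i]]_m) : Prop :=
  rho 1%:M = 1%:M /\
  forall g h, Gamma g -> Gamma h -> rho (g *m h) = rho g *m rho h.

Definition tensor_rep {R : realType} (m p : nat)
    (rho : 'M[R]_2 -> 'M[R[i]]_m) (eta : 'M[R]_2 -> 'M[R[i]]_p)
    (g : 'M[R]_2) : 'M[R[i]]_(m * p) := rho g *t eta g.

(** Regularity of functions *)

(* Absolutely convergent power series in x - Re a and y - Im a on a closed box
   around a. *)
Definition real_analytic_at {R : realType} (h : R[i] -> R[i]) (a : R[i]) :
    Prop :=
  exists (A : nat -> nat -> R[i]) (eps M : R),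
  [/\ 0 < eps,
      forall n, \sum_(i < n) \sum_(j < n) `|A i j| * eps%:C ^+ (i + j) <= M%:C
    & forall u v : R, `|u| <= eps -> `|v| <= eps ->
        ((fun n => \sum_(i < n) \sum_(j < n) A i j * u%:C ^+ i * v%:C ^+ j)
          : nat -> R[i]^o) @ \oo --> (h (a + (u +i* v)) : R[i]^o)].

Definition holomorphic_at {R : realType} (h : R[i] -> R[i]) (a : R[i]) : Prop :=
  exists (A : nat -> R[i]) (eps : R), 0 < eps /\
  forall z, `|z - a| < eps%:C ->
    ((fun n => \sum_(i < n) A i * (z - a) ^+ i) : nat -> R[i]^o)
      @ \oo --> (h z : R[i]^o).

(* Pole of order at most N at a; the value at a itself is irrelevant. *)
Definition meromorphic_at {R : realType} (h : R[i] -> R[i]) (a : R[i]) : Prop :=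
  exists (N : nat) (h0 : R[i] -> R[i]) (eps : R),
  [/\ 0 < eps, holomorphic_at h0 a
    & forall z, z != a -> `|z - a| < eps%:C -> h z = h0 z / (z - a) ^+ N].

Definition coordwise {R : realType} (m : nat)
    (P : (R[i] -> R[i]) -> R[i] -> Prop) (f : R[i] -> 'cV[R[i]]_m)
    (a : R[i]) : Prop :=
  forall i, P (fun z => f z i 0) a.

Definition discrete_in_H {R : realType} (S : set R[i]) : Prop :=
  forall a, upper_half_plane a -> ~ limit_point (S : set R[i]^o) a.

(** The operator d/dtau = (d/dx - i d/dy) / 2 *)

Definition derive_line {R : realType} (h : R -> R[i]) (t : R) : R[i] :=
  derive1 (fun s => complex.Re (h s) : R^o) t +i*
  derive1 (fun s => complex.Im (h s) : R^o) t.

Definition dtau_scalar {R : realType} (h : R[i] -> R[i]) (z : R[i]) : R[i] :=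
  (derive_line (fun x => h (x +i* complex.Im z)) (complex.Re z)
   - (0 +i* 1) * derive_line (fun y => h (complex.Re z +i* y)) (complex.Im z)) / 2.

Definition dtau {R : realType} (m : nat) (f : R[i] -> 'cV[R[i]]_m)
    (z : R[i]) : 'cV[R[i]]_m :=
  \col_i dtau_scalar (fun w => f w i 0) z.

(** Conditions at the cusps *)

(* If f_0, ..., f_d satisfy
     f(g z) = \sum_r j_g(z)^(k-r) (j_g')^r rho(g) f_r(z)   for g in Gamma,
   and s is in SL_2(R), then the functions at_cusp s k d F t below satisfy
     f(g s z) = \sum_t j_(gs)(z)^(k-t) (j_(gs)')^t rho(g) (at_cusp s k d F t z).
   They are the components, for the conjugate group s^-1 Gamma s, of the
   expansion of f at the cusp s(oo); for d = 0 this is the usual f|_k s. *)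
Definition at_cusp {R : realType} (m : nat) (s : 'M[R]_2) (k : int) (d : nat)
    (F : nat -> R[i] -> 'cV[R[i]]_m) (t : nat) (z : R[i]) : 'cV[R[i]]_m :=
  \sum_(r < d.+1 | (t <= r)%N)
    ('C(r, t)%:R * (- autj' s) ^+ (r - t) * autj s z ^ (r%:Z + t%:Z - k))
      *: F r (mobius s z).

Definition bounded_at_ioo {R : realType} (m : nat) (h : R[i] -> 'cV[R[i]]_m) :
    Prop :=
  exists M Y : R, forall z, Y <= complex.Im z ->
    forall i, `|h z i 0| <= M%:C.

Definition vanishing_at_ioo {R : realType} (m : nat)
    (h : R[i] -> 'cV[R[i]]_m) : Prop :=
  forall eps : R, 0 < eps -> exists Y : R, forall z, Y <= complex.Im z ->
    forall i, `|h z i 0| <= eps%:C.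

Definition exp_growth_at_ioo {R : realType} (m : nat)
    (h : R[i] -> 'cV[R[i]]_m) : Prop :=
  exists B M Y : R, forall z, Y <= complex.Im z ->
    forall i, `|h z i 0| <= (B * expR (M * complex.Im z))%:C.

(** Quasi-modular forms *)

(* mer: meromorphic on the upper half-plane; merc: moreover meromorphic at the
   cusps.  Both are closed under the brackets. *)
Variant regularity := an | sing | mer | merc | hol | cusp | wh.

Definition regularity_on_H {R : realType} (m : nat) (star : regularity)
    (S : set R[i]) (f : R[i] -> 'cV[R[i]]_m) : Prop :=
  forall a, upper_half_plane a ->
    match star with
    | an | sing => ~ S a -> coordwise real_analytic_at f a
    | mer | merc => (~ S a -> coordwise holomorphic_at f a) /\
                    coordwise meromorphic_at f a
    | hol | cusp | wh => coordwise holomorphic_at f a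
    end.

Definition singular_set {R : realType} (star : regularity) (S : set R[i]) :
    Prop :=
  match star with
  | sing | mer | merc => discrete_in_H S
  | _ => S = set0
  end.

(* For cusp forms only the component number 0 has to vanish at the cusps, the
   other ones being bounded: E_4' is a cusp form of weight 6 and depth 1 over
   SL_2(Z), although its component number 1 is a multiple of E_4. *)
Definition condition_at_cusps {R : realType} (Gamma : set 'M[R]_2) (m : nat)
    (star : regularity) (k : int) (d : nat) (S : set R[i])
    (F : nat -> R[i] -> 'cV[R[i]]_m) : Prop :=
  forall s, cusp_at Gamma s ->
    match star with
    | an | sing | mer => True
    | hol => forall t, (t <= d)%N -> bounded_at_ioo (at_cusp s k d F t)
    | cusp => (forall t, (t <= d)%N -> bounded_at_ioo (at_cusp s k d F t)) /\
              vanishing_at_ioo (at_cusp s k d F 0)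
    | wh => forall t, (t <= d)%N -> exp_growth_at_ioo (at_cusp s k d F t)
    | merc => (exists Y : R, forall z, Y <= complex.Im z -> ~ S (mobius s z)) /\
              forall t, (t <= d)%N -> exp_growth_at_ioo (at_cusp s k d F t)
    end.

(* S is the set of possible singularities; it is empty unless star is sing,
   mer or merc.  Over a Fuchsian group f_1, ..., f_d are determined by f. *)
Definition quasimodular {R : realType} (Gamma : set 'M[R]_2) (m : nat)
    (rho : 'M[R]_2 -> 'M[R[i]]_m) (star : regularity) (k : int) (d : nat)
    (f : R[i] -> 'cV[R[i]]_m) : Prop :=
  exists (F : nat -> R[i] -> 'cV[R[i]]_m) (S : set R[i]),
  [/\ F 0%N = f,
      singular_set star S,
      forall r, (r <= d)%N -> regularity_on_H star S (F r),
      forall g z, Gamma g -> upper_half_plane z -> ~ S z -> ~ S (mobius g z) ->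
        f (mobius g z) =
        \sum_(r < d.+1)
          (autj g z ^ (k - r%:Z) * autj' g ^+ r) *: (rho g *m F r z)
    & condition_at_cusps Gamma star k d S F].

(* cusp and wh are only considered for groups with cusps. *)
Definition regularity_for {R : realType} (Gamma : set 'M[R]_2)
    (star : regularity) : Prop :=
  match star with
  | cusp | wh => has_cusps Gamma
  | _ => True
  end.

(** Brackets *)

Definition bracket {R : realType} (n : nat) (c : 'rV[R[i]]_n.+1) (m p : nat)
    (f : R[i] -> 'cV[R[i]]_m) (g : R[i] -> 'cV[R[i]]_p) (z : R[i]) :
    'cV[R[i]]_(m * p) :=
  \sum_(r < n.+1)
    c 0 r *: (iter r (@dtau R m) f z *t iter (n - r) (@dtau R p) g z).

Definition preserves_quasimodularity {R : realType} (k l : int) (d e n : nat)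
    (c : 'rV[R[i]]_n.+1) : Prop :=
  forall (Gamma : set 'M[R]_2) (m p : nat)
    (rho : 'M[R]_2 -> 'M[R[i]]_m) (eta : 'M[R]_2 -> 'M[R[i]]_p)
    (star : regularity) (f : R[i] -> 'cV[R[i]]_m) (g : R[i] -> 'cV[R[i]]_p),
  fuchsian Gamma -> representation Gamma rho -> representation Gamma eta ->
  regularity_for Gamma star ->
  quasimodular Gamma rho star k d f -> quasimodular Gamma eta star l e g ->
  quasimodular Gamma (tensor_rep rho eta) star (k + l + (2 * n)%:Z) (d + e)
    (bracket c f g).

Definition rc_coef {R : realType} (k l : int) (d e n : nat) :
    'rV[R[i]]_n.+1 :=
  \row_(r < n.+1)
    ((-1) ^+ r * 'C(n, r)%:R
     * (\prod_(r <= j < n) (k - d%:Z + j%:Z)%:~R)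
     * (\prod_(n - r <= q < n) (l - e%:Z + q%:Z)%:~R)).

(* Main.v *)
(* A quasi-modular form of depth d with components F_0, ..., F_d is encoded by
   the functions
     polar d F p q z = \sum_t F_t(z) (q z - p)^(d-t) q^t,
   homogeneous of degree d in (p, q). In these terms the transformation law in
   weight k and depth d becomes the law of a modular form of weight k - d, the
   group acting also on (p, q), and products of families become products of
   functions. The bracket is therefore the classical Rankin-Cohen bracket in
   the weights k - d and l - e. Its covariance is an identity between
   polynomials in X = -j'/j: the iterated derivatives of a form transform by the
   polynomials [bol_poly], and the derivative in X of their Rankin-Cohen
   combination vanishes by the recurrence
     (n-a)(l-e+n-1-a) c_a + (a+1)(k-d+a) c_(a+1) = 0   (a < n).
   Near a cusp, Cauchy's estimate on ever larger discs shows that the derivatives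
   of a bounded function vanish; as each term of a bracket with n >= 1 contains
   a derivative, it is a cusp form.

   For uniqueness, take vector-valued test forms
     y^(-d-p) Sym^m(z, 1) (x) Sym^p(conj z, 1),
   which are real analytic and quasi-modular of depth d for SL_2(R), hence for
   the Fuchsian group SL_2(Z). Suitable linear forms of such f and g vanish to
   prescribed orders at a point z_0 of the upper half-plane. Letting the group
   element vary, the law of the bracket bounds the degree of a polynomial in
   X at z_0, and this forces the recurrence for the coefficients.
   Outside the excluded case the solutions of the recurrence form a line. *)
Require Import Defs.
From HB Require Import structures.
From mathcomp Require Import all_boot all_order all_algebra.
From mathcomp Require Import complex mxtens ring lra zify.
From mathcomp Require Import all_classical all_reals all_analysis.
From mathcomp Require Import measurable_realfun.
Import Order.TTheory GRing.Theory Num.Theory.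
Import numFieldNormedType.Exports.

Set Implicit Arguments.
Unset Strict Implicit.
Unset Printing Implicit Defensive.

Local Open Scope classical_set_scope.
Local Open Scope ring_scope.
Local Open Scope complex_scope.

Import Normc.

Local Notation dtau_iter j := (iter j (@dtau_scalar _)).

(** * Complex limits and double power series *)

Section ComplexNorm.
Variable R : realType.
Implicit Types (z w : R[i]) (x : R).

Lemma normc_ge0 z : 0 <= normc z.
Proof. by case: z => a b; exact: sqrtr_ge0. Qed.

Lemma normcB_le z w : normc (z - w) <= normc z + normc w.
Proof. exact: (@ler_normB R (Rcomplex R)). Qed.

Lemma distcC z w : normc (z - w) = normc (w - z).
Proof. exact: (@distrC R (Rcomplex R)). Qed.

Lemma lercB_dist z w : normc z - normc w <= normc (z - w).
Proof. exact: (@lerB_dist R (Rcomplex R)). Qed.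

Lemma normc_eq0 z : (normc z == 0) = (z == 0).
Proof. exact: (@normr_eq0 R (Rcomplex R)). Qed.

Lemma normc_gt0 z : (0 < normc z) = (z != 0).
Proof. exact: (@normr_gt0 R (Rcomplex R)). Qed.

Lemma normcX z n : normc (z ^+ n) = normc z ^+ n.
Proof.
by elim: n => [|n IH]; rewrite ?expr0 ?exprS ?normc1 // normcM IH.
Qed.

Lemma normc_sum_le (I : Type) (r : seq I) (P : pred I) (F : I -> R[i]) :
  normc (\sum_(i <- r | P i) F i) <= \sum_(i <- r | P i) normc (F i).
Proof. exact: (@ler_norm_sum R (Rcomplex R)). Qed.

Lemma sqr_normcE z : normc z ^+ 2 = complex.Re z ^+ 2 + complex.Im z ^+ 2.
Proof. by case: z => a b /=; rewrite sqr_sqrtr // addr_ge0 ?sqr_ge0. Qed.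

Lemma normc_real x : normc x%:C = `|x|.
Proof. by rewrite /= expr0n /= addr0 sqrtr_sqr. Qed.

Lemma normc_conj z : normc (conjc z) = normc z.
Proof. by case: z => a b /=; rewrite sqrrN. Qed.

Lemma normc_nat n : normc (n%:R : R[i]) = n%:R.
Proof.
by rewrite -(rmorph_nat (real_complex R)) normc_real ger0_norm ?ler0n.
Qed.

Lemma normRe_le z : `|complex.Re z| <= normc z.
Proof. by have := normc_ge_Re z; rewrite lecR. Qed.

Lemma normIm_le z : `|complex.Im z| <= normc z.
Proof.
rewrite -(@ler_pXn2r _ 2) ?nnegrE ?normc_ge0 // sqr_normcE.
by rewrite real_normK ?num_real // lerDr sqr_ge0.
Qed.

Lemma normc_le_ReIm z : normc z <= `|complex.Re z| + `|complex.Im z|.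
Proof.
rewrite -(@ler_pXn2r _ 2) ?nnegrE ?normc_ge0 ?addr_ge0 // sqr_normcE.
by rewrite sqrrD !real_normK ?num_real // lerD2r lerDl mulrn_wge0.
Qed.

Lemma nbhs_normcP z (P : R[i] -> Prop) :
  (\forall w \near (z : R[i]^o), P w) <->
  exists2 r : R, 0 < r & forall w, normc w < r -> P (z + w).
Proof.
rewrite nbhs_normP; split=> [[e]|[r r0 Pr]].
  case: e => x y; rewrite /= ltcE /= => /andP[/eqP -> x0] Px; exists x => // w wx.
  by apply: Px; rewrite /ball_ /= opprD addNKr normrN -ltcR in wx *.
exists r%:C; first by rewrite /= ltcR.
move=> w; rewrite /ball_ /= -[`|_|]/((normc _)%:C) ltcR distcC => /Pr.
by rewrite addrC subrK.
Qed.

End ComplexNorm.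

Local Notation cvgc u l :=
  ((u : nat -> (complex _)^o) @ \oo --> (l : (complex _)^o)).

Section ComplexLimits.
Variable R : realType.
Implicit Types (u v : nat -> R[i]) (l : R[i]) (C : R).

Lemma cvgcP u l : cvgc u l <->
  forall e : R, 0 < e -> \forall n \near \oo, normc (u n - l) < e.
Proof.
split=> [/cvgrPdist_lt ul e e0|ul].
  have := ul e%:C; rewrite ltcR => /(_ e0); apply: filterS => n.
  by rewrite distrC -[`|_|]/((normc _)%:C) ltcR.
apply/cvgrPdist_lt => -[e f]; rewrite ltcE /= => /andP[/eqP -> /ul].
by apply: filterS => n; rewrite distrC -[`|_|]/((normc _)%:C) ltcR.
Qed.

Lemma cvg_half_expr C : (fun n => C * 2^-1 ^+ n : R) @ \oo --> 0.
Proof. by apply: cvg_geometric; rewrite gtr0_norm ?invf_lt1 ?ltr1n. Qed.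

Lemma cvgc_le u l C : cvgc u l -> (forall n, normc (u n) <= C) -> normc l <= C.
Proof.
move=> /cvgcP ul uC; apply/ler_addgt0Pr => e /ul[N _ /(_ N (leqnn N))].
have := lercB_dist l (u N); rewrite distcC; have := uC N; lra.
Qed.

Lemma cvgcD u v l m : cvgc u l -> cvgc v m -> cvgc (fun n => u n + v n) (l + m).
Proof. exact: (@cvgD R[i] R[i]^o nat \oo). Qed.

Lemma cvgcB u v l m : cvgc u l -> cvgc v m -> cvgc (fun n => u n - v n) (l - m).
Proof. exact: (@cvgB R[i] R[i]^o nat \oo). Qed.

Lemma cvgcM u v l m : cvgc u l -> cvgc v m -> cvgc (fun n => u n * v n) (l * m).
Proof. exact: (@cvgM R[i] nat \oo). Qed.

Lemma cvgc_cst l : cvgc (fun=> l) l.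
Proof. exact: (@cvg_cst R[i]^o). Qed.

Lemma cvgcZ (c : R[i]) u l : cvgc u l -> cvgc (fun n => c * u n) (c * l).
Proof. by apply: cvgcM; exact: cvgc_cst. Qed.

Lemma cvgc_geometric u v l C :
  (forall n, normc (u n - v n) <= C * 2^-1 ^+ n) -> cvgc v l -> cvgc u l.
Proof.
move=> uv vl; suff uv0 : cvgc (fun n => u n - v n) 0.
  exact: (@cvg_sub0 R[i] (R[i]^o) nat \oo _ u v l uv0 vl).
apply/cvgcP => e e0.
move/cvgr0_norm_lt : (cvg_half_expr C) => /(_ _ e0); apply: filterS => n.
by rewrite subr0; apply: le_lt_trans; rewrite (le_trans (uv n)) ?ler_norm.
Qed.

Lemma geometric_cauchy_cvg (x : nat -> R) C :
  (forall n m, (n <= m)%N -> `|x m - x n| <= C * 2^-1 ^+ n) -> cvgn x.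
Proof.
move=> xC; apply: R_complete; apply/cauchy_exP => e e0.
move/cvgr0_norm_lt : (cvg_half_expr C) => /(_ _ e0)[N _ CN].
exists (x N); exists N => // n Nn; rewrite /ball /= distrC.
by apply: le_lt_trans (xC _ _ Nn) _; rewrite (le_lt_trans (ler_norm _)) ?CN /=.
Qed.

Lemma geometric_cauchy_cvgc u C :
  (forall n m, (n <= m)%N -> normc (u m - u n) <= C * 2^-1 ^+ n) ->
  exists l, cvgc u l.
Proof.
move=> uC.
pose re n := complex.Re (u n); pose im n := complex.Im (u n).
have /cvgrPdist_lt ua : re @ \oo --> limn re.
  apply: (@geometric_cauchy_cvg _ C) => n m /uC; apply: le_trans.
  by rewrite -raddfB normRe_le.
have /cvgrPdist_lt ub : im @ \oo --> limn im.
  apply: (@geometric_cauchy_cvg _ C) => n m /uC; apply: le_trans.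
  by rewrite -raddfB normIm_le.
exists (limn re +i* limn im); apply/cvgcP => e e0; near=> n.
rewrite distcC; apply: le_lt_trans (normc_le_ReIm _) _.
rewrite [ltRHS](splitr e) !raddfB /=; apply: ltrD; near: n.
  by apply: ua; rewrite divr_gt0.
by apply: ub; rewrite divr_gt0.
Unshelve. all: by end_near. Qed.

End ComplexLimits.

Arguments cvgc_cst {R} l.
Arguments cvgcZ {R} c [u l].

Section SquareSums.

Definition sqsum (V : nmodType) (n : nat) (f : nat -> nat -> V) : V :=
  \sum_(i < n) \sum_(j < n) f i j.

Lemma eq_sqsum (V : nmodType) n (f g : nat -> nat -> V) :
  (forall i j, (i < n)%N -> (j < n)%N -> f i j = g i j) ->
  sqsum n f = sqsum n g.
Proof. by move=> fg; apply: eq_bigr => i _; apply: eq_bigr => j _; exact: fg. Qed.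

Lemma sqsumD (V : nmodType) n (f g : nat -> nat -> V) :
  sqsum n (fun i j => f i j + g i j) = sqsum n f + sqsum n g.
Proof. by rewrite -big_split; apply: eq_bigr => i _; rewrite -big_split. Qed.

Lemma sqsumB (V : zmodType) n (f g : nat -> nat -> V) :
  sqsum n (fun i j => f i j - g i j) = sqsum n f - sqsum n g.
Proof. by rewrite -sumrB; apply: eq_bigr => i _; rewrite -sumrB. Qed.

Lemma sqsumZ (K : pzSemiRingType) n (c : K) f :
  sqsum n (fun i j => c * f i j) = c * sqsum n f.
Proof. by rewrite mulr_sumr; apply: eq_bigr => i _; rewrite mulr_sumr. Qed.

Lemma sqsumZr (K : pzSemiRingType) n (c : K) f :
  sqsum n (fun i j => f i j * c) = sqsum n f * c.
Proof. by rewrite mulr_suml; apply: eq_bigr => i _; rewrite mulr_suml. Qed.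

Lemma sqsum_swap (V : nmodType) n (f : nat -> nat -> V) :
  sqsum n (fun i j => f j i) = sqsum n f.
Proof. exact: exchange_big. Qed.

Lemma sqsum_widen (V : nmodType) n m (f : nat -> nat -> V) : (n <= m)%N ->
  sqsum n f = sqsum m (fun i j => if (i < n)%N && (j < n)%N then f i j else 0).
Proof.
move=> nm; rewrite /sqsum (big_ord_widen m (fun i => \sum_(j < n) f i j)) //.
rewrite big_mkcond /=; apply: eq_bigr => i _; case: ifP => _; last by rewrite big1.
by rewrite (big_ord_widen m (f i)) // big_mkcond.
Qed.

Lemma sqsum_single (V : nmodType) n i0 j0 (f : nat -> nat -> V) :
  (i0 < n)%N -> (j0 < n)%N -> (forall i j, (i, j) != (i0, j0) -> f i j = 0) ->
  sqsum n f = f i0 j0.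
Proof.
move=> hi hj f0; rewrite /sqsum (bigD1 (Ordinal hi)) //= (bigD1 (Ordinal hj)) //=.
rewrite !big1 ?addr0 // => [i|j] neq.
  by rewrite big1 // => j _; apply: f0; apply: contra neq => /eqP[? _]; exact/eqP/val_inj.
by apply: f0; apply: contra neq => /eqP[?]; exact/eqP/val_inj.
Qed.

Lemma sqsumM (K : pzSemiRingType) n (a b : nat -> nat -> K) :
  sqsum n a * sqsum n b =
  sqsum n (fun i j => sqsum n (fun i' j' => a i j * b i' j')).
Proof. by rewrite -sqsumZr; apply: eq_sqsum => i j _ _; rewrite -sqsumZ. Qed.

Lemma sum_triangle (V : nmodType) n (t : nat -> nat -> V) :
  \sum_(p < n) \sum_(i < p.+1) t i (p - i)%N =
  \sum_(i < n) \sum_(j < n | (i + j < n)%N) t i j.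
Proof.
transitivity (\sum_(p < n) \sum_(i < n | (i <= p)%N) t i (p - i)%N).
  by apply: eq_bigr => p _; rewrite (big_ord_widen n (fun i => t i (p - i)%N)).
rewrite (exchange_big_dep xpredT) //=; apply: eq_bigr => i _.
rewrite -(big_mkord (fun p => (i <= p)%N) (fun p => t i (p - i)%N)).
rewrite -(big_mkord (fun j => (i + j < n)%N) (fun j => t i j)).
rewrite (@big_cat_nat _ _ _ i) //=; last exact: ltnW.
rewrite big_nat_cond big1 ?add0r; last by move=> p; lia.
rewrite -{1}[nat_of_ord i]add0n big_addn.
rewrite [RHS](@big_cat_nat _ _ _ (n - i)) ?leq_subr //=.
rewrite [X in _ = _ + X]big_nat_cond [X in _ = _ + X]big1 ?addr0; last by move=> p; lia.
rewrite [LHS]big_nat_cond [RHS]big_nat_cond.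
by apply: eq_big => p; [have := ltn_ord i; lia|rewrite addnK].
Qed.

Lemma sqsum_triangle (V : nmodType) n (t : nat -> nat -> nat -> nat -> V) :
  sqsum n (fun p q =>
    \sum_(i < p.+1) \sum_(j < q.+1) t i j (p - i)%N (q - j)%N) =
  sqsum n (fun i j => sqsum n (fun i' j' =>
    if (i + i' < n)%N && (j + j' < n)%N then t i j i' j' else 0)).
Proof.
transitivity (\sum_(p < n) \sum_(i < p.+1)
    (\sum_(q < n) \sum_(j < q.+1) t i j (p - i)%N (q - j)%N)).
  by apply: eq_bigr => p _; rewrite exchange_big.
rewrite (sum_triangle _ (fun i i' => \sum_(q < n) \sum_(j < q.+1) t i j i' (q - j)%N)).
apply: eq_bigr => i _; rewrite big_mkcond /= exchange_big /=; apply: eq_bigr => i' _.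
case: ifP => _ /=; last by rewrite big1 // => j _; rewrite big1.
rewrite (sum_triangle _ (fun j j' => t i j i' j')); apply: eq_bigr => j _.
by rewrite big_mkcond.
Qed.

Lemma ler_sqsum (K : numDomainType) n (f g : nat -> nat -> K) :
  (forall i j, (i < n)%N -> (j < n)%N -> f i j <= g i j) ->
  sqsum n f <= sqsum n g.
Proof. by move=> fg; apply: ler_sum => i _; apply: ler_sum => j _; exact: fg. Qed.

Lemma sqsum_ge0 (K : numDomainType) n (f : nat -> nat -> K) :
  (forall i j, 0 <= f i j) -> 0 <= sqsum n f.
Proof. by move=> f0; apply: sumr_ge0 => i _; apply: sumr_ge0. Qed.

Lemma ler_sqsum_widen (K : numDomainType) n m (f : nat -> nat -> K) :
  (n <= m)%N -> (forall i j, 0 <= f i j) -> sqsum n f <= sqsum m f.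
Proof.
by move=> nm f0; rewrite (sqsum_widen _ nm); apply: ler_sqsum => i j _ _; case: ifP.
Qed.

Lemma normc_sqsum_le (R : realType) n (f : nat -> nat -> R[i]) g :
  (forall i j, (i < n)%N -> (j < n)%N -> normc (f i j) <= g i j) ->
  normc (sqsum n f) <= sqsum n g.
Proof.
move=> fg; apply: le_trans (normc_sum_le _ _ _) _; apply: ler_sum => i _.
by apply: le_trans (normc_sum_le _ _ _) _; apply: ler_sum => j _; exact: fg.
Qed.

Lemma sqsum_row0 (V : nmodType) n (f : nat -> nat -> V) :
  (forall i j, f i.+1 j = 0) -> sqsum n f = \sum_(j < n) f 0%N j.
Proof.
move=> f0; rewrite /sqsum; case: n => [|n]; first by rewrite !big_ord0.
by rewrite big_ord_recl /= [X in _ + X]big1 ?addr0 // => i _; rewrite big1.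
Qed.

End SquareSums.

Section DoubleSeries.
Variable R : realType.
Implicit Types (A B : nat -> nat -> R[i]) (x y s t : R[i]) (eps M : R).

Definition dseries A x y (n : nat) : R[i] :=
  sqsum n (fun i j => A i j * x ^+ i * y ^+ j).

Definition dsummable A eps M : Prop :=
  forall n, sqsum n (fun i j => normc (A i j) * eps ^+ (i + j)) <= M.

Lemma normc_expr_ge0 z eps n : 0 <= eps -> 0 <= normc z * eps ^+ n :> R.
Proof. by move=> eps0; rewrite mulr_ge0 ?normc_ge0 ?exprn_ge0. Qed.

Lemma half_expr_ge0 n : 0 <= 2^-1 ^+ n :> R.
Proof. by rewrite exprn_ge0 ?invr_ge0. Qed.

Lemma ler_half_expr (m n : nat) : (m <= n)%N -> 2^-1 ^+ n <= 2^-1 ^+ m :> R.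
Proof.
by move=> mn; apply: ler_wiXn2l => //; rewrite ?invr_ge0 // invf_le1 // ler1n.
Qed.

Lemma dsummable_le A eps eps' M :
  0 <= eps' <= eps -> dsummable A eps M -> dsummable A eps' M.
Proof.
move=> /andP[e0 ee'] AM n; apply: le_trans (AM n); apply: ler_sqsum => i j _ _.
by rewrite ler_wpM2l ?normc_ge0 // lerXn2r // nnegrE // (le_trans e0).
Qed.

Lemma dsummableD A B eps M M' :
  0 <= eps -> dsummable A eps M -> dsummable B eps M' ->
  dsummable (fun i j => A i j + B i j) eps (M + M').
Proof.
move=> e0 AM BM n; apply: le_trans (lerD (AM n) (BM n)).
rewrite -sqsumD; apply: ler_sqsum => i j _ _.
by rewrite -mulrDl ler_wpM2r ?exprn_ge0 // le_normcD.
Qed.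

Lemma dsummableZ c A eps M :
  dsummable A eps M -> dsummable (fun i j => c * A i j) eps (normc c * M).
Proof.
move=> AM n; apply: le_trans (ler_wpM2l (normc_ge0 c) (AM n)).
by rewrite -sqsumZ; apply: ler_sqsum => i j _ _; rewrite normcM mulrA.
Qed.

Lemma dsummable_swap A eps M :
  dsummable A eps M -> dsummable (fun i j => A j i) eps M.
Proof.
move=> AM n; apply: le_trans (AM n); rewrite -sqsum_swap.
by apply: ler_sqsum => i j _ _; rewrite addnC.
Qed.

Lemma dseriesD A B x y n :
  dseries (fun i j => A i j + B i j) x y n = dseries A x y n + dseries B x y n.
Proof. by rewrite -sqsumD; apply: eq_sqsum => i j _ _; rewrite !mulrDl. Qed.

Lemma dseriesZ c A x y n : dseries (fun i j => c * A i j) x y n = c * dseries A x y n.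
Proof. by rewrite -sqsumZ; apply: eq_sqsum => i j _ _; rewrite !mulrA. Qed.

Lemma dseries_swap A x y n : dseries (fun i j => A j i) y x n = dseries A x y n.
Proof. by rewrite /dseries -sqsum_swap; apply: eq_sqsum => i j _ _; rewrite mulrAC. Qed.

Lemma normc_dterm_le A x y eps i j : normc x <= eps -> normc y <= eps ->
  normc (A i j * x ^+ i * y ^+ j) <= normc (A i j) * eps ^+ (i + j).
Proof.
move=> hx hy; have r0 : 0 <= eps := le_trans (normc_ge0 _) hx.
rewrite !normcM !normcX exprD mulrA.
apply: ler_pM; rewrite ?mulr_ge0 ?exprn_ge0 ?normc_ge0 //.
  by rewrite ler_wpM2l ?normc_ge0 // lerXn2r // nnegrE ?normc_ge0.
by rewrite lerXn2r // nnegrE ?normc_ge0.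
Qed.

(* On half the radius of summability the terms outside the square of side [n]
   gain a factor [2^-n]. *)
Lemma normc_dterm_half_le A x y eps n i j :
  normc x <= eps / 2 -> normc y <= eps / 2 -> (n <= i + j)%N ->
  normc (A i j * x ^+ i * y ^+ j) <=
  normc (A i j) * eps ^+ (i + j) * 2^-1 ^+ n.
Proof.
move=> hx hy nij; apply: le_trans (normc_dterm_le A i j hx hy) _.
have e0 : 0 <= eps by have := le_trans (normc_ge0 _) hx; lra.
by rewrite exprMn mulrA ler_wpM2l ?normc_expr_ge0 // ler_half_expr.
Qed.

Lemma dseries_cauchy A x y eps M n m :
  normc x <= eps / 2 -> normc y <= eps / 2 -> dsummable A eps M -> (n <= m)%N ->
  normc (dseries A x y m - dseries A x y n) <= M * 2^-1 ^+ n.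
Proof.
move=> hx hy AM nm; have e0 : 0 <= eps by have := le_trans (normc_ge0 _) hx; lra.
rewrite {2}/dseries (sqsum_widen _ nm) -sqsumB.
apply: le_trans (ler_wpM2r (half_expr_ge0 n) (AM m)); rewrite -sqsumZr.
apply: normc_sqsum_le => i j _ _; case: ifP => hij.
  by rewrite subrr normc0 mulr_ge0 ?normc_expr_ge0 ?half_expr_ge0.
by rewrite subr0 normc_dterm_half_le //; lia.
Qed.

Lemma dseries_cvg A x y eps M : normc x <= eps / 2 -> normc y <= eps / 2 ->
  dsummable A eps M -> exists l, cvgc (dseries A x y) l.
Proof.
move=> hx hy AM; apply: (@geometric_cauchy_cvgc _ _ M) => n m.
exact: dseries_cauchy hx hy AM.
Qed.

Definition dconv A B (p q : nat) : R[i] :=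
  \sum_(i < p.+1) \sum_(j < q.+1) A i j * B (p - i)%N (q - j)%N.

Lemma dsummable_conv A B eps M M' : 0 <= eps ->
  dsummable A eps M -> dsummable B eps M' -> dsummable (dconv A B) eps (M * M').
Proof.
move=> e0 AM BM n.
pose a i j := normc (A i j) * eps ^+ (i + j).
pose b i j := normc (B i j) * eps ^+ (i + j).
have a0 i j : 0 <= a i j by exact: normc_expr_ge0.
have b0 i j : 0 <= b i j by exact: normc_expr_ge0.
apply: le_trans (ler_pM (sqsum_ge0 _ a0) (sqsum_ge0 _ b0) (AM n) (BM n)).
rewrite sqsumM; apply: (@le_trans _ _ (sqsum n (fun p q =>
    \sum_(i < p.+1) \sum_(j < q.+1) a i j * b (p - i)%N (q - j)%N))).
  apply: ler_sqsum => p q _ _.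
  apply: le_trans (ler_wpM2r (exprn_ge0 _ e0) (normc_sum_le _ _ _)) _.
  rewrite mulr_suml; apply: ler_sum => i _.
  apply: le_trans (ler_wpM2r (exprn_ge0 _ e0) (normc_sum_le _ _ _)) _.
  rewrite mulr_suml; apply: ler_sum => j _; rewrite normcM /a /b mulrACA -exprD.
  by rewrite addnACA !subnKC // -ltnS.
rewrite (sqsum_triangle n (fun i j i' j' => a i j * b i' j'));
  apply: ler_sqsum => i j _ _; apply: ler_sqsum => i' j' _ _.
by case: ifP => // _; rewrite mulr_ge0.
Qed.

Lemma dseries_conv A B x y n : dseries (dconv A B) x y n =
  sqsum n (fun i j => sqsum n (fun i' j' =>
    if (i + i' < n)%N && (j + j' < n)%N
    then A i j * x ^+ i * y ^+ j * (B i' j' * x ^+ i' * y ^+ j') else 0)).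
Proof.
rewrite -(sqsum_triangle _ (fun i j i' j' =>
  A i j * x ^+ i * y ^+ j * (B i' j' * x ^+ i' * y ^+ j'))).
apply: eq_sqsum => p q _ _; rewrite !mulr_suml; apply: eq_bigr => i _.
rewrite !mulr_suml; apply: eq_bigr => j _.
have xp : x ^+ p = x ^+ i * x ^+ (p - i) by rewrite -exprD subnKC // -ltnS.
have yq : y ^+ q = y ^+ j * y ^+ (q - j) by rewrite -exprD subnKC // -ltnS.
by rewrite xp yq; ring.
Qed.

Lemma dseriesM_conv_le A B x y eps M M' n :
  normc x <= eps / 2 -> normc y <= eps / 2 ->
  dsummable A eps M -> dsummable B eps M' ->
  normc (dseries (dconv A B) x y n - dseries A x y n * dseries B x y n)
    <= M * M' * 2^-1 ^+ n.
Proof.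
move=> hx hy AM BM; have e0 : 0 <= eps by have := le_trans (normc_ge0 _) hx; lra.
pose a i j := normc (A i j) * eps ^+ (i + j).
pose b i j := normc (B i j) * eps ^+ (i + j).
have a0 i j : 0 <= a i j by exact: normc_expr_ge0.
have b0 i j : 0 <= b i j by exact: normc_expr_ge0.
apply: le_trans (ler_wpM2r (half_expr_ge0 n)
  (ler_pM (sqsum_ge0 _ a0) (sqsum_ge0 _ b0) (AM n) (BM n))).
rewrite dseries_conv sqsumM [in leRHS]sqsumM -sqsumB -sqsumZr.
apply: normc_sqsum_le => i j _ _; rewrite -sqsumB -sqsumZr.
apply: normc_sqsum_le => i' j' _ _; case: ifP => out.
  by rewrite subrr normc0 (mulr_ge0 (mulr_ge0 _ _) (half_expr_ge0 n)).
rewrite sub0r normcN normcM.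
apply: le_trans (ler_pM (normc_ge0 _) (normc_ge0 _)
  (normc_dterm_half_le A hx hy (leqnn (i + j)))
  (normc_dterm_half_le B hx hy (leqnn (i' + j')))) _.
rewrite mulrACA -exprD ler_wpM2l ?(mulr_ge0 (a0 _ _) (b0 _ _)) //.
by apply: ler_half_expr; move: out; lia.
Qed.

Lemma dseries_conv_cvg A B x y eps M M' h h' :
  normc x <= eps / 2 -> normc y <= eps / 2 ->
  dsummable A eps M -> dsummable B eps M' ->
  cvgc (dseries A x y) h -> cvgc (dseries B x y) h' ->
  cvgc (dseries (dconv A B) x y) (h * h').
Proof.
move=> hx hy AM BM Ah Bh.
apply: (cvgc_geometric (fun n => dseriesM_conv_le n hx hy AM BM)).
exact: cvgcM.
Qed.

Definition dseries_dx A (i j : nat) : R[i] := i.+1%:R * A i.+1 j.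
Definition dseries_dy A (i j : nat) : R[i] := j.+1%:R * A i j.+1.

Lemma nat_half_expr_le1 n : n.+1%:R * 2^-1 ^+ n <= 1 :> R.
Proof.
by rewrite exprVn ler_pdivrMr ?exprn_gt0 // mul1r -natrX ler_nat ltn_expl.
Qed.

Lemma dsummable_dx A eps M : 0 < eps -> dsummable A eps M ->
  dsummable (dseries_dx A) (eps / 2) (M / eps).
Proof.
move=> e0 AM n; rewrite ler_pdivlMr //; apply: le_trans (AM n.+1).
have t0 i j : 0 <= normc (A i j) * eps ^+ (i + j) by apply: normc_expr_ge0; exact: ltW.
rewrite [leRHS]/sqsum big_ord_recl /= ler_wpDl ?sumr_ge0 // mulr_suml.
apply: ler_sum => i _; rewrite big_ord_recr /= ler_wpDr // mulr_suml.
apply: ler_sum => j _.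
rewrite normcM normc_nat exprMn /bump /= add1n addSn exprS.
have -> : i.+1%:R * normc (A i.+1 j) * (eps ^+ (i + j) * 2^-1 ^+ (i + j)) * eps =
  normc (A i.+1 j) * (eps * eps ^+ (i + j)) * (i.+1%:R * 2^-1 ^+ (i + j)) by ring.
rewrite -[leRHS]mulr1 ler_wpM2l //.
  by rewrite -exprS normc_expr_ge0 // ltW.
by apply: le_trans (nat_half_expr_le1 i);
  rewrite ler_wpM2l ?ler0n // ler_half_expr ?leq_addr.
Qed.

Lemma dsummable_dy A eps M : 0 < eps -> dsummable A eps M ->
  dsummable (dseries_dy A) (eps / 2) (M / eps).
Proof. by move=> e0 /dsummable_swap/(dsummable_dx e0)/dsummable_swap. Qed.

Definition termwise_dx A x y n : R[i] :=
  sqsum n (fun i j => A i j * (i%:R * x ^+ i.-1) * y ^+ j).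

Definition termwise_dy A x y n : R[i] :=
  sqsum n (fun i j => A i j * x ^+ i * (j%:R * y ^+ j.-1)).

Lemma termwise_dxS A x y n : termwise_dx A x y n.+1 =
  dseries (dseries_dx A) x y n + \sum_(i < n) dseries_dx A i n * x ^+ i * y ^+ n.
Proof.
rewrite [LHS]/sqsum big_ord_recl big1 ?add0r /=; last first.
  by move=> j _; rewrite !(mul0r, mulr0).
rewrite -big_split /=; apply: eq_bigr => i _; rewrite big_ord_recr /= /dseries_dx.
by congr (_ + _); [apply: eq_bigr => j _|]; rewrite /bump /= add1n; ring.
Qed.

Lemma termwise_dx_cvg A x y eps M l : 0 < eps ->
  normc x <= eps / 4 -> normc y <= eps / 4 -> dsummable A eps M ->
  cvgc (dseries (dseries_dx A) x y) l -> cvgc (termwise_dx A x y) l.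
Proof.
move=> e0 hx hy AM xl; rewrite -(cvg_shiftS (termwise_dx A x y : nat -> R[i]^o)).
apply: (@cvgc_geometric _ _ _ _ (M / eps) _ xl) => n /=.
rewrite termwise_dxS addrC addKr; apply: le_trans (normc_sum_le _ _ _) _.
have e2 : 0 <= eps / 2 by lra.
have hx2 : normc x <= eps / 2 / 2 by lra.
have hy2 : normc y <= eps / 2 / 2 by lra.
apply: le_trans (ler_wpM2r (half_expr_ge0 n) (dsummable_dx e0 AM n.+1)).
rewrite -sqsumZr [leRHS]/sqsum big_ord_recr /= ler_wpDr //.
  by apply: sumr_ge0 => j _; rewrite mulr_ge0 ?normc_expr_ge0 ?half_expr_ge0.
apply: ler_sum => i _; rewrite big_ord_recr /= ler_wpDl //.
  by apply: sumr_ge0 => j _; rewrite mulr_ge0 ?normc_expr_ge0 ?half_expr_ge0.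
by apply: normc_dterm_half_le; rewrite ?leq_addl.
Qed.

Lemma termwise_dy_cvg A x y eps M l : 0 < eps ->
  normc x <= eps / 4 -> normc y <= eps / 4 -> dsummable A eps M ->
  cvgc (dseries (dseries_dy A) x y) l -> cvgc (termwise_dy A x y) l.
Proof.
move=> e0 hx hy AM.
have -> : dseries (dseries_dy A) x y = dseries (dseries_dx (fun i j => A j i)) y x.
  by apply/funext => n; rewrite -dseries_swap.
have -> : termwise_dy A x y = termwise_dx (fun i j => A j i) y x.
  apply/funext => n; rewrite /termwise_dx -sqsum_swap.
  by apply: eq_sqsum => i j _ _; ring.
exact: termwise_dx_cvg (dsummable_swap AM).
Qed.

(* Bounds on a monomial of degree [k], on its linear part and on the error of
   its first order expansion, set up so as to pass from [b] to [x * b]. *)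
Definition monomial_expansion (r sg : R) (k : nat) (a b L : R[i]) : Prop :=
  [/\ normc b <= r ^+ k, normc L * r <= sg * k%:R * r ^+ k &
      normc (a - b - L) * r ^+ 2 <= sg ^+ 2 * k%:R ^+ 2 * r ^+ k].

Lemma monomial_expansionM (r sg : R) k a b L x s :
  normc x <= r -> normc (x + s) <= r -> normc s <= sg ->
  monomial_expansion r sg k a b L ->
  monomial_expansion r sg k.+1 ((x + s) * a) (x * b) (s * b + x * L).
Proof.
move=> hx hxs hs [hb hL hR].
have r0 : 0 <= r := le_trans (normc_ge0 _) hx.
have s0 : 0 <= sg := le_trans (normc_ge0 _) hs.
have rk : 0 <= r ^+ k by exact: exprn_ge0.
split.
- by rewrite normcM exprS; apply: ler_pM => //; exact: normc_ge0.
- apply: le_trans (ler_wpM2r r0 (le_normcD _ _)) _; rewrite !normcM exprS -natr1.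
  have sb := ler_wpM2r r0 (ler_pM (normc_ge0 _) (normc_ge0 _) hs hb).
  have xL : normc x * (normc L * r) <= r * (sg * k%:R * r ^+ k).
    by apply: ler_pM => //; rewrite ?mulr_ge0 ?normc_ge0.
  lra.
- have -> : (x + s) * a - x * b - (s * b + x * L) = (x + s) * (a - b - L) + s * L by ring.
  apply: le_trans (ler_wpM2r (exprn_ge0 _ r0) (le_normcD _ _)) _.
  rewrite !normcM (exprS r k) -natr1.
  have xsR : normc (x + s) * (normc (a - b - L) * r ^+ 2) <=
      r * (sg ^+ 2 * k%:R ^+ 2 * r ^+ k).
    by apply: ler_pM => //; rewrite ?mulr_ge0 ?normc_ge0 ?exprn_ge0.
  have sL : normc s * (normc L * r) * r <= sg * (sg * k%:R * r ^+ k) * r.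
    by rewrite ler_wpM2r //; apply: ler_pM; rewrite ?mulr_ge0 ?normc_ge0.
  have : 0 <= sg ^+ 2 * r ^+ k * r * (k%:R + 1).
    by rewrite !mulr_ge0 ?exprn_ge0 ?addr_ge0 ?ler0n.
  lra.
Qed.

Lemma monomial_expansion_XY x y s t (r sg : R) i j :
  normc x <= r -> normc y <= r -> normc (x + s) <= r -> normc (y + t) <= r ->
  normc s <= sg -> normc t <= sg ->
  monomial_expansion r sg (i + j)
    ((x + s) ^+ i * (y + t) ^+ j) (x ^+ i * y ^+ j)
    (s * (i%:R * x ^+ i.-1 * y ^+ j) + t * (x ^+ i * (j%:R * y ^+ j.-1))).
Proof.
move=> hx hy hxs hyt hs ht; elim: i => [|i IH]; last first.
  have := monomial_expansionM hx hxs hs IH; rewrite addSn !exprS !mulrA.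
  congr monomial_expansion; case: i {IH} => [|i]; rewrite /= ?expr0 ?exprS -?natr1; ring.
rewrite add0n; elim: j => [|j IH].
  rewrite !(mul0r, mulr0, addr0) /monomial_expansion !expr0 mulr1 subrr subr0.
  by split; rewrite ?normc1 ?normc0 ?expr0n ?mul0r ?mulr0 ?mul0r.
have := monomial_expansionM hy hyt ht IH; rewrite !exprS.
congr monomial_expansion; rewrite ?expr0; try ring.
case: j {IH} => [|j]; rewrite /= ?expr0 ?exprS -?natr1; ring.
Qed.

Lemma dterm_expansion_le A x y s t eps (sg : R) i j : 0 < eps ->
  normc x <= eps / 4 -> normc y <= eps / 4 ->
  normc (x + s) <= eps / 4 -> normc (y + t) <= eps / 4 ->
  normc s <= sg -> normc t <= sg ->
  normc (A i j * (x + s) ^+ i * (y + t) ^+ j - A i j * x ^+ i * y ^+ j -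
    (s * (A i j * (i%:R * x ^+ i.-1) * y ^+ j) +
     t * (A i j * x ^+ i * (j%:R * y ^+ j.-1)))) <=
  normc (A i j) * eps ^+ (i + j) * ((4 / eps) ^+ 2 * sg ^+ 2).
Proof.
move=> e0 hx hy hxs hyt hs ht.
have [_ _ hR] := monomial_expansion_XY i j hx hy hxs hyt hs ht.
have -> : A i j * (x + s) ^+ i * (y + t) ^+ j - A i j * x ^+ i * y ^+ j -
    (s * (A i j * (i%:R * x ^+ i.-1) * y ^+ j) +
     t * (A i j * x ^+ i * (j%:R * y ^+ j.-1))) =
  A i j * ((x + s) ^+ i * (y + t) ^+ j - x ^+ i * y ^+ j -
    (s * (i%:R * x ^+ i.-1 * y ^+ j) + t * (x ^+ i * (j%:R * y ^+ j.-1)))) by ring.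
rewrite normcM -[leRHS]mulrA ler_wpM2l ?normc_ge0 //.
rewrite -(@ler_pM2r _ ((eps / 4) ^+ 2)) ?exprn_gt0 ?divr_gt0 //.
apply: le_trans hR _.
have -> : eps ^+ (i + j) * ((4 / eps) ^+ 2 * sg ^+ 2) * (eps / 4) ^+ 2 =
  sg ^+ 2 * eps ^+ (i + j) by field; rewrite lt0r_neq0.
rewrite -mulrA ler_wpM2l ?sqr_ge0 // exprMn mulrCA ler_piMr ?exprn_ge0 ?(ltW e0) //.
rewrite exprVn ler_pdivrMr ?exprn_gt0 // mul1r -!natrX ler_nat.
by rewrite (_ : 4 = 2 ^ 2)%N // -expnM mulnC expnM leq_exp2r // ltnW // ltn_expl.
Qed.

Lemma dseries_expansion A x y s t eps M (sg : R) (h0 h1 hx hy : R[i]) : 0 < eps ->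
  normc x <= eps / 4 -> normc y <= eps / 4 ->
  normc (x + s) <= eps / 4 -> normc (y + t) <= eps / 4 ->
  normc s <= sg -> normc t <= sg -> dsummable A eps M ->
  cvgc (dseries A x y) h0 -> cvgc (dseries A (x + s) (y + t)) h1 ->
  cvgc (dseries (dseries_dx A) x y) hx -> cvgc (dseries (dseries_dy A) x y) hy ->
  normc (h1 - h0 - (s * hx + t * hy)) <= M * ((4 / eps) ^+ 2 * sg ^+ 2).
Proof.
move=> e0 xe ye xse yte se te AM c0 c1.
move=> /(termwise_dx_cvg e0 xe ye AM) cx /(termwise_dy_cvg e0 xe ye AM) cy.
apply: cvgc_le (cvgcB (cvgcB c1 c0) (cvgcD (cvgcZ s cx) (cvgcZ t cy))) _ => n.
have sg0 : 0 <= (4 / eps) ^+ 2 * sg ^+ 2 by rewrite mulr_ge0 ?sqr_ge0.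
apply: le_trans (ler_wpM2r sg0 (AM n)); rewrite -sqsumZr.
rewrite /= -!sqsumZ -!sqsumD -!sqsumB.
by apply: normc_sqsum_le => i j _ _; exact: dterm_expansion_le.
Qed.

End DoubleSeries.

(** * The operator d/dtau *)

Section BigOX.
Variable R : realType.
Implicit Types (r s : R[i] -> R[i]) (z w c : R[i]).

Lemma near0_shift z (P : R[i] -> Prop) :
  (\forall w \near (z : R[i]^o), P w) <->
  \forall w \near (0 : R[i]^o), P (z + w).
Proof.
by split=> /nbhs_normcP[d d0 Pd]; apply/nbhs_normcP; exists d => // w /Pd; rewrite add0r.
Qed.

Lemma near0_normc_lt (d : R) : 0 < d ->
  \forall w \near (0 : R[i]^o), normc w < d.
Proof. by move=> d0; apply/nbhs_normcP; exists d => // w; rewrite add0r. Qed.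

Definition bigOX (k : nat) r : Prop :=
  exists C : R, \forall w \near (0 : R[i]^o), normc (r w) <= C * normc w ^+ k.

Lemma bigOX_ge0 k r : bigOX k r -> exists2 C : R, 0 <= C &
  \forall w \near (0 : R[i]^o), normc (r w) <= C * normc w ^+ k.
Proof.
move=> [C rC]; exists `|C| => //; apply: filterS rC => w /le_trans; apply.
by rewrite ler_wpM2r ?exprn_ge0 ?normc_ge0 // ler_norm.
Qed.

Lemma bigOX_near k r s : (\forall w \near (0 : R[i]^o), r w = s w) ->
  bigOX k r -> bigOX k s.
Proof. by move=> rs [C rC]; exists C; apply: filterS2 rs rC => w ->. Qed.

Lemma eq_bigOX k r s : r =1 s -> bigOX k r -> bigOX k s.
Proof. by move=> /funext ->. Qed.

Lemma bigOX_le k l r : (l <= k)%N -> bigOX k r -> bigOX l r.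
Proof.
move=> lk /bigOX_ge0[C C0 rC]; exists C.
apply: filterS2 (near0_normc_lt ltr01) rC => w /ltW w1 /le_trans; apply.
by rewrite ler_wpM2l // ler_wiXn2l ?normc_ge0.
Qed.

Lemma bigOXD k r s : bigOX k r -> bigOX k s -> bigOX k (fun w => r w + s w).
Proof.
move=> [C rC] [D sD]; exists (C + D); apply: filterS2 rC sD => w rw sw.
by apply: le_trans (le_normcD _ _) _; rewrite mulrDl lerD.
Qed.

Lemma bigOXM k l r s :
  bigOX k r -> bigOX l s -> bigOX (k + l) (fun w => r w * s w).
Proof.
move=> [C rC] [D sD]; exists (C * D); apply: filterS2 rC sD => w rw sw.
by rewrite normcM exprD mulrACA ler_pM ?normc_ge0.
Qed.

Lemma bigOX_cst c : bigOX 0 (fun=> c).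
Proof. by exists (normc c); apply: filterE => w; rewrite expr0 mulr1. Qed.

Lemma bigOXZ k c r : bigOX k r -> bigOX k (fun w => c * r w).
Proof. by move=> /(bigOXM (bigOX_cst c)). Qed.

Lemma bigOX0 k : bigOX k (fun=> 0).
Proof. by exists 0; apply: filterE => w; rewrite normc0 mul0r. Qed.

Lemma bigOX_expr k : bigOX k (fun w => w ^+ k).
Proof. by exists 1; apply: filterE => w; rewrite mul1r normcX. Qed.

Lemma bigOX_id : bigOX 1 id.
Proof. exact: bigOX_expr. Qed.

Lemma bigOX_conjc : bigOX 1 (@conjc R).
Proof. by exists 1; apply: filterE => w; rewrite expr1 mul1r normc_conj. Qed.

Lemma bigOX_conj k r : bigOX k r -> bigOX k (fun w => conjc (r w)).
Proof. by move=> [C rC]; exists C; apply: filterS rC => w; rewrite normc_conj. Qed.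

Lemma bigOX1_lt r (e : R) : bigOX 1 r -> 0 < e ->
  \forall w \near (0 : R[i]^o), normc (r w) < e.
Proof.
move=> /bigOX_ge0[C C0 rC] e0; have C1 : 0 < C + 1 by lra.
apply: filterS2 (near0_normc_lt (divr_gt0 e0 C1)) rC => w we /le_lt_trans; apply.
rewrite expr1; apply: (@le_lt_trans _ _ ((C + 1) * normc w)).
  by rewrite ler_wpM2r ?normc_ge0 // lerDl.
by rewrite mulrC -ltr_pdivlMr.
Qed.

Lemma near0_comp s (P : R[i] -> Prop) : bigOX 1 s ->
  (\forall w \near (0 : R[i]^o), P w) -> \forall w \near (0 : R[i]^o), P (s w).
Proof.
move=> sO /nbhs_normcP[d d0 Pd]; apply: filterS (bigOX1_lt sO d0) => w /Pd.
by rewrite add0r.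
Qed.

Lemma bigOX_comp k r s : bigOX k r -> bigOX 1 s -> bigOX k (fun w => r (s w)).
Proof.
move=> /bigOX_ge0[C C0 rC] sO; have [D sD] := sO.
exists (C * D ^+ k); apply: filterS2 sD (near0_comp sO rC) => w sw /le_trans; apply.
rewrite -mulrA ler_wpM2l // -exprMn -[normc w]expr1.
by rewrite lerXn2r // nnegrE ?normc_ge0 // (le_trans _ sw) ?normc_ge0.
Qed.

Lemma bigOX_inv s c : c != 0 -> bigOX 1 (fun w => s w - c) ->
  (\forall w \near (0 : R[i]^o), s w != 0) /\ bigOX 0 (fun w => (s w)^-1).
Proof.
rewrite -normc_gt0 => c0 sc; have c20 : 0 < normc c / 2 by rewrite divr_gt0.
have low : \forall w \near (0 : R[i]^o), normc c / 2 < normc (s w).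
  apply: filterS (bigOX1_lt sc c20) => w; have := lercB_dist c (s w).
  rewrite distcC; lra.
split; first by apply: filterS low => w; rewrite -normc_gt0; exact: lt_trans.
exists (normc c / 2)^-1; apply: filterS low => w sw.
by rewrite expr0 mulr1 normcV lef_pV2 ?posrE ?(ltW sw) // (lt_trans c20).
Qed.

Lemma bigOX_at0 k r : bigOX k.+1 r -> r 0 = 0.
Proof.
move=> [C /nbhs_singleton]; rewrite normc0 expr0n mulr0 => r0.
by apply/eqP; rewrite -normc_eq0 eq_le r0 normc_ge0.
Qed.

End BigOX.

Section DtauDerivative.
Variable R : realType.
Implicit Types (h g s : R[i] -> R[i]) (z w al be c : R[i]).

Definition is_dtau h z al : Prop :=
  exists be, bigOX 2 (fun w => h (z + w) - h z - (al * w + be * conjc w)).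

Definition is_cderive h z al : Prop :=
  bigOX 2 (fun w => h (z + w) - h z - al * w).

Lemma is_cderive_dtau h z al : is_cderive h z al -> is_dtau h z al.
Proof.
by move=> h_cderive; exists 0; apply: eq_bigOX h_cderive => w; rewrite mul0r addr0.
Qed.

Lemma derive1_quadratic (u : R -> R) (t a C d : R) : 0 < d ->
  (forall s : R, `|s| < d -> `|u (t + s) - u t - a * s| <= C * `|s| ^+ 2) ->
  derive1 (u : R -> R^o) t = a.
Proof.
move=> d0 uC; rewrite derive1E; apply: cvg_lim => //.
apply/cvgrPdist_lt => e e0; near=> s.
have s0 : s != 0 by near: s; exact: nbhs_dnbhs_neq.
have C0 : 0 < `|C| + 1 by rewrite ltr_wpDl.
have : `|s| < Num.min d (e / (`|C| + 1)).
  by near: s; apply: dnbhs0_lt; rewrite lt_min d0 divr_gt0.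
rewrite lt_min => /andP[/uC us se].
rewrite /GRing.scale /= /GRing.scale /= mulr1 (addrC s t).
have -> : a - s^-1 * (u (t + s) - u t) = - (s^-1 * (u (t + s) - u t - a * s)).
  by field.
rewrite normrN normrM normfV ltr_pdivrMl ?normr_gt0 //.
apply: le_lt_trans us _; apply: (@le_lt_trans _ _ ((`|C| + 1) * `|s| ^+ 2)).
  by rewrite ler_wpM2r ?exprn_ge0 //; have := ler_norm C; lra.
by rewrite expr2 mulrCA ltr_pM2l ?normr_gt0 // mulrC -ltr_pdivlMr.
Unshelve. all: by end_near. Qed.

Lemma derive_line_quadratic (u : R -> R[i]) (t : R) (a : R[i]) (C d : R) : 0 < d ->
  (forall s : R, `|s| < d -> normc (u (t + s) - u t - a * s%:C) <= C * `|s| ^+ 2) ->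
  derive_line u t = a.
Proof.
move=> d0 uC; rewrite /derive_line.
have reE (s : R) : complex.Re (u (t + s) - u t - a * s%:C) =
    complex.Re (u (t + s)) - complex.Re (u t) - complex.Re a * s.
  by case: (u (t + s)) (u t) a {uC} => [x y] [x' y'] [b c] /=; ring.
have imE (s : R) : complex.Im (u (t + s) - u t - a * s%:C) =
    complex.Im (u (t + s)) - complex.Im (u t) - complex.Im a * s.
  by case: (u (t + s)) (u t) a {uC reE} => [x y] [x' y'] [b c] /=; ring.
rewrite (@derive1_quadratic _ t (complex.Re a) C d) //; last first.
  by move=> s /uC; apply: le_trans; rewrite -reE normRe_le.
rewrite (@derive1_quadratic _ t (complex.Im a) C d) //; last first.
  by move=> s /uC; apply: le_trans; rewrite -imE normIm_le.
by case: a {uC reE imE}.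
Qed.

Lemma is_dtau_val h z al : is_dtau h z al -> dtau_scalar h z = al.
Proof.
move=> [be [C /nbhs_normcP[d d0 hC]]]; rewrite /dtau_scalar.
have {}hC w : normc w < d ->
    normc (h (z + w) - h z - (al * w + be * conjc w)) <= C * normc w ^+ 2.
  by move/hC; rewrite add0r.
rewrite (@derive_line_quadratic _ _ (al + be) C d) //; last first.
  move=> s hs; have := hC s%:C; rewrite normc_real => /(_ hs).
  rewrite conjc_real -mulrDl; congr (normc (h _ - h _ - _) <= _).
    by case: (z) => a b /=; simpc.
  by case: (z).
rewrite (@derive_line_quadratic _ _ ('i * (al - be)) C d) //; last first.
  move=> s hs; have := hC ('i * s%:C); rewrite normcM normc_real.
  have -> : normc ('i : R[i]) = 1 by rewrite /= expr0n /= add0r expr1n sqrtr1.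
  rewrite mul1r => /(_ hs).
  have -> : conjc ('i * s%:C) = - ('i * s%:C) :> R[i] by simpc.
  congr (normc (h _ - h _ - _) <= _); last by ring.
    by case: (z) => a b /=; simpc.
  by case: (z).
rewrite -[0 +i* 1]/('i) mulrA -expr2 (sqr_i R); by field.
Qed.

Lemma is_dtau_eq h z al be : is_dtau h z al -> al = be -> is_dtau h z be.
Proof. by move=> ? <-. Qed.

Lemma is_dtau_bigOX1 h z al : is_dtau h z al -> bigOX 1 (fun w => h (z + w) - h z).
Proof.
move=> [be hO]; have := bigOXD (bigOX_le (leqnSn 1) hO)
  (bigOXD (bigOXZ al (@bigOX_id R)) (bigOXZ be (@bigOX_conjc R))).
by apply: eq_bigOX => w; ring.
Qed.

Lemma is_dtau_bigOX0 h z al : is_dtau h z al -> bigOX 0 (fun w => h (z + w)).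
Proof.
move=> /is_dtau_bigOX1/(bigOX_le (leq0n 1)) hO.
by have := bigOXD hO (bigOX_cst (h z)); apply: eq_bigOX => w; rewrite subrK.
Qed.

Lemma is_dtau_near h g z al :
  (\forall w \near (z : R[i]^o), h w = g w) -> is_dtau h z al -> is_dtau g z al.
Proof.
move=> hg [be hO]; exists be; apply: bigOX_near hO.
have <- := nbhs_singleton hg; move/near0_shift: hg.
by apply: filterS => w ->.
Qed.

Lemma is_dtau_ext h g z al : h =1 g -> is_dtau h z al -> is_dtau g z al.
Proof. by move=> /funext ->. Qed.

Lemma is_dtau_cst c z : is_dtau (fun=> c) z 0.
Proof.
by exists 0; apply: eq_bigOX (bigOX0 _ 2) => w; rewrite subrr !mul0r addr0 subr0.
Qed.

Lemma is_dtau_id z : is_dtau id z 1.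
Proof. by exists 0; apply: eq_bigOX (bigOX0 _ 2) => w; ring. Qed.

Lemma is_dtau_conj z : is_dtau (@conjc R) z 0.
Proof. by exists 1; apply: eq_bigOX (bigOX0 _ 2) => w; rewrite rmorphD; ring. Qed.

Lemma is_dtauD h g z al be : is_dtau h z al -> is_dtau g z be ->
  is_dtau (fun w => h w + g w) z (al + be).
Proof.
move=> [a hO] [b gO]; exists (a + b).
by apply: eq_bigOX (bigOXD hO gO) => w; ring.
Qed.

Lemma is_dtauM h g z al be : is_dtau h z al -> is_dtau g z be ->
  is_dtau (fun w => h w * g w) z (al * g z + h z * be).
Proof.
move=> h_dtau g_dtau; have gO0 := is_dtau_bigOX0 g_dtau.
move: h_dtau g_dtau => [a hO] [b gO].
have linO p q : bigOX 1 (fun w => p * w + q * conjc w).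
  by apply: bigOXD; apply: bigOXZ; [exact: bigOX_id|exact: bigOX_conjc].
have affO := bigOXD (bigOX_cst (h z)) (bigOX_le (leq0n 1) (linO al a)).
exists (a * g z + h z * b).
apply: eq_bigOX (bigOXD (bigOXD (bigOXM hO gO0) (bigOXM affO gO))
  (bigOXM (linO al a) (linO be b))) => w; ring.
Qed.

Lemma is_dtauZ c h z al : is_dtau h z al -> is_dtau (fun w => c * h w) z (c * al).
Proof. by move/(is_dtauM (is_dtau_cst c z)); rewrite mul0r add0r. Qed.

Lemma is_dtau_sum (I : Type) (r : seq I) (P : pred I) (h : I -> R[i] -> R[i])
    (al : I -> R[i]) z :
  (forall i, P i -> is_dtau (h i) z (al i)) ->
  is_dtau (fun w => \sum_(i <- r | P i) h i w) z (\sum_(i <- r | P i) al i).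
Proof.
move=> h_dtau; elim: r => [|i r IH].
  by rewrite big_nil; apply: is_dtau_ext (is_dtau_cst 0 z) => w; rewrite big_nil.
rewrite big_cons; case: ifP => Pi.
  by apply: is_dtau_ext (is_dtauD (h_dtau i Pi) IH) => w; rewrite big_cons Pi.
by apply: is_dtau_ext IH => w; rewrite big_cons Pi.
Qed.

Lemma is_dtauX h z al n : is_dtau h z al ->
  is_dtau (fun w => h w ^+ n) z (n%:R * al * h z ^+ n.-1).
Proof.
move=> h_dtau; elim: n => [|n IH].
  by rewrite !mul0r; apply: is_dtau_ext (is_dtau_cst 1 z) => w; rewrite expr0.
apply: is_dtau_eq (is_dtau_ext (fun w => esym (exprS (h w) n)) (is_dtauM h_dtau IH)) _.
by case: n {IH} => [|n]; rewrite /= ?exprS ?expr0 -?natr1; ring.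
Qed.

Lemma is_dtauV h z al : h z != 0 -> is_dtau h z al ->
  is_dtau (fun w => (h w)^-1) z (- (h z ^+ 2)^-1 * al).
Proof.
move=> hz0 h_dtau; have hO1 := is_dtau_bigOX1 h_dtau.
have [nz hVO] := bigOX_inv hz0 hO1.
move: h_dtau => [be hO]; exists (- (h z ^+ 2)^-1 * be).
have := bigOXD (bigOXZ (- (h z ^+ 2)^-1) hO)
  (bigOXM (bigOXZ (h z ^+ 2)^-1 (bigOXM hO1 hO1)) hVO).
by apply: bigOX_near; apply: filterS nz => w hw0; field; rewrite hz0.
Qed.

Lemma is_dtau_comp h s z al sg : is_dtau h (s z) al -> is_cderive s z sg ->
  is_dtau (fun w => h (s w)) z (al * sg).
Proof.
move=> [be hO] sO; have sO1 := is_dtau_bigOX1 (is_cderive_dtau sO).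
exists (be * conjc sg).
apply: eq_bigOX (bigOXD (bigOX_comp hO sO1)
  (bigOXD (bigOXZ al sO) (bigOXZ be (bigOX_conj sO)))) => w.
by rewrite (addrC (s z)) subrK !rmorphB !rmorphM /=; ring.
Qed.

End DtauDerivative.

Section Coordinates.
Variable R : realType.
Implicit Types (w : R[i]) (p : R[i] * R[i]).

Definition real_linear p w : R[i] := p.1 * w + p.2 * conjc w.

Lemma real_linearD p v w : real_linear p (v + w) = real_linear p v + real_linear p w.
Proof. by rewrite /real_linear rmorphD /=; ring. Qed.

(* The two variables of the power series: the real and imaginary parts for real
   analytic functions, [w] and [0] for holomorphic ones. *)
Record coordinates := Coordinates {
  coordx : R[i] * R[i];
  coordy : R[i] * R[i];
  normc_coordx_le : forall w, normc (real_linear coordx w) <= normc w;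
  normc_coordy_le : forall w, normc (real_linear coordy w) <= normc w;
  normc_le_coords : forall w,
    normc w <= normc (real_linear coordx w) + normc (real_linear coordy w) }.

Lemma real_linear_Re w : real_linear (2^-1, 2^-1) w = (complex.Re w)%:C.
Proof. by rewrite /real_linear -mulrDr addcJ mulrA mulVf ?mul1r // pnatr_eq0. Qed.

Lemma real_linear_Im w : real_linear (- ('i / 2), 'i / 2) w = (complex.Im w)%:C.
Proof. by rewrite ImJ_sub /real_linear mulNr addrC -mulrBr -mulrA mulrC (mulrC 2^-1). Qed.

Lemma real_linear_id w : real_linear (1, 0) w = w.
Proof. by rewrite /real_linear mul1r mul0r addr0. Qed.

Lemma real_linear_0 w : real_linear (0, 0) w = 0.
Proof. by rewrite /real_linear !mul0r addr0. Qed.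

Lemma normc_Re_le w : normc (real_linear (2^-1, 2^-1) w) <= normc w.
Proof. by rewrite real_linear_Re normc_real normRe_le. Qed.

Lemma normc_Im_le w : normc (real_linear (- ('i / 2), 'i / 2) w) <= normc w.
Proof. by rewrite real_linear_Im normc_real normIm_le. Qed.

Lemma normc_le_ReIm_coords w : normc w <=
  normc (real_linear (2^-1, 2^-1) w) + normc (real_linear (- ('i / 2), 'i / 2) w).
Proof. by rewrite real_linear_Re real_linear_Im !normc_real normc_le_ReIm. Qed.

Definition ReIm_coords : coordinates :=
  Coordinates normc_Re_le normc_Im_le normc_le_ReIm_coords.

Lemma normc_id_le w : normc (real_linear (1, 0) w) <= normc w.
Proof. by rewrite real_linear_id. Qed.

Lemma normc_0_le w : normc (real_linear (0, 0) w) <= normc w.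
Proof. by rewrite real_linear_0 normc0 normc_ge0. Qed.

Lemma normc_le_id0_coords w : normc w <=
  normc (real_linear (1, 0) w) + normc (real_linear (0, 0) w).
Proof. by rewrite real_linear_id real_linear_0 normc0 addr0. Qed.

Definition holomorphic_coords : coordinates :=
  Coordinates normc_id_le normc_0_le normc_le_id0_coords.

End Coordinates.

Section Analytic.
Variables (R : realType) (xy : coordinates R).
Implicit Types (h g : R[i] -> R[i]) (a z w c : R[i]) (A : nat -> nat -> R[i]).

Local Notation X := (real_linear (coordx xy)).
Local Notation Y := (real_linear (coordy xy)).

Definition has_dseries h a A (eps : R) : Prop :=
  forall w, normc (X w) <= eps -> normc (Y w) <= eps ->
    cvgc (dseries A (X w) (Y w)) (h (a + w)).

Definition analytic h a : Prop :=
  exists A (eps M : R), [/\ 0 < eps, dsummable A eps M & has_dseries h a A eps].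

Lemma analytic_small h a (d : R) : 0 < d -> analytic h a ->
  exists A (eps M : R), [/\ 0 < eps < d, dsummable A eps M & has_dseries h a A eps].
Proof.
move=> d0 [A [eps [M [e0 AM hA]]]]; exists A, (Num.min eps (d / 2)), M.
have d20 : 0 < d / 2 by rewrite divr_gt0.
have m0 : 0 < Num.min eps (d / 2) by rewrite lt_min e0.
split.
- by rewrite m0 gt_min; apply/orP; right; lra.
- by apply: dsummable_le AM; rewrite ltW // ge_min lexx.
- by move=> w; rewrite !le_min => /andP[hx _] /andP[hy _]; exact: hA.
Qed.

Lemma analytic_ext h g a : h =1 g -> analytic h a -> analytic g a.
Proof. by move=> /funext ->. Qed.

Lemma analyticD h g a :
  analytic h a -> analytic g a -> analytic (fun w => h w + g w) a.
Proof.
move=> [B [eps [N [e0 BN hB]]]] /(analytic_small e0)[A [d [M [/andP[d0 de] AM gA]]]].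
exists (fun i j => B i j + A i j), d, (N + M); split=> [//||w hx hy].
  apply: dsummableD => //; first exact: ltW.
  by apply: dsummable_le BN; rewrite !ltW.
have hw := hB w (le_trans hx (ltW de)) (le_trans hy (ltW de)).
have -> : dseries (fun i j => B i j + A i j) (X w) (Y w) =
    fun n => dseries B (X w) (Y w) n + dseries A (X w) (Y w) n.
  by apply/funext => n; rewrite dseriesD.
exact: cvgcD hw (gA w hx hy).
Qed.

Lemma analyticM h g a :
  analytic h a -> analytic g a -> analytic (fun w => h w * g w) a.
Proof.
move=> [B [eps [N [e0 BN hB]]]] /(analytic_small e0)[A [d [M [/andP[d0 de] AM gA]]]].
have {}BN : dsummable B d N by apply: dsummable_le BN; rewrite !ltW.
have d20 : 0 < d / 2 by rewrite divr_gt0.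
exists (dconv B A), (d / 2), (N * M); split=> [//||w hx hy].
  apply: (@dsummable_le _ _ d); first by rewrite (ltW d20); lra.
  by apply: dsummable_conv => //; exact: ltW.
apply: (dseries_conv_cvg hx hy BN AM).
  by apply: hB; lra.
by apply: gA; lra.
Qed.

Lemma analytic_monomial c i0 j0 a :
  analytic (fun w => c * X (w - a) ^+ i0 * Y (w - a) ^+ j0) a.
Proof.
pose A i j := if (i, j) == (i0, j0) then c else 0.
have A0 i j : (i, j) != (i0, j0) -> A i j = 0 by rewrite /A => /negbTE ->.
have AE : A i0 j0 = c by rewrite /A eqxx.
exists A, 1, (normc c); split=> [//|n|w _ _].
  have nn : (n <= (n + i0 + j0).+1)%N by lia.
  apply: le_trans (ler_sqsum_widen nn _) _ => [i j|].
    by rewrite normc_expr_ge0.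
  rewrite (@sqsum_single _ _ i0 j0) ?expr1n ?mulr1 ?AE //; try lia.
  by move=> i j /A0 ->; rewrite normc0 mul0r.
apply/cvgcP => e e0; exists (i0 + j0).+1 => // n /= nn.
rewrite /dseries (@sqsum_single _ _ i0 j0); try lia.
  by rewrite AE (addrC a) addrK subrr normc0.
by move=> i j /A0 ->; rewrite !mul0r.
Qed.

Lemma analytic_cst c a : analytic (fun=> c) a.
Proof.
by apply: analytic_ext (analytic_monomial c 0 0 a) => w; rewrite !expr0 !mulr1.
Qed.

Lemma analytic_coordx a : analytic X a.
Proof.
apply: analytic_ext (analyticD (analytic_cst (X a) a) (analytic_monomial 1 1 0 a)) => w.
by rewrite expr1 expr0 mul1r mulr1 -real_linearD addrC subrK.
Qed.

Lemma analytic_coordy a : analytic Y a.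
Proof.
apply: analytic_ext (analyticD (analytic_cst (Y a) a) (analytic_monomial 1 0 1 a)) => w.
by rewrite expr1 expr0 mulr1 mul1r -real_linearD addrC subrK.
Qed.

Lemma dseries_is_dtau h a w A (eps M : R) (hx hy : R[i]) :
  0 < eps -> dsummable A eps M -> has_dseries h a A eps -> normc w < eps / 8 ->
  cvgc (dseries (dseries_dx A) (X w) (Y w)) hx ->
  cvgc (dseries (dseries_dy A) (X w) (Y w)) hy ->
  is_dtau h (a + w) ((coordx xy).1 * hx + (coordy xy).1 * hy).
Proof.
move=> e0 AM hA we cx cy; have xw := normc_coordx_le xy w.
have yw := normc_coordy_le xy w.
exists ((coordx xy).2 * hx + (coordy xy).2 * hy), (M * (4 / eps) ^+ 2).
have e80 : 0 < eps / 8 by lra.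
apply: filterS (near0_normc_lt e80) => s se.
have xs := normc_coordx_le xy s; have ys := normc_coordy_le xy s.
have xws := normc_coordx_le xy (w + s); have yws := normc_coordy_le xy (w + s).
have ws := le_normcD w s; rewrite /= in ws; rewrite !real_linearD in xws yws.
have c0 := hA w ltac:(lra) ltac:(lra).
have := hA (w + s); rewrite !real_linearD => /(_ ltac:(lra) ltac:(lra)) c1.
have -> : ((coordx xy).1 * hx + (coordy xy).1 * hy) * s +
    ((coordx xy).2 * hx + (coordy xy).2 * hy) * conjc s = X s * hx + Y s * hy.
  by rewrite /real_linear; ring.
rewrite -[a + w + s]addrA -[leRHS]mulrA.
apply: (dseries_expansion e0 _ _ _ _ xs ys AM c0 c1 cx cy); lra.
Qed.

Lemma analytic_expansion h a : analytic h a ->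
  exists A (eps M : R), [/\ 0 < eps, dsummable A eps M & forall w, normc w < eps ->
    exists hx hy, [/\ cvgc (dseries (dseries_dx A) (X w) (Y w)) hx,
      cvgc (dseries (dseries_dy A) (X w) (Y w)) hy &
      is_dtau h (a + w) ((coordx xy).1 * hx + (coordy xy).1 * hy)]].
Proof.
move=> [A [eps [M [e0 AM hA]]]]; exists A, (eps / 8), M; split; first by lra.
  by apply: dsummable_le AM; lra.
move=> w we; have xw := normc_coordx_le xy w; have yw := normc_coordy_le xy w.
have hx : normc (X w) <= eps / 2 / 2 by lra.
have hy : normc (Y w) <= eps / 2 / 2 by lra.
have [lx cx] := dseries_cvg hx hy (dsummable_dx e0 AM).
have [ly cy] := dseries_cvg hx hy (dsummable_dy e0 AM).
by exists lx, ly; split=> //; exact: dseries_is_dtau hA we cx cy.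
Qed.

Lemma analytic_is_dtau h a : analytic h a ->
  \forall z \near (a : R[i]^o), is_dtau h z (dtau_scalar h z).
Proof.
move=> /analytic_expansion[A [eps [M [e0 AM hA]]]]; apply/nbhs_normcP.
by exists eps => // w /hA[hx [hy [_ _ h_dtau]]]; rewrite (is_dtau_val h_dtau).
Qed.

Lemma analytic_dtau h a : analytic h a -> analytic (dtau_scalar h) a.
Proof.
move=> /analytic_expansion[A [eps [M [e0 AM hA]]]].
pose p := (coordx xy).1; pose q := (coordy xy).1.
exists (fun i j => p * dseries_dx A i j + q * dseries_dy A i j), (eps / 4).
exists (normc p * (M / eps) + normc q * (M / eps)); split; first by lra.
  apply: dsummableD; first by lra.
    by apply: dsummableZ; apply: dsummable_le (dsummable_dx e0 AM); lra.
  by apply: dsummableZ; apply: dsummable_le (dsummable_dy e0 AM); lra.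
move=> w hx hy; have := normc_le_coords xy w => xyw.
have /hA[lx [ly [cx cy h_dtau]]] : normc w < eps by lra.
rewrite (is_dtau_val h_dtau).
rewrite (_ : dseries _ _ _ = fun n => p * dseries (dseries_dx A) (X w) (Y w) n +
    q * dseries (dseries_dy A) (X w) (Y w) n).
  exact: cvgcD (cvgcZ p cx) (cvgcZ q cy).
by apply/funext => n; rewrite dseriesD !dseriesZ.
Qed.

End Analytic.

Local Notation real_ana := (analytic (ReIm_coords _)).
Local Notation holo := (analytic (holomorphic_coords _)).

Section RegularityClasses.
Variable R : realType.
Implicit Types (h : R[i] -> R[i]) (a z w : R[i]).

Lemma real_analyticP h a : real_analytic_at h a <-> real_ana h a.
Proof.
have AE (A : nat -> nat -> R[i]) (eps : R) n :
    \sum_(i < n) \sum_(j < n) `|A i j| * eps%:C ^+ (i + j) =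
    (sqsum n (fun i j => normc (A i j) * eps ^+ (i + j)))%:C.
  rewrite rmorph_sum; apply: eq_bigr => i _; rewrite rmorph_sum; apply: eq_bigr => j _.
  by rewrite rmorphM rmorphXn.
split=> -[A [eps [M [e0 AM hA]]]]; exists A, eps, M.
  split=> [//|n|[u v]]; first by have := AM n; rewrite AE lecR.
  by rewrite real_linear_Re real_linear_Im !normc_real; exact: hA.
split=> [//|n|u v hu hv]; first by rewrite AE lecR.
have := hA (u +i* v).
  by rewrite real_linear_Re real_linear_Im !normc_real; apply.
Qed.

Lemma dseries_holomorphic (A : nat -> nat -> R[i]) x n :
  dseries A x 0 n = \sum_(i < n) A i 0%N * x ^+ i.
Proof.
case: n => [|n]; rewrite /dseries /sqsum ?big_ord0 //.
apply: eq_bigr => i _; rewrite big_ord_recl big1 ?addr0 ?expr0 ?mulr1 // => j _.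
by rewrite exprS mul0r mulr0.
Qed.

(* Convergence on a disc of radius [eps] only bounds the coefficients there;
   absolute summability holds on a smaller disc. *)
Lemma power_series_coef_bounded (A : nat -> R[i]) (r : R) l : 0 < r ->
  cvgc (fun n => \sum_(i < n) A i * r%:C ^+ i) l ->
  exists C : R, forall n, normc (A n) * r ^+ n <= C.
Proof.
move=> r0 cl; have clS := cl; rewrite -(cvg_shiftS (_ : nat -> R[i]^o)) in clS.
have [C [_ bC]] := cvg_seq_bounded (cvgP _ (cvgcB clS cl)).
have := bC (C + 1) _; rewrite ltrDl ltr01 => /(_ isT) {}bC.
exists (complex.Re (C + 1)) => n; have := bC n I.
rewrite /= big_ord_recr /= addrAC subrr add0r -[`|_|]/((normc _)%:C).
by rewrite lecE normcM normcX normc_real gtr0_norm // => /andP[_].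
Qed.

Lemma half_expr_sum_le2 n : \sum_(i < n) (2^-1 : R) ^+ i <= 2.
Proof.
have -> : \sum_(i < n) (2^-1 : R) ^+ i = 2 - 2 * 2^-1 ^+ n.
  elim: n => [|n IH]; first by rewrite big_ord0 expr0; ring.
  by rewrite big_ord_recr /= IH exprS; field.
by rewrite lerBlDr lerDl mulr_ge0 ?half_expr_ge0.
Qed.

Lemma dsummable_power_series (A : nat -> R[i]) (r C : R) : 0 < r ->
  (forall n, normc (A n) * r ^+ n <= C) ->
  dsummable (fun i j => if j == 0%N then A i else 0) (r / 2) (C * 2).
Proof.
move=> r0 AC; have C0 : 0 <= C.
  by apply: le_trans (AC 0%N); rewrite normc_expr_ge0 ?ltW.
case=> [|n]; first by rewrite /sqsum big_ord0 mulr_ge0.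
apply: le_trans (ler_wpM2l C0 (half_expr_sum_le2 n.+1)); rewrite mulr_sumr.
apply: ler_sum => i _; rewrite big_ord_recl big1 ?addr0 => [|j _].
  by rewrite /= addn0 exprMn mulrA ler_wpM2r ?half_expr_ge0.
by rewrite [normc _]normc0 mul0r.
Qed.

Lemma holomorphicP h a : holomorphic_at h a <-> holo h a.
Proof.
split=> [[A [eps [e0 hA]]]|[A [eps [M [e0 AM hA]]]]]; last first.
  exists (fun i => A i 0%N), eps; split=> [//|z].
  rewrite -[`|_|]/((normc _)%:C) ltcR => ze.
  have := hA (z - a); rewrite real_linear_id real_linear_0 normc0 (addrC a) subrK.
  move=> /(_ (ltW ze) (ltW e0)).
  by rewrite (funext (dseries_holomorphic _ _)).
have r0 : 0 < eps / 2 by rewrite divr_gt0.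
have := hA (a + (eps / 2)%:C); rewrite (addrC a) addrK -[`|_|]/((normc _)%:C).
rewrite normc_real ltcR gtr0_norm // => /(_ ltac:(lra)).
move=> /(power_series_coef_bounded r0)[C AC].
exists (fun i j => if j == 0%N then A i else 0), (eps / 2 / 2), (C * 2).
split; [by lra|exact: dsummable_power_series|move=> w].
rewrite real_linear_id real_linear_0 => we _.
rewrite (funext (dseries_holomorphic _ w)) /=.
have := hA (a + w); rewrite (addrC a) addrK; apply.
by rewrite -[`|_|]/((normc _)%:C) ltcR; lra.
Qed.

End RegularityClasses.

Section Taylor.
Variable R : realType.
Implicit Types (h g s : R[i] -> R[i]) (z w c : R[i]) (P Q : {poly R[i]}).

Lemma bigOX_horner P : bigOX 0 (horner P).
Proof.
elim/poly_ind: P => [|P c IH].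
  by apply: eq_bigOX (bigOX0 _ 0) => w; rewrite horner0.
have PXO := bigOXM IH (bigOX_le (leq0n 1) (@bigOX_id R)).
apply: eq_bigOX (bigOXD PXO (bigOX_cst c)) => w.
by rewrite hornerMXaddC.
Qed.

Lemma bigOX_horner_root0 P : P.[0] = 0 -> bigOX 1 (horner P).
Proof.
move=> /rootP/factor_theorem[Q ->].
apply: eq_bigOX (bigOXM (bigOX_horner Q) (@bigOX_id R)) => w.
by rewrite hornerM hornerXsubC subr0.
Qed.

Lemma bigOX_horner_sub N P (u v : R[i] -> R[i]) : bigOX 0 u -> bigOX 0 v ->
  bigOX N (fun w => u w - v w) -> bigOX N (fun w => P.[u w] - P.[v w]).
Proof.
move=> uO vO uvO; have PvO Q : bigOX 0 (fun w => Q.[v w]).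
  elim/poly_ind: Q => [|Q c IH].
    by apply: eq_bigOX (bigOX0 _ 0) => w; rewrite horner0.
  by apply: eq_bigOX (bigOXD (bigOXM IH vO) (bigOX_cst c)) => w; rewrite hornerMXaddC.
elim/poly_ind: P => [|P c IH].
  by apply: eq_bigOX (bigOX0 _ N) => w; rewrite !horner0 subrr.
have := bigOXM IH uO; rewrite addn0 => /bigOXD/(_ (bigOXM (PvO P) uvO)).
by apply: eq_bigOX => w; rewrite !hornerMXaddC; ring.
Qed.

Definition taylor_at (N : nat) h z : Prop :=
  exists P, bigOX N (fun w => h (z + w) - P.[w]).

Lemma taylor_at_near N h g z : (\forall w \near (z : R[i]^o), h w = g w) ->
  taylor_at N h z -> taylor_at N g z.
Proof.
move=> /near0_shift hg [P hO]; exists P; apply: bigOX_near hO.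
by apply: filterS hg => w ->.
Qed.

Lemma taylor_at_ext N h g z : h =1 g -> taylor_at N h z -> taylor_at N g z.
Proof. by move=> /funext ->. Qed.

Lemma taylor_at_le N M h z : (M <= N)%N -> taylor_at N h z -> taylor_at M h z.
Proof. by move=> MN [P hO]; exists P; exact: bigOX_le hO. Qed.

Lemma taylor_at_cst N c z : taylor_at N (fun=> c) z.
Proof. by exists c%:P; apply: eq_bigOX (bigOX0 _ N) => w; rewrite hornerC subrr. Qed.

Lemma taylor_at_id N z : taylor_at N id z.
Proof.
exists (z%:P + 'X); apply: eq_bigOX (bigOX0 _ N) => w.
by rewrite hornerD hornerC hornerX subrr.
Qed.

Lemma taylor_atD N h g z :
  taylor_at N h z -> taylor_at N g z -> taylor_at N (fun w => h w + g w) z.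
Proof.
move=> [P hO] [Q gO]; exists (P + Q).
by apply: eq_bigOX (bigOXD hO gO) => w; rewrite hornerD; ring.
Qed.

Lemma taylor_at_bigOX0 N h z : taylor_at N h z -> bigOX 0 (fun w => h (z + w)).
Proof.
move=> [P /(bigOX_le (leq0n N)) hO].
by apply: eq_bigOX (bigOXD hO (bigOX_horner P)) => w; rewrite subrK.
Qed.

Lemma taylor_atM N h g z :
  taylor_at N h z -> taylor_at N g z -> taylor_at N (fun w => h w * g w) z.
Proof.
move=> [P hO] g_taylor; have gO0 := taylor_at_bigOX0 g_taylor.
move: g_taylor => [Q gO]; exists (P * Q).
have := bigOXM hO gO0; rewrite addn0 => /bigOXD/(_ (bigOXM (bigOX_horner P) gO)).
by apply: eq_bigOX => w; rewrite hornerM; ring.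
Qed.

Lemma taylor_atX N h z n : taylor_at N h z -> taylor_at N (fun w => h w ^+ n) z.
Proof.
move=> h_taylor; elim: n => [|n IH].
  by apply: taylor_at_ext (taylor_at_cst N 1 z) => w; rewrite expr0.
by apply: taylor_at_ext (taylor_atM h_taylor IH) => w; rewrite exprS.
Qed.

Lemma taylor_at0 N h z P : bigOX N.+1 (fun w => h (z + w) - P.[w]) -> P.[0] = h z.
Proof. by move/bigOX_at0; rewrite addr0 => /eqP; rewrite subr_eq0 => /eqP ->. Qed.

Lemma taylor_at_bigOX1 N h z : taylor_at N.+1 h z -> bigOX 1 (fun w => h (z + w) - h z).
Proof.
move=> [P hO]; have P0 := taylor_at0 hO.
have PO : bigOX 1 (horner (P - (h z)%:P)).
  by apply: bigOX_horner_root0; rewrite hornerD hornerN hornerC P0 subrr.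
apply: eq_bigOX (bigOXD (bigOX_le (ltn0Sn N) hO) PO) => w.
by rewrite hornerD hornerN hornerC; ring.
Qed.

Lemma taylor_atV N h z :
  h z != 0 -> taylor_at N.+1 h z -> taylor_at N.+1 (fun w => (h w)^-1) z.
Proof.
move=> hz h_taylor; have [nz hVO] := bigOX_inv hz (taylor_at_bigOX1 h_taylor).
move: h_taylor => [P hO]; have P0 := taylor_at0 hO; pose c := h z.
pose u := 1 - c^-1 *: P; pose Q := c^-1 *: \sum_(i < N.+1) u ^+ i.
have u0 : u.[0] = 0 by rewrite /u !hornerE P0 mulVf // subrr.
have PQ w : u.[w] ^+ N.+1 = 1 - P.[w] * Q.[w].
  rewrite /Q hornerZ horner_sum; under eq_bigr do rewrite horner_exp.
  have cP : c^-1 * P.[w] = 1 - u.[w] by rewrite /u !hornerE; ring.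
  by rewrite mulrCA mulrA cP -[1 - u.[w]]opprB mulNr -subrX1; ring.
exists Q; have uO : bigOX N.+1 (fun w => u.[w] ^+ N.+1).
  exact: bigOX_comp (bigOX_expr R N.+1) (bigOX_horner_root0 u0).
have := bigOXM hO (bigOX_horner Q); rewrite addn0 => /(bigOXZ (-1))/(bigOXD uO).
move/bigOXM/(_ hVO); rewrite addn0; apply: bigOX_near.
by apply: filterS nz => w hw; rewrite PQ; field.
Qed.

Lemma taylor_at_comp N h s z : taylor_at N.+1 h (s z) -> taylor_at N.+1 s z ->
  taylor_at N.+1 (fun w => h (s w)) z.
Proof.
move=> [P hO] s_taylor; have sO1 := taylor_at_bigOX1 s_taylor.
move: s_taylor => [S sO]; have S0 := taylor_at0 sO.
exists (P \Po (S - (s z)%:P)).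
have sSO : bigOX N.+1 (fun w => (s (z + w) - s z) - (S - (s z)%:P).[w]).
  by apply: eq_bigOX sO => w; rewrite hornerD hornerN hornerC; ring.
apply: eq_bigOX (bigOXD (bigOX_comp hO sO1)
  (bigOX_horner_sub P (bigOX_le (leq0n 1) sO1) (bigOX_horner _) sSO)) => w.
by rewrite horner_comp (addrC (s z)) subrK; ring.
Qed.

Lemma taylor_at_coef N h z : taylor_at N h z -> exists b : nat -> R[i],
  bigOX N (fun w => h (z + w) - \sum_(i < N) b i * w ^+ i).
Proof.
move=> [P hO]; exists (fun i => P`_i).
have := bigOXM (bigOX_expr R N) (bigOX_horner (drop_poly N P)); rewrite addn0.
move/(bigOXD hO); apply: eq_bigOX => w.
rewrite -{1}(poly_take_drop N P) hornerD hornerM hornerXn /take_poly horner_poly.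
by ring.
Qed.

Lemma taylor_at_cderive h z :
  taylor_at 2 h z -> is_cderive h z (dtau_scalar h z).
Proof.
move=> /taylor_at_coef[b hO].
have {}hO : is_cderive h z (b 1%N).
  have := bigOX_at0 hO; rewrite addr0 !big_ord_recr big_ord0 /=.
  rewrite expr1 mulr0 addr0 add0r expr0 mulr1 => /eqP; rewrite subr_eq0 => /eqP b0.
  by apply: eq_bigOX hO => w; rewrite !big_ord_recr big_ord0 /= b0 expr1; ring.
by rewrite (is_dtau_val (is_cderive_dtau hO)).
Qed.

Lemma power_series_tail_le (A : nat -> R[i]) (eps M : R) w N n :
  0 < eps -> normc w <= eps ->
  (forall m, \sum_(i < m) normc (A i) * eps ^+ i <= M) ->
  normc (\sum_(i < n + N) A i * w ^+ i - \sum_(i < N) A i * w ^+ i)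
    <= M / eps ^+ N * normc w ^+ N.
Proof.
move=> e0 we AM; rewrite addnC big_split_ord /= addrAC subrr add0r.
have A0 i : 0 <= normc (A i) * eps ^+ i by rewrite normc_expr_ge0 ?ltW.
have : \sum_(i < n) normc (A (N + i)%N) * eps ^+ (N + i) <= M.
  apply: le_trans (AM (N + n)%N); rewrite big_split_ord /= ler_wpDl //.
  exact: sumr_ge0.
move=> /(ler_wpM2l (exprn_ge0 N (normc_ge0 w))) tailM.
rewrite mulrAC ler_pdivlMr ?exprn_gt0 // [leRHS]mulrC; apply: le_trans tailM.
rewrite -ler_pdivlMr ?exprn_gt0 // mulr_sumr mulr_suml.
apply: le_trans (normc_sum_le _ _ _) _; apply: ler_sum => i _.
have -> : normc w ^+ N * (normc (A (N + i)%N) * eps ^+ (N + i)) / eps ^+ N =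
    normc w ^+ N * normc (A (N + i)%N) * eps ^+ i.
  by rewrite exprD; field; rewrite expf_neq0 ?lt0r_neq0.
rewrite normcM normcX exprD mulrA [normc (A _) * _]mulrC.
rewrite ler_wpM2l ?mulr_ge0 ?exprn_ge0 ?normc_ge0 //.
by rewrite lerXn2r ?nnegrE ?normc_ge0 ?(ltW e0).
Qed.

Lemma holomorphic_taylor N h z : analytic (holomorphic_coords R) h z -> taylor_at N h z.
Proof.
move=> [A [eps [M [e0 AM hA]]]]; exists (\poly_(i < N) A i 0%N), (M / eps ^+ N).
apply: filterS (near0_normc_lt e0) => w we.
have := hA w; rewrite real_linear_id real_linear_0 normc0 => /(_ (ltW we) (ltW e0)).
rewrite (funext (dseries_holomorphic A w)) horner_poly.
rewrite -(cvg_shiftn N (_ : nat -> R[i]^o)).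
move=> /cvgcB/(_ (cvgc_cst (\sum_(i < N) A i 0%N * w ^+ i)))/cvgc_le; apply => n.
apply: (@power_series_tail_le (fun i => A i 0%N)) => // [|m]; first exact: ltW.
apply: le_trans (AM m); apply: ler_sum => i _.
case: m i => [[]//|m] i; rewrite big_ord_recl /= addn0 lerDl.
by apply: sumr_ge0 => j _; rewrite normc_expr_ge0 ?ltW.
Qed.

End Taylor.

(** * Cauchy estimate *)

Section CauchyEstimate.
Variable R : realType.
Implicit Types (h g : R[i] -> R[i]) (a p z w : R[i]) (r e t : R).

Lemma taylor_at_normc_continuous g (q : R * R) : taylor_at 1 g (q.1 +i* q.2) ->
  {for q, continuous (fun v : R * R => normc (g (v.1 +i* v.2)))}.
Proof.
move=> /taylor_at_bigOX1 gO; apply/cvgrPdist_lt => e e0.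
have /nbhs_normcP[d d0 gd] := bigOX1_lt gO e0.
have d20 : 0 < d / 2 by rewrite divr_gt0.
exists (ball q.1 (d / 2), ball q.2 (d / 2)); first by split; exact: nbhsx_ballx.
move=> [x y] [/= hx hy].
apply: (@le_lt_trans _ _ (normc (g (x +i* y) - g (q.1 +i* q.2)))).
  by rewrite distrC; exact: (@ler_dist_dist R (Rcomplex R)).
have := gd ((x - q.1) +i* (y - q.2)); rewrite add0r.
have -> : (q.1 +i* q.2) + ((x - q.1) +i* (y - q.2)) = x +i* y.
  by simpc; rewrite !(addrC _ (_ - _)) !subrK.
apply; apply: le_lt_trans (normc_le_ReIm _) _ => /=.
by move: hx hy; rewrite /ball /= distrC (distrC q.2); lra.
Qed.

Definition square a r : set R[i] :=
  [set z | `|complex.Re (z - a)| <= r /\ `|complex.Im (z - a)| <= r].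

Lemma square_center a r : 0 <= r -> square a r a.
Proof. by move=> r0; rewrite /square /= subrr normr0. Qed.

Lemma square_near a r p : normc (p - a) < r ->
  \forall z \near (p : R[i]^o), square a r z.
Proof.
move=> pr; apply/nbhs_normcP; exists (r - normc (p - a)); first by rewrite subr_gt0.
move=> w wr; have : normc (p + w - a) < r.
  by rewrite addrAC; apply: le_lt_trans (le_normcD _ _) _; move: wr => /=; lra.
by move=> /ltW ar; split; apply: le_trans ar; [exact: normRe_le|exact: normIm_le].
Qed.

Lemma square_normc_le a r z : square a r z -> normc (z - a) ^+ 2 <= 2 * r ^+ 2.
Proof.
move=> [re im]; rewrite sqr_normcE -real_normK ?num_real //.
rewrite -[X in _ + X]real_normK ?num_real //.
have r0 := le_trans (normr_ge0 _) re.
have := lerXn2r 2 (normr_ge0 (complex.Re (z - a))) r0 re.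
have := lerXn2r 2 (normr_ge0 (complex.Im (z - a))) r0 im.
lra.
Qed.

Definition cross_sum (u : R[i] -> R) t : R :=
  u t%:C + u (0 +i* t) + u (- t%:C) + u (0 -i* t).

Lemma ler_cross_sum (u v : R[i] -> R) t : 0 <= t ->
  (forall w, normc w = t -> u w <= v w) -> cross_sum u t <= cross_sum v t.
Proof.
move=> t0 uv; have nt : normc (t%:C : R[i]) = t by rewrite normc_real ger0_norm.
apply: lerD; [apply: lerD; [apply: lerD|]|]; apply: uv; rewrite ?normcN //=.
  by rewrite expr0n /= add0r sqrtr_sqr ger0_norm.
by rewrite expr0n /= add0r sqrrN sqrtr_sqr ger0_norm.
Qed.

Lemma cross_sum_quadratic (b0 b1 b2 : R[i]) t :
  cross_sum (fun w => normc (b0 + b1 * w + b2 * w ^+ 2) ^+ 2) t =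
  4 * (normc b0 ^+ 2 + t ^+ 2 * normc b1 ^+ 2 + t ^+ 4 * normc b2 ^+ 2).
Proof.
rewrite /cross_sum !sqr_normcE.
case: b0 => x0 y0; case: b1 => x1 y1; case: b2 => x2 y2 /=; ring.
Qed.

Lemma cross_sum_dist a p t :
  cross_sum (fun w => normc (p + w - a) ^+ 2) t = 4 * normc (p - a) ^+ 2 + 4 * t ^+ 2.
Proof.
transitivity (cross_sum (fun w => normc (p - a + 1 * w + 0 * w ^+ 2) ^+ 2) t).
  by congr (normc _ ^+ 2 + normc _ ^+ 2 + normc _ ^+ 2 + normc _ ^+ 2); ring.
by rewrite cross_sum_quadratic normc0 normc1; ring.
Qed.

Lemma ler_sqr_perturb (x y d K : R) : 0 <= x -> 0 <= y -> 0 <= d ->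
  x <= K -> x <= y + d -> x ^+ 2 - 2 * K * d <= y ^+ 2.
Proof. by move=> x0 y0 d0 xK xyd; case: (lerP x y) => xy; nra. Qed.

(* The terms of order 1 and 2 in the expansion of [g] at [p] only contribute
   nonnegative terms to the mean of [|g|^2] over the four points [p + i^k t]. *)
Lemma cross_sum_ge g p : taylor_at 3 g p -> exists2 D : R, 0 <= D &
  exists2 d : R, 0 < d & forall t, 0 < t < d ->
    4 * normc (g p) ^+ 2 - D * t ^+ 3 <= cross_sum (fun w => normc (g (p + w)) ^+ 2) t.
Proof.
move=> /taylor_at_coef[b hO]; have b0 : b 0%N = g p.
  have := bigOX_at0 hO; rewrite addr0 !big_ord_recr big_ord0 /= !expr0n /=.
  by rewrite !mulr0 !addr0 add0r mulr1 => /eqP; rewrite subr_eq0 => /eqP ->.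
have [C C0 /nbhs_normcP[d d0 gd]] := bigOX_ge0 hO.
pose u w := b 0%N + b 1%N * w + b 2%N * w ^+ 2.
pose K := normc (b 0%N) + normc (b 1%N) + normc (b 2%N).
have K0 : 0 <= K by rewrite !addr_ge0 ?normc_ge0.
exists (8 * K * C); first by rewrite !mulr_ge0.
exists (Num.min d 1); first by rewrite lt_min d0 ltr01.
move=> t; rewrite lt_min => /and3P[t0 td t1].
have t30 : 0 <= t ^+ 3 by rewrite exprn_ge0 ?ltW.
have uK w : normc w = t -> normc (u w) <= K.
  move=> wt; apply: le_trans (le_normcD _ _) _; apply: lerD.
    apply: le_trans (le_normcD _ _) _; rewrite lerD2l normcM wt.
    by rewrite ler_piMr ?normc_ge0 ?ltW.
  by rewrite normcM normcX wt ler_piMr ?normc_ge0 ?exprn_ile1 ?ltW.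
have gu w : normc w = t -> normc (u w) <= normc (g (p + w)) + C * t ^+ 3.
  move=> wt; have := gd w; rewrite add0r wt => /(_ td).
  rewrite !big_ord_recr big_ord0 /= add0r expr0 mulr1 expr1 -/(u w).
  have := lercB_dist (u w) (g (p + w)); rewrite distcC; lra.
apply: (@le_trans _ _ (cross_sum (fun w => normc (u w) ^+ 2 - 2 * K * (C * t ^+ 3)) t)).
  have := cross_sum_quadratic (b 0%N) (b 1%N) (b 2%N) t.
  rewrite -b0 /cross_sum -!/(u _) => u_sum.
  have : 0 <= t ^+ 2 * normc (b 1%N) ^+ 2 by rewrite mulr_ge0 ?sqr_ge0.
  have : 0 <= t ^+ 4 * normc (b 2%N) ^+ 2.
    by rewrite mulr_ge0 ?exprn_ge0 ?normc_ge0 ?(ltW t0).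
  lra.
apply: ler_cross_sum => [|w wt]; first exact: ltW.
by apply: ler_sqr_perturb (uK w wt) (gu w wt); rewrite ?normc_ge0 ?(mulr_ge0 C0 t30).
Qed.

Definition penalized g a e z : R := normc (g z) ^+ 2 + e * normc (z - a) ^+ 2.

Lemma penalized_no_local_max g a p e : 0 < e -> taylor_at 3 g p ->
  ~ \forall z \near (p : R[i]^o), penalized g a e z <= penalized g a e p.
Proof.
move=> e0 /cross_sum_ge[D D0 [d d0 gD]] /nbhs_normcP[d' d'0 pmax].
have D1 : 0 < D + 1 by lra.
pose t := Num.min (Num.min d d') (e / (D + 1)) / 2.
have m0 : 0 < Num.min (Num.min d d') (e / (D + 1)) by rewrite !lt_min d0 d'0 divr_gt0.
have t0 : 0 < t by rewrite divr_gt0.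
have [td td' te] : [/\ t < d, t < d' & t * (D + 1) < e].
  have : t < Num.min (Num.min d d') (e / (D + 1)) by rewrite /t; lra.
  by rewrite !lt_min => /andP[/andP[-> ->]]; rewrite ltr_pdivlMr.
have := gD t; rewrite t0 td => /(_ isT) gsum.
have : cross_sum (fun w => penalized g a e (p + w)) t <=
    cross_sum (fun=> penalized g a e p) t.
  by apply: ler_cross_sum => [|w wt]; [exact: ltW|apply: pmax; rewrite wt].
have := cross_sum_dist a p t; move: gsum.
rewrite /cross_sum /penalized => gsum dsum psum.
have {}dsum := congr1 (fun x => e * x) dsum.
have : D * t ^+ 3 < e * t ^+ 2.
  rewrite exprS mulrA ltr_pM2r ?exprn_gt0 //; move: te; nra.
have : 0 < e * t ^+ 2 by rewrite mulr_gt0 ?exprn_gt0.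
by move: dsum; rewrite /= => dsum; lra.
Qed.

Lemma penalized_square_max g a r e : 0 < r ->
  (forall z, square a r z -> taylor_at 1 g z) ->
  exists2 p, square a r p &
    forall z, square a r z -> penalized g a e z <= penalized g a e p.
Proof.
move=> r0 g_taylor.
pose K : set (R * R) := `[complex.Re a - r, complex.Re a + r]%classic `*`
  `[complex.Im a - r, complex.Im a + r]%classic.
have KP x y : K (x, y) <-> square a r (x +i* y).
  by rewrite /K /square /= !raddfB /= !in_itv /= !ler_distl.
pose f (q : R * R) : R := penalized g a e (q.1 +i* q.2).
have cK : compact K by apply: compact_setX; exact: segment_compact.
have K0 : K !=set0.
  exists (complex.Re a, complex.Im a); apply/KP.
  by have := @square_center a r (ltW r0); case: (a).
have cf : {within K, continuous f}.
  apply: continuous_in_subspaceT => -[x y]; rewrite inE => /KP/g_taylor g_taylorq.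
  have cg := @taylor_at_normc_continuous g (x, y) g_taylorq.
  have cd := @taylor_at_normc_continuous (fun z => z - a) (x, y)
    (taylor_atD (taylor_at_id 1 _) (taylor_at_cst 1 (- a) _)).
  apply: cvgD; first exact: (cvgM cg cg).
  by apply: cvgM; [exact: cvg_cst|exact: (cvgM cd cd)].
have [[x y] /set_mem/KP Kq qmax] := compact_EVT_max K0 cK cf.
exists (x +i* y) => // -[x' y'] /KP Kz.
by apply: (qmax (x', y')); rewrite inE.
Qed.

Lemma maximum_principle g a r (m : R) : 0 < r ->
  (forall z, square a r z -> taylor_at 3 g z) ->
  (forall z, square a r z -> r <= normc (z - a) -> normc (g z) <= m) ->
  normc (g a) <= m.
Proof.
move=> r0 g_taylor gm; rewrite leNgt; apply/negP => ma.
have sqa := square_center a (ltW r0).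
have m0 : 0 <= m.
  have rE : a + r%:C - a = r%:C by rewrite addrC addKr.
  apply: le_trans (normc_ge0 _) (gm (a + r%:C) _ _).
    by rewrite /square /= rE /= normr0 gtr0_norm ?lexx ?(ltW r0).
  by rewrite rE normc_real ler_norm.
pose e := (normc (g a) ^+ 2 - m ^+ 2) / (4 * r ^+ 2).
have r2 : 0 < r ^+ 2 by rewrite exprn_gt0.
have e0 : 0 < e by rewrite divr_gt0 ?mulr_gt0 // subr_gt0 ltrXn2r ?nnegrE ?normc_ge0.
have eE : e * (4 * r ^+ 2) = normc (g a) ^+ 2 - m ^+ 2.
  by rewrite mulfVK // mulf_neq0 ?lt0r_neq0.
have [p sqp pmax] := penalized_square_max e r0
  (fun z sqz => taylor_at_le (isT : (1 <= 3)%N) (g_taylor z sqz)).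
case: (ltrP (normc (p - a)) r) => pr.
  apply: (@penalized_no_local_max g a p e e0 (g_taylor p sqp)).
  by apply: filterS (square_near pr) => z; exact: pmax.
have := pmax a sqa; rewrite /penalized subrr normc0 expr0n mulr0 addr0.
have : normc (g p) ^+ 2 <= m ^+ 2 by rewrite lerXn2r ?nnegrE ?normc_ge0 ?gm.
have := ler_wpM2l (ltW e0) (square_normc_le sqp).
have := mulr_gt0 e0 r2; lra.
Qed.

Definition difference_quotient h a z : R[i] :=
  if z == a then dtau_scalar h a else (h z - h a) / (z - a).

Lemma taylor_at_difference_quotient_ne N h a z : z != a ->
  taylor_at N.+1 h z -> taylor_at N.+1 (difference_quotient h a) z.
Proof.
move=> za h_taylor.
apply: (@taylor_at_near _ _ (fun w => (h w - h a) * (w - a)^-1)).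
  apply/nbhs_normcP; exists (normc (z - a)); first by rewrite normc_gt0 subr_eq0.
  move=> w hw; rewrite /difference_quotient; case: eqP => // wa.
  by move: hw; rewrite -wa opprD addNKr normcN ltxx.
apply: taylor_atM; first by apply: taylor_atD; [|exact: taylor_at_cst].
apply: taylor_atV; first by rewrite subr_eq0.
by apply: taylor_atD; [exact: taylor_at_id|exact: taylor_at_cst].
Qed.

Lemma taylor_at_difference_quotient N h a :
  taylor_at N.+2 h a -> taylor_at N.+1 (difference_quotient h a) a.
Proof.
move=> [P hO]; have P0 := taylor_at0 hO; have hO2 := bigOX_le (isT : (2 <= N.+2)%N) hO.
have /factor_theorem[Q PQ] : root (P - (h a)%:P) 0.
  by apply/rootP; rewrite hornerD hornerN hornerC P0 subrr.
have PE w : P.[w] = h a + Q.[w] * w.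
  by rewrite -[P](subrK (h a)%:P) PQ hornerD hornerM hornerXsubC subr0 hornerC addrC.
have QO : bigOX 1 (fun w => (Q - (Q.[0])%:P).[w]).
  by apply: bigOX_horner_root0; rewrite hornerD hornerN hornerC subrr.
have Q0 : Q.[0] = dtau_scalar h a.
  symmetry; apply/is_dtau_val/is_cderive_dtau.
  apply: eq_bigOX (bigOXD hO2 (bigOXM QO (@bigOX_id R))) => w.
  by rewrite PE hornerD hornerN hornerC; ring.
exists Q; move: hO => [C hC]; exists C; apply: filterS hC => w.
rewrite /difference_quotient; case: (eqVneq w 0) => [->|w0].
  by move=> _; rewrite addr0 eqxx Q0 subrr normc0 expr0n mulr0.
rewrite -subr_eq0 (addrC a) addrK (negbTE w0) addrC => hw.
rewrite -(ler_pM2r (_ : 0 < normc w)) ?normc_gt0 // -normcM -mulrA -exprSr.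
apply: le_trans hw; rewrite PE le_eqVlt; apply/orP; left; apply/eqP; congr normc.
by rewrite (addrC a); field.
Qed.

Lemma cauchy_estimate h a r (M : R) : 0 < r ->
  (forall z, square a r z -> taylor_at 4 h z) ->
  (forall z, square a r z -> normc (h z) <= M) ->
  normc (dtau_scalar h a) <= 2 * M / r.
Proof.
move=> r0 h_taylor hM; have sqa := square_center a (ltW r0).
have <- : difference_quotient h a a = dtau_scalar h a.
  by rewrite /difference_quotient eqxx.
apply: (maximum_principle r0) => z sqz.
  case: (eqVneq z a) => [->|za];
    first exact: taylor_at_difference_quotient (h_taylor _ sqa).
  exact: taylor_at_difference_quotient_ne (taylor_at_le (leqnSn 3) (h_taylor _ sqz)).
move=> rz; have za : z != a by rewrite -subr_eq0 -normc_gt0 (lt_le_trans r0).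
rewrite /difference_quotient (negbTE za) normcM normcV.
apply: ler_pM; rewrite ?normc_ge0 ?invr_ge0 ?normc_ge0 //.
  by apply: le_trans (normcB_le _ _) _; have := hM _ sqz; have := hM _ sqa; lra.
by rewrite lef_pV2 ?posrE // (lt_le_trans r0).
Qed.

End CauchyEstimate.

(** * Rankin-Cohen algebra *)

Section PolynomialComplements.

Lemma poly_ext_inj (K : idomainType) (P Q : {poly K}) (x : nat -> K) :
  injective x -> (forall i, P.[x i] = Q.[x i]) -> P = Q.
Proof.
move=> x_inj PQ; apply/eqP; rewrite -subr_eq0; apply/negPn/negP => D0.
pose rs := map x (iota 0 (size (P - Q))).
have := max_poly_roots D0 (_ : all (root _) rs) (_ : uniq rs).
rewrite size_map size_iota ltnn => /(_ _ _)/negP; apply => //.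
  by apply/allP => _ /mapP[i _ ->]; rewrite /root hornerD hornerN PQ subrr.
by rewrite map_inj_uniq ?iota_uniq.
Qed.

Variable K : numFieldType.

Lemma poly_deriv0_const (p : {poly K}) : p^`() = 0 -> p = (p.[0])%:P.
Proof.
move=> p'0; apply/polyP => -[|i]; rewrite coefC horner_coef0 //=.
have /eqP := congr1 (fun q : {poly K} => q`_i) p'0.
by rewrite coef_deriv coef0 mulrn_eq0 => /eqP.
Qed.

Lemma size_affine_exp_mul (p : {poly K}) (a : K) D :
  a != 0 -> p != 0 -> size ((a *: 'X + 1) ^+ D * p) = (D + size p)%N.
Proof.
move=> a0 p0; have a1 : size (a *: 'X + 1 : {poly K}) = 2.
  by rewrite -mul_polyC size_MXaddC polyC_eq0 (negbTE a0) size_polyC a0.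
have a10 : (a *: 'X + 1 : {poly K}) != 0 by rewrite -size_poly_gt0 a1.
have sizeD : size ((a *: 'X + 1 : {poly K}) ^+ D)%R = D.+1.
  by rewrite -[LHS]prednK ?size_poly_gt0 ?expf_neq0 // size_exp a1 mul1n.
by rewrite size_mul ?expf_neq0 // sizeD.
Qed.

End PolynomialComplements.

Section RankinCohenAlgebra.
Variable K : numFieldType.
Implicit Types (kap lam : int) (n r i a : nat) (t u c : nat -> K).

Definition bol_coef kap r i : K :=
  'C(r, i)%:R * \prod_(i <= a < r) (kap + a%:Z)%:~R.

Lemma bol_coef_small kap r i : (r < i)%N -> bol_coef kap r i = 0.
Proof. by move=> ri; rewrite /bol_coef bin_small // mul0r. Qed.

Lemma bol_coef_recr kap r i : (i <= r.+1)%N ->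
  bol_coef kap r.+1 i = bol_coef kap r i * (kap + r%:Z + i%:Z)%:~R
    + (if i is i'.+1 then bol_coef kap r i' else 0).
Proof.
rewrite /bol_coef; case: i => [_|i ir].
  by rewrite !bin0 big_nat_recr //= !mul1r !addr0.
case: (ltnP i r) => [{}ir|ri]; last first.
  have -> : i = r by lia.
  by rewrite binn bin_small // !big_geq // !mul0r add0r binn.
rewrite big_nat_recr //= [in X in _ = _ + X]big_ltn // binS natrD !intrD -!pmulrn -!natr1.
have : (i%:R + 1) * 'C(r, i.+1)%:R = (r%:R - i%:R) * 'C(r, i)%:R :> K.
  by rewrite natr1 -natrB ?(ltnW ir) // -!natrM mul_bin_left.
move: ('C(r, i.+1)%:R) ('C(r, i)%:R) (\prod_(i.+1 <= _ < r) _) => B C P BC.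
apply/eqP; rewrite -subr_eq0; apply/eqP.
transitivity (- P * ((i%:R + 1) * B - (r%:R - i%:R) * C)); first by ring.
by rewrite BC subrr mulr0.
Qed.

Definition bol_poly kap t r : {poly K} :=
  \sum_(i < r.+1) (bol_coef kap r i * t i) *: 'X^(r - i).

Lemma horner_bol_poly kap t r x :
  (bol_poly kap t r).[x] = \sum_(i < r.+1) bol_coef kap r i * t i * x ^+ (r - i).
Proof. by rewrite horner_sum; apply: eq_bigr => i _; rewrite hornerZ hornerXn. Qed.

Lemma horner0_bol_poly kap t r : (bol_poly kap t r).[0] = t r.
Proof.
rewrite horner_bol_poly big_ord_recr big1 /= => [|i _].
  by rewrite subnn /bol_coef binn big_geq // !mul1r mulr1 add0r.
by rewrite expr0n subn_eq0 leqNgt ltn_ord mulr0.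
Qed.

Lemma deriv_bol_poly kap t r : (bol_poly kap t r.+1)^`() =
  (r.+1%:R * (kap + r%:Z)%:~R) *: bol_poly kap t r.
Proof.
rewrite linear_sum big_ord_recr /= subnn expr0 linearZ /= derivC scaler0 addr0.
rewrite scaler_sumr; apply: eq_bigr => i _; have ir : (i <= r)%N by rewrite -ltnS.
rewrite linearZ /= derivXn subSn //= -scaler_nat !scalerA; congr (_ *: _).
have bin_down : (r - i).+1%:R * 'C(r.+1, i)%:R = r.+1%:R * 'C(r, i)%:R :> K.
  by rewrite -!natrM -subSn // -mul_bin_down.
rewrite /bol_coef big_nat_recr //=.
transitivity ((r - i).+1%:R * 'C(r.+1, i)%:R *
  (\prod_(i <= a < r) (kap + a%:Z)%:~R * (kap + r%:Z)%:~R * t i) : K); first by ring.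
by rewrite bin_down; ring.
Qed.

Definition rc_poly kap lam n c t u : {poly K} :=
  \sum_(r < n.+1) c r *: (bol_poly kap t r * bol_poly lam u (n - r)).

Definition rc_defect kap lam n c a : K :=
  (n - a)%:R * (lam + (n - a.+1)%:Z)%:~R * c a + a.+1%:R * (kap + a%:Z)%:~R * c a.+1.

Lemma horner_bol_poly_scale kap t r (a x : K) : a != 0 ->
  (bol_poly kap (fun i => a ^ (kap + (2 * i)%:Z) * t i) r).[x * a ^+ 2] =
  a ^ (kap + (2 * r)%:Z) * (bol_poly kap t r).[x].
Proof.
move=> a0; rewrite !horner_bol_poly mulr_sumr; apply: eq_bigr => i _.
have ir := leq_ord i.
have -> : kap + (2 * r)%:Z = kap + (2 * i)%:Z + (2 * (r - i))%N%:Z by lia.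
by rewrite (expfzDr (kap + (2 * i)%:Z)) // -[X in _ = _ * X * _]exprnP exprMn -exprM;
  ring.
Qed.

Lemma horner_rc_poly_scale kap lam n c t u (a x : K) : a != 0 ->
  (rc_poly kap lam n c (fun i => a ^ (kap + (2 * i)%:Z) * t i)
                       (fun i => a ^ (lam + (2 * i)%:Z) * u i)).[x * a ^+ 2] =
  a ^ (kap + lam + (2 * n)%:Z) * (rc_poly kap lam n c t u).[x].
Proof.
move=> a0; rewrite !horner_sum mulr_sumr; apply: eq_bigr => r _; have rn := leq_ord r.
rewrite !hornerZ !hornerM !horner_bol_poly_scale //.
have -> : kap + lam + (2 * n)%:Z = kap + (2 * r)%:Z + (lam + (2 * (n - r))%N%:Z) by lia.
by rewrite (expfzDr (kap + (2 * r)%:Z)) //; ring.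
Qed.

Lemma deriv_rc_poly kap lam n c t u : (rc_poly kap lam n.+1 c t u)^`() =
  \sum_(a < n.+1)
    rc_defect kap lam n.+1 c a *: (bol_poly kap t a * bol_poly lam u (n - a)).
Proof.
have dl : \sum_(r < n.+2) c r *: ((bol_poly kap t r)^`() * bol_poly lam u (n.+1 - r)) =
    \sum_(a < n.+1) (a.+1%:R * (kap + a%:Z)%:~R * c a.+1) *:
      (bol_poly kap t a * bol_poly lam u (n - a)).
  rewrite big_ord_recl /= /bol_poly big_ord1 expr0 linearZ /= derivC scaler0 mul0r.
  rewrite scaler0 add0r.
  apply: eq_bigr => a _; rewrite /bump /= add1n deriv_bol_poly -scalerAl scalerA.
  by rewrite mulrC.
have dr : \sum_(r < n.+2) c r *: (bol_poly kap t r * (bol_poly lam u (n.+1 - r))^`()) =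
    \sum_(a < n.+1) ((n.+1 - a)%:R * (lam + (n - a)%:Z)%:~R * c a) *:
      (bol_poly kap t a * bol_poly lam u (n - a)).
  rewrite big_ord_recr /= subnn [in X in _ + X]/bol_poly big_ord1 expr0.
  rewrite linearZ /= derivC scaler0 mulr0 scaler0 addr0.
  apply: eq_bigr => a _; have an : (a <= n)%N by rewrite -ltnS.
  by rewrite subSn // deriv_bol_poly -scalerAr scalerA mulrC.
rewrite linear_sum /=; under eq_bigr do rewrite linearZ /= derivM scalerDr.
rewrite big_split /= dl dr -big_split /=; apply: eq_bigr => a _.
by rewrite -scalerDl addrC.
Qed.

Definition rc_recurrence kap lam n c : Prop :=
  forall a, (a < n)%N -> rc_defect kap lam n c a = 0.

Lemma rc_poly_const kap lam n c t u : rc_recurrence kap lam n c ->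
  rc_poly kap lam n c t u = (\sum_(r < n.+1) c r * t r * u (n - r)%N)%:P.
Proof.
move=> c_rec; rewrite [LHS]poly_deriv0_const.
  congr _%:P; rewrite horner_sum; apply: eq_bigr => r _.
  by rewrite hornerZ hornerM !horner0_bol_poly mulrA.
case: n c_rec => [|n] c_rec; last first.
  by rewrite deriv_rc_poly big1 // => a _; rewrite c_rec ?scale0r.
rewrite /rc_poly /bol_poly !big_ord1 !expr0 -scalerAl -scalerAr !linearZ /=.
by rewrite mulr1 derivC !scaler0.
Qed.

Lemma rc_defect_eq0 kap lam n c t u a b : (a + b).+1 = n ->
  (forall i, (i < a)%N -> t i = 0) -> (forall i, (i < b)%N -> u i = 0) ->
  t a != 0 -> u b != 0 -> (size (rc_poly kap lam n c t u) <= 1)%N ->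
  rc_defect kap lam n c a = 0.
Proof.
case: n => // n [abn] t0 u0 ta ub /size1_polyC Q_const.
have := congr1 (fun p : {poly K} => p^`().[0]) Q_const.
rewrite derivC horner0 deriv_rc_poly horner_sum (bigD1 (inord a)) //= inordK; last by lia.
rewrite big1 ?addr0 => [|i]; last first.
  rewrite -val_eqE /= inordK => [ia|]; last by lia.
  rewrite hornerZ hornerM !horner0_bol_poly; case: (ltngtP i a) => h.
  - by rewrite t0 // mul0r mulr0.
  - by rewrite u0 ?mulr0 //; have := ltn_ord i; lia.
  - by rewrite h eqxx in ia.
rewrite hornerZ hornerM !horner0_bol_poly (_ : n - a = b)%N; last by lia.
by move/eqP; rewrite !mulf_eq0 (negbTE ta) (negbTE ub) !orbF => /eqP.
Qed.

Definition rc_coefficient kap lam n r : K :=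
  (-1) ^+ r * 'C(n, r)%:R * (\prod_(r <= j < n) (kap + j%:Z)%:~R)
    * (\prod_(n - r <= q < n) (lam + q%:Z)%:~R).

Lemma rc_coefficient_recurrence kap lam n :
  rc_recurrence kap lam n (rc_coefficient kap lam n).
Proof.
move=> a an; rewrite /rc_defect /rc_coefficient.
rewrite (@big_ltn _ _ _ a n) // (@big_ltn _ _ _ (n - a.+1)) //; last by lia.
rewrite (_ : (n - a.+1).+1 = n - a)%N; last by lia.
have binE : a.+1%:R * 'C(n, a.+1)%:R = (n - a)%:R * 'C(n, a)%:R :> K.
  by rewrite -!natrM mul_bin_left.
rewrite exprS.
transitivity ((-1) ^+ a * (lam + (n - a.+1)%:Z)%:~R * (kap + a%:Z)%:~R *
  \prod_(a.+1 <= j < n) (kap + j%:Z)%:~R * \prod_(n - a <= q < n) (lam + q%:Z)%:~R *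
  ((n - a)%:R * 'C(n, a)%:R - a.+1%:R * 'C(n, a.+1)%:R) : K); first by ring.
by rewrite binE subrr mulr0.
Qed.

(* The recurrence determines all coefficients from the one of index [r0] as
   long as none of the factors crossed on the way vanishes. *)
Definition rc_pivot kap lam n r0 : Prop :=
  [/\ (r0 <= n)%N, forall j, (r0 <= j < n)%N -> kap + j%:Z != 0 &
      forall q, (n - r0 <= q < n)%N -> lam + q%:Z != 0].

Section Pivot.
Variables (kap lam : int) (n r0 : nat).
Hypothesis r0_pivot : rc_pivot kap lam n r0.

Lemma rc_coefficient_pivot_neq0 : rc_coefficient kap lam n r0 != 0.
Proof.
have [r0n kap0 lam0] := r0_pivot.
have prod_neq0 m (mu : int) : (forall j, (m <= j < n)%N -> mu + j%:Z != 0) ->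
    \prod_(m <= j < n) (mu + j%:Z)%:~R != 0 :> K.
  move=> mu0; rewrite big_nat_cond; elim/big_ind: _ => [|x y|j /andP[jn _]].
  - exact: oner_neq0.
  - exact: mulf_neq0.
  - by rewrite intr_eq0 mu0.
by rewrite !mulf_neq0 ?signr_eq0 ?prod_neq0 // pnatr_eq0 -lt0n bin_gt0.
Qed.

Lemma rc_recurrence_eq0_up c i : rc_recurrence kap lam n c -> c r0 = 0 ->
  (r0 + i <= n)%N -> c (r0 + i)%N = 0.
Proof.
move=> c_rec c0; have [_ kap0 _] := r0_pivot.
elim: i => [|i IH] h; first by rewrite addn0.
have /eqP := c_rec (r0 + i)%N ltac:(lia); rewrite /rc_defect IH ?mulr0 ?add0r;
  last by lia.
rewrite addnS !mulf_eq0 pnatr_eq0 intr_eq0 /= (negbTE (kap0 _ _)) /=; last by lia.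
by move=> /eqP.
Qed.

Lemma rc_recurrence_eq0_down c i : rc_recurrence kap lam n c -> c r0 = 0 ->
  (i <= r0)%N -> c (r0 - i)%N = 0.
Proof.
move=> c_rec c0; have [r0n _ lam0] := r0_pivot.
elim: i => [|i IH] h; first by rewrite subn0.
have /eqP := c_rec (r0 - i.+1)%N ltac:(lia); rewrite /rc_defect.
rewrite (_ : (r0 - i.+1).+1 = r0 - i)%N ?IH ?mulr0 ?addr0; try lia.
rewrite !mulf_eq0 pnatr_eq0 intr_eq0 (negbTE (lam0 _ _)); last by lia.
by rewrite orbF (_ : (n - (r0 - i.+1))%N == 0%N = false); [move=> /eqP|lia].
Qed.

Lemma rc_recurrence_eq0 c : rc_recurrence kap lam n c -> c r0 = 0 ->
  forall r, (r <= n)%N -> c r = 0.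
Proof.
move=> c_rec c0 r rn; case: (leqP r0 r) => r0r.
  by rewrite -(subnKC r0r); apply: rc_recurrence_eq0_up; rewrite ?subnKC.
by rewrite -(subKn (ltnW r0r)); apply: rc_recurrence_eq0_down; rewrite ?leq_subr.
Qed.

Lemma rc_recurrence_unique c : rc_recurrence kap lam n c ->
  forall r, (r <= n)%N ->
    c r = c r0 / rc_coefficient kap lam n r0 * rc_coefficient kap lam n r.
Proof.
move=> c_rec r rn; set x := _ / _; apply/eqP; rewrite -subr_eq0; apply/eqP.
apply: (@rc_recurrence_eq0 (fun r => c r - x * rc_coefficient kap lam n r)) => // [a an|].
  have cE := c_rec a an; have rcE := rc_coefficient_recurrence kap lam an.
  transitivity (rc_defect kap lam n c a -
    x * rc_defect kap lam n (rc_coefficient kap lam n) a).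
    by rewrite /rc_defect; ring.
  by rewrite cE rcE mulr0 subr0.
by rewrite /x divfK ?subrr // rc_coefficient_pivot_neq0.
Qed.

End Pivot.

Lemma rc_pivot_exists (k l : int) (d e n : nat) :
  ~ [/\ 0 <= d%:Z - k, 0 <= e%:Z - l, d%:Z - k < n%:Z, e%:Z - l < n%:Z
      & n%:Z <= d%:Z + e%:Z - k - l + 1] ->
  exists r0, rc_pivot (k - d%:Z) (l - e%:Z) n r0.
Proof.
move=> not_excluded.
case: (boolP ((0 <= d%:Z - k) && (d%:Z - k < n%:Z))) => [/andP[k1 k2]|k_out]; last first.
  exists 0%N; split=> // [j|q] /andP[ja jb]; last by lia.
  by apply/eqP => kj0; move/negP: k_out; apply; lia.
case: (boolP ((0 <= e%:Z - l) && (e%:Z - l < n%:Z))) => [/andP[l1 l2]|l_out]; last first.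
  exists n; split=> // [j|q] /andP[ja jb]; first by lia.
  by apply/eqP => lq0; move/negP: l_out; apply; lia.
have : d%:Z + e%:Z - k - l + 1 < n%:Z.
  by rewrite ltNge; apply/negP => h; apply: not_excluded; split.
exists (`|d%:Z - k|%N).+1; split; first by lia.
  by move=> j /andP[ja jb]; apply/eqP => kj0; lia.
by move=> q /andP[qa qb]; apply/eqP => lq0; lia.
Qed.

End RankinCohenAlgebra.

(** * Slash operators *)

Section Mobius.
Variable R : realType.
Implicit Types (s g : 'M[R]_2) (z w : R[i]).

Lemma mulmx22E g s i j : (g *m s) i j = g i 0 * s 0 j + g i 1 * s 1 j.
Proof.
rewrite mxE !big_ord_recl big_ord0 addr0.
by congr (g i _ * s _ j + g i _ * s _ j); apply/val_inj.
Qed.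

Lemma det_mx22 s : \det s = s 0 0 * s 1 1 - s 0 1 * s 1 0.
Proof.
rewrite (expand_det_row _ 0) !big_ord_recl big_ord0 /= addr0 /cofactor !det_mx11 !mxE /=.
rewrite addn0 expr0 mul1r /bump /= expr1 mulN1r mulrN.
by congr (s 0 _ * s _ _ - s 0 _ * s _ _); apply/val_inj.
Qed.

Lemma det1_unitmx s : \det s = 1 -> s \in unitmx.
Proof. by move=> ds; rewrite unitmxE ds unitr1. Qed.

Lemma Re_autj s z : complex.Re (autj s z) = s 1 0 * complex.Re z + s 1 1.
Proof. by rewrite /autj; case: z => a b /=; rewrite mul0r subr0. Qed.

Lemma Im_autj s z : complex.Im (autj s z) = s 1 0 * complex.Im z.
Proof. by rewrite /autj; case: z => a b /=; rewrite mul0r !addr0. Qed.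

Lemma autj_neq0 s z : \det s = 1 -> upper_half_plane z -> autj s z != 0.
Proof.
rewrite det_mx22 /upper_half_plane /= => ds z0; apply/eqP => j0.
have := Im_autj s z; rewrite j0 /= => /esym/eqP.
rewrite mulf_eq0 (gt_eqF z0) orbF => /eqP c0.
have := Re_autj s z; rewrite j0 /= c0 mul0r add0r => /esym d0.
by move: ds; rewrite c0 d0 !mulr0 subrr => /esym/eqP; rewrite oner_eq0.
Qed.

Lemma Im_mobius s z : \det s = 1 ->
  complex.Im (mobius s z) = complex.Im z / normc (autj s z) ^+ 2.
Proof.
rewrite det_mx22 => ds; rewrite sqr_normcE /mobius /autj.
case: z => x y /=; rewrite !(mul0r, mulr0, subr0, addr0).
set D := _ ^+ 2 + _ ^+ 2.
transitivity ((s 0 0 * s 1 1 - s 0 1 * s 1 0) * y / D); last by rewrite ds mul1r.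
by ring.
Qed.

Lemma mobius_upper s z :
  \det s = 1 -> upper_half_plane z -> upper_half_plane (mobius s z).
Proof.
move=> ds z0; rewrite /upper_half_plane /= Im_mobius // divr_gt0 //.
by rewrite exprn_gt0 // normc_gt0 autj_neq0.
Qed.

Lemma mobius1 z : mobius 1%:M z = z.
Proof. by rewrite /mobius !mxE /= mul1r mul0r addr0 add0r divr1. Qed.

Lemma autj1 z : autj 1%:M z = 1.
Proof. by rewrite /autj !mxE /= mul0r add0r. Qed.

Lemma autjM g s z : \det s = 1 -> upper_half_plane z ->
  autj (g *m s) z = autj g (mobius s z) * autj s z.
Proof.
move=> ds z0; have := autj_neq0 ds z0; rewrite /autj !mulmx22E /mobius.
by rewrite /autj !rmorphD !rmorphM => j0; field; exact: j0.
Qed.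

Lemma mobiusM g s z : \det g = 1 -> \det s = 1 -> upper_half_plane z ->
  mobius (g *m s) z = mobius g (mobius s z).
Proof.
move=> dg ds z0; have j0 := autj_neq0 ds z0.
have gs0 := autj_neq0 dg (mobius_upper ds z0).
have sE : mobius s z * autj s z = (s 0 0)%:C * z + (s 0 1)%:C by rewrite divfK.
have numE : ((g *m s) 0 0)%:C * z + ((g *m s) 0 1)%:C =
    ((g 0 0)%:C * mobius s z + (g 0 1)%:C) * autj s z.
  by rewrite mulrDl -mulrA sE !mulmx22E /autj !rmorphD !rmorphM; ring.
rewrite /mobius -/(autj (g *m s) z) -/(autj g (mobius s z)) -/(mobius s z) numE autjM //.
by rewrite -mulf_div divff // mulr1.
Qed.

Lemma mobiusK s z : \det s = 1 -> upper_half_plane z ->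
  mobius (invmx s) (mobius s z) = z.
Proof.
move=> ds z0; rewrite -mobiusM ?det_inv ?ds ?invr1 //.
by rewrite mulVmx ?mobius1 ?det1_unitmx.
Qed.

Lemma autj_invmx s z : \det s = 1 -> upper_half_plane z ->
  autj (invmx s) (mobius s z) = (autj s z)^-1.
Proof.
move=> ds z0; have j0 := autj_neq0 ds z0; apply: (mulIf j0).
by rewrite mulVf // -autjM // mulVmx ?det1_unitmx ?autj1.
Qed.

Lemma open_upper_half_plane : open (upper_half_plane : set R[i]^o).
Proof.
rewrite openE => z z0; apply/nbhs_normcP; exists (complex.Im z) => // w hw.
rewrite /upper_half_plane /= raddfD /=; have := normIm_le w.
by rewrite ler_norml => /andP[]; move: hw; lra.
Qed.

Lemma taylor_at_affine N (p q z : R[i]) : taylor_at N (fun w => p * w + q) z.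
Proof.
apply: taylor_atD; last exact: taylor_at_cst.
by apply: taylor_atM; [exact: taylor_at_cst|exact: taylor_at_id].
Qed.

Lemma taylor_at_mobius N s z :
  \det s = 1 -> upper_half_plane z -> taylor_at N.+1 (mobius s) z.
Proof.
move=> ds z0; apply: taylor_atM; first exact: taylor_at_affine.
by apply: taylor_atV; [exact: autj_neq0|exact: taylor_at_affine].
Qed.

Lemma taylor_at_autjz N s z (m : int) : \det s = 1 -> upper_half_plane z ->
  taylor_at N.+1 (fun w => autj s w ^ m) z.
Proof.
move=> ds z0; case: m => m; first by apply: taylor_atX; exact: taylor_at_affine.
apply: taylor_atV; first by rewrite expf_neq0 // autj_neq0.
by apply: taylor_atX; exact: taylor_at_affine.
Qed.

Lemma mobius_near s z (P : R[i] -> Prop) : \det s = 1 -> upper_half_plane z ->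
  (\forall w \near (mobius s z : R[i]^o), P w) ->
  \forall w \near (z : R[i]^o), P (mobius s w).
Proof.
move=> ds z0 /near0_shift; have sO := taylor_at_bigOX1 (taylor_at_mobius 0 ds z0).
move/(near0_comp sO) => sP; apply/near0_shift; apply: filterS sP => w.
by rewrite addrC subrK.
Qed.

Lemma is_dtau_affine (p q z : R[i]) : is_dtau (fun w => p * w + q) z p.
Proof.
apply: is_dtau_eq (is_dtauD (is_dtauZ p (is_dtau_id z)) (is_dtau_cst q z)) _.
by rewrite mulr1 addr0.
Qed.

Lemma is_dtau_autj s z : is_dtau (autj s) z (autj' s).
Proof. exact: is_dtau_affine. Qed.

Lemma is_cderive_mobius s z : \det s = 1 -> upper_half_plane z ->
  is_cderive (mobius s) z (autj s z ^- 2).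
Proof.
move=> ds z0; have j0 := autj_neq0 ds z0.
suff <- : dtau_scalar (mobius s) z = autj s z ^- 2.
  exact: taylor_at_cderive (taylor_at_mobius 1 ds z0).
apply: is_dtau_val; apply: is_dtau_eq (is_dtauM (is_dtau_affine (s 0 0)%:C (s 0 1)%:C z)
  (is_dtauV j0 (is_dtau_autj s z))) _.
have : (s 0 0)%:C * (s 1 1)%:C - (s 0 1)%:C * (s 1 0)%:C = 1 :> R[i].
  by rewrite -!rmorphM -rmorphB -det_mx22 ds.
move: j0; rewrite /autj /autj' => j0 D.
by rewrite -[RHS]mul1r -{}D; field; exact: j0.
Qed.

Lemma is_dtau_autjz s z (m : int) : \det s = 1 -> upper_half_plane z ->
  is_dtau (fun w => autj s w ^ m) z (m%:~R * autj' s * autj s z ^ (m - 1)).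
Proof.
move=> ds z0; have j0 := autj_neq0 ds z0; have dj := is_dtau_autj s z.
case: m => m.
  apply: is_dtau_eq (is_dtauX m dj) _; case: m => [|m]; first by rewrite !mul0r.
  by rewrite (_ : m.+1%:Z - 1 = m) //; lia.
apply: is_dtau_eq (@is_dtauV _ (fun w => autj s w ^+ m.+1) z _
  (expf_neq0 m.+1 j0) (is_dtauX m.+1 dj)) _.
rewrite NegzE (_ : - m.+1%:Z - 1 = Negz m.+1); last by lia.
rewrite mulrNz /exprz -[m.+1.-1]/m -[(m.+1)%:~R]/(m.+1%:R) !exprS; field.
by rewrite expf_neq0.
Qed.

(* The paper's [j'/j] up to sign; it satisfies a Riccati equation. *)
Definition autx s z : R[i] := - autj' s / autj s z.

Lemma is_dtau_autx s z :
  \det s = 1 -> upper_half_plane z -> is_dtau (autx s) z (autx s z ^+ 2).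
Proof.
move=> ds z0; have j0 := autj_neq0 ds z0.
apply: is_dtau_eq (is_dtauZ (- autj' s) (is_dtauV j0 (is_dtau_autj s z))) _.
by rewrite /autx; field.
Qed.

Lemma expfz_autx s z (m : int) : \det s = 1 -> upper_half_plane z ->
  autj s z ^ m = autj s z ^ (m - 1) * autj s z.
Proof.
move=> ds z0; have j0 := autj_neq0 ds z0.
by have := expfzDr (m - 1) 1 j0; rewrite expr1z subrK.
Qed.

End Mobius.

Section DifferentialAlgebras.
Variable R : realType.
Implicit Types (h g : R[i] -> R[i]) (z w c : R[i]) (U : set R[i]).

Record diff_algebra (P : (R[i] -> R[i]) -> Prop) : Prop := DiffAlgebra {
  da_cst : forall c, P (fun=> c);
  da_add : forall h g, P h -> P g -> P (fun z => h z + g z);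
  da_mul : forall h g, P h -> P g -> P (fun z => h z * g z);
  da_dtau : forall h, P h -> P (dtau_scalar h) }.

Lemma eq_da (P : (R[i] -> R[i]) -> Prop) h g : h =1 g -> P h -> P g.
Proof. by move=> /funext ->. Qed.

Lemma da_sum P (I : Type) (r : seq I) (Q : pred I) (h : I -> R[i] -> R[i]) :
  diff_algebra P -> (forall i, Q i -> P (h i)) ->
  P (fun z => \sum_(i <- r | Q i) h i z).
Proof.
move=> PA Ph; elim: r => [|i r IH].
  by apply: (@eq_da P _ _ _ (da_cst PA 0)) => z; rewrite big_nil.
case: (boolP (Q i)) => Qi.
  by apply: (@eq_da P _ _ _ (da_add PA (Ph i Qi) IH)) => z; rewrite big_cons Qi.
by apply: (@eq_da P _ _ _ IH) => z; rewrite big_cons (negbTE Qi).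
Qed.

Lemma da_exp P h n : diff_algebra P -> P h -> P (fun z => h z ^+ n).
Proof.
move=> PA Ph; elim: n => [|n IH].
  by apply: (@eq_da P _ _ _ (da_cst PA 1)) => z; rewrite expr0.
by apply: (@eq_da P _ _ _ (da_mul PA Ph IH)) => z; rewrite exprS.
Qed.

Lemma da_and P Q : diff_algebra P -> diff_algebra Q ->
  diff_algebra (fun h => P h /\ Q h).
Proof.
move=> PA QA; split.
- by move=> c; split; exact: da_cst.
- by move=> h g [? ?] [? ?]; split; exact: da_add.
- by move=> h g [? ?] [? ?]; split; exact: da_mul.
- by move=> h [? ?]; split; exact: da_dtau.
Qed.

Lemma da_imp (A : Prop) P : diff_algebra P -> diff_algebra (fun h => A -> P h).
Proof.
move=> PA; split.
- by move=> c _; exact: da_cst.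
- by move=> h g Ph Pg a; apply: da_add; [|exact: Ph|exact: Pg].
- by move=> h g Ph Pg a; apply: da_mul; [|exact: Ph|exact: Pg].
- by move=> h Ph a; apply: da_dtau => //; exact: Ph.
Qed.

(* A pointwise regularity condition that passes to [w |-> j_s(w)^m h(s w)]. *)
Record slash_class (B : (R[i] -> R[i]) -> R[i] -> Prop) : Prop := SlashClass {
  sc_near : forall h g z,
    (\forall w \near (z : R[i]^o), h w = g w) -> B h z -> B g z;
  sc_is_dtau : forall h z, B h z -> is_dtau h z (dtau_scalar h z);
  sc_cst : forall c z, B (fun=> c) z;
  sc_add : forall h g z, B h z -> B g z -> B (fun w => h w + g w) z;
  sc_mul : forall h g z, B h z -> B g z -> B (fun w => h w * g w) z;
  sc_autjz : forall s (m : int) z, \det s = 1 -> upper_half_plane z ->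
    B (fun w => autj s w ^ m) z;
  sc_mobius : forall h s z, \det s = 1 -> upper_half_plane z ->
    B h (mobius s z) -> B (fun w => h (mobius s w)) z }.

Definition dtau_derivable h z : Prop := is_dtau h z (dtau_scalar h z).

Lemma is_dtau_derivable h z al : is_dtau h z al -> dtau_derivable h z.
Proof. by move=> h_dtau; rewrite /dtau_derivable (is_dtau_val h_dtau). Qed.

Lemma dtau_derivable_slash_class : slash_class dtau_derivable.
Proof.
split.
- by move=> h g z hg hd; exact: is_dtau_derivable (is_dtau_near hg hd).
- by [].
- by move=> c z; exact: is_dtau_derivable (is_dtau_cst c z).
- by move=> h g z hd gd; exact: is_dtau_derivable (is_dtauD hd gd).
- by move=> h g z hd gd; exact: is_dtau_derivable (is_dtauM hd gd).
- by move=> s m z ds z0; exact: is_dtau_derivable (is_dtau_autjz m ds z0).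
- move=> h s z ds z0 hd.
  exact: is_dtau_derivable (is_dtau_comp hd (is_cderive_mobius ds z0)).
Qed.

Definition taylor h z : Prop := forall N, taylor_at N.+1 h z.

Lemma taylor_slash_class : slash_class taylor.
Proof.
split.
- by move=> h g z hg ht N; exact: taylor_at_near hg (ht N).
- by move=> h z /(_ 1%N)/taylor_at_cderive/is_cderive_dtau.
- by move=> c z N; exact: taylor_at_cst.
- by move=> h g z ht gt N; exact: taylor_atD.
- by move=> h g z ht gt N; exact: taylor_atM.
- by move=> s m z ds z0 N; exact: taylor_at_autjz.
- by move=> h s z ds z0 ht N; apply: taylor_at_comp; [exact: ht|exact: taylor_at_mobius].
Qed.

Definition smooth_on (B : (R[i] -> R[i]) -> R[i] -> Prop) U h : Prop :=
  forall j z, U z -> B (dtau_iter j h) z.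

Lemma smooth_on_subset B U V h : U `<=` V -> smooth_on B V h -> smooth_on B U h.
Proof. by move=> UV hs j z /UV; exact: hs. Qed.

Lemma iter_dtau_cst c j : dtau_iter j (fun=> c) = fun=> if j is 0 then c else 0.
Proof.
elim: j => [//|j IH]; apply/funext => z; rewrite iterS IH.
by case: j {IH} => [|j]; rewrite (is_dtau_val (is_dtau_cst _ _)).
Qed.

Section SmoothOn.
Variables (B : (R[i] -> R[i]) -> R[i] -> Prop) (U : set R[i]).
Hypotheses (HB : slash_class B) (Uopen : open (U : set R[i]^o)).

Lemma open_near z : U z -> \forall w \near (z : R[i]^o), U w.
Proof. by move=> Uz; exact: open_nbhs_nbhs. Qed.

Lemma dtau_eq_on h g z al : (forall w, U w -> h w = g w) -> U z ->
  is_dtau h z al -> dtau_scalar g z = al.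
Proof.
move=> hg Uz hd; apply: is_dtau_val; apply: is_dtau_near hd.
by apply: filterS (open_near Uz) => w; exact: hg.
Qed.

Definition smooth_upto (j : nat) h : Prop :=
  forall i z, (i <= j)%N -> U z -> B (dtau_iter i h) z.

Lemma smooth_onE h : smooth_on B U h <-> forall j, smooth_upto j h.
Proof. by split=> [hs j i z _|hs j z]; [exact: hs|exact: (hs j)]. Qed.

Lemma smooth_upto_le i j h : (i <= j)%N -> smooth_upto j h -> smooth_upto i h.
Proof. by move=> ij hs a z ai; apply: hs; exact: leq_trans ij. Qed.

Lemma smooth_uptoS j h : (forall z, U z -> B h z) ->
  smooth_upto j (dtau_scalar h) -> smooth_upto j.+1 h.
Proof. by move=> h0 hs [|i] z ij Uz; [exact: h0|rewrite iterSr; exact: hs]. Qed.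

Lemma smooth_upto_dtau j h : smooth_upto j.+1 h -> smooth_upto j (dtau_scalar h).
Proof. by move=> hs i z ij Uz; rewrite -iterSr; exact: hs. Qed.

Lemma smooth_upto_iter_eq j h g : smooth_upto j h -> (forall z, U z -> h z = g z) ->
  forall i z, (i <= j)%N -> U z -> dtau_iter i g z = dtau_iter i h z.
Proof.
move=> hs hg; elim=> [|i IH] z ij Uz; first by rewrite /= hg.
rewrite !iterS; apply: (@dtau_eq_on (dtau_iter i h)) => // [w Uw|].
  by rewrite IH // ltnW.
exact: (sc_is_dtau HB (hs i z (ltnW ij) Uz)).
Qed.

Lemma smooth_upto_eq j h g : smooth_upto j h -> (forall z, U z -> h z = g z) ->
  smooth_upto j g.
Proof.
move=> hs hg i z ij Uz; apply: (sc_near HB) (hs i z ij Uz).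
by apply: filterS (open_near Uz) => w Uw; rewrite (smooth_upto_iter_eq hs hg).
Qed.

Lemma smooth_uptoD j h g : smooth_upto j h -> smooth_upto j g ->
  smooth_upto j (fun z => h z + g z).
Proof.
elim: j h g => [|j IH] h g hs gs.
  by move=> [|//] z _ Uz; apply: (sc_add HB); [exact: (hs 0%N)|exact: (gs 0%N)].
apply: smooth_uptoS => [z Uz|].
  by apply: (sc_add HB); [exact: (hs 0%N)|exact: (gs 0%N)].
apply: smooth_upto_eq (IH _ _ (smooth_upto_dtau hs) (smooth_upto_dtau gs)) _ => z Uz.
have h_dtau := sc_is_dtau HB (hs 0%N z (leq0n _) Uz).
by rewrite (is_dtau_val (is_dtauD h_dtau (sc_is_dtau HB (gs 0%N z (leq0n _) Uz)))).
Qed.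

Lemma smooth_uptoM j h g : smooth_upto j h -> smooth_upto j g ->
  smooth_upto j (fun z => h z * g z).
Proof.
elim: j h g => [|j IH] h g hs gs.
  by move=> [|//] z _ Uz; apply: (sc_mul HB); [exact: (hs 0%N)|exact: (gs 0%N)].
apply: smooth_uptoS => [z Uz|].
  by apply: (sc_mul HB); [exact: (hs 0%N)|exact: (gs 0%N)].
have hs' := smooth_upto_le (leqnSn j) hs; have gs' := smooth_upto_le (leqnSn j) gs.
apply: smooth_upto_eq (smooth_uptoD (IH _ _ (smooth_upto_dtau hs) gs')
  (IH _ _ hs' (smooth_upto_dtau gs))) _ => z Uz.
have h_dtau := sc_is_dtau HB (hs 0%N z (leq0n _) Uz).
by rewrite (is_dtau_val (is_dtauM h_dtau (sc_is_dtau HB (gs 0%N z (leq0n _) Uz)))).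
Qed.

Lemma smooth_on_eq h g :
  (forall z, U z -> h z = g z) -> smooth_on B U h -> smooth_on B U g.
Proof. by move=> hg /smooth_onE hs; apply/smooth_onE => j; exact: smooth_upto_eq hg. Qed.

Lemma iter_dtau_eq_on h g j z : (forall z, U z -> h z = g z) -> smooth_on B U h -> U z ->
  dtau_iter j g z = dtau_iter j h z.
Proof. by move=> hg /smooth_onE hs;
  exact: smooth_upto_iter_eq (hs j) hg _ _ (leqnn j). Qed.

Lemma smooth_on_diff_algebra : diff_algebra (smooth_on B U).
Proof.
split.
- by move=> c j z _; rewrite iter_dtau_cst; exact: sc_cst.
- by move=> h g /smooth_onE hs /smooth_onE gs; apply/smooth_onE => j; exact: smooth_uptoD.
- by move=> h g /smooth_onE hs /smooth_onE gs; apply/smooth_onE => j; exact: smooth_uptoM.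
- by move=> h hs j z Uz; rewrite -iterSr; exact: hs.
Qed.

Lemma smooth_on_is_dtau h j z : smooth_on B U h -> U z ->
  is_dtau (dtau_iter j h) z (dtau_iter j.+1 h z).
Proof. by move=> hs Uz; rewrite iterS; exact: (sc_is_dtau HB (hs j z Uz)). Qed.

Lemma smooth_on_derivable h : smooth_on B U h -> smooth_on dtau_derivable U h.
Proof. by move=> hs j z Uz; exact: smooth_on_is_dtau hs Uz. Qed.

Lemma iter_dtau_linear (I : finType) (c : I -> R[i]) (h : I -> R[i] -> R[i]) j z :
  (forall i, smooth_on B U (h i)) -> U z ->
  dtau_iter j (fun w => \sum_i c i * h i w) z = \sum_i c i * dtau_iter j (h i) z.
Proof.
move=> hs; elim: j z => [//|j IH] z Uz; rewrite iterS.
apply: (@dtau_eq_on (fun w => \sum_i c i * dtau_iter j (h i) w)) => // [w Uw|].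
  by rewrite IH.
by apply: is_dtau_sum => i _; apply: is_dtauZ; exact: smooth_on_is_dtau.
Qed.

Lemma iter_dtau_antiholomorphic b h j z :
  (forall z, U z -> is_dtau b z 0) -> smooth_on B U h -> U z ->
  dtau_iter j (fun w => b w * h w) z = b z * dtau_iter j h z.
Proof.
move=> bd hs; elim: j z => [//|j IH] z Uz; rewrite iterS.
apply: (@dtau_eq_on (fun w => b w * dtau_iter j h w)) => // [w Uw|]; first by rewrite IH.
apply: is_dtau_eq (is_dtauM (bd z Uz) (smooth_on_is_dtau j hs Uz)) _.
by rewrite mul0r add0r.
Qed.

End SmoothOn.
End DifferentialAlgebras.

Section Slash.
Variable R : realType.
Implicit Types (phi psi : R[i] -> R[i]) (s : 'M[R]_2) (kap lam : int) (z : R[i]).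

Definition slash s kap phi z : R[i] := autj s z ^ (- kap) * phi (mobius s z).

Lemma is_dtau_slash s kap phi z : \det s = 1 -> upper_half_plane z ->
  dtau_derivable phi (mobius s z) ->
  is_dtau (slash s kap phi) z (kap%:~R * autx s z * slash s kap phi z
    + slash s (kap + 2) (dtau_scalar phi) z).
Proof.
move=> ds z0 phid; have j0 := autj_neq0 ds z0.
apply: is_dtau_eq (is_dtauM (is_dtau_autjz (- kap) ds z0)
  (is_dtau_comp phid (is_cderive_mobius ds z0))) _.
have jE : autj s z ^ (- (kap + 2)) = autj s z ^ (- kap) * autj s z ^- 2.
  by rewrite opprD expfzDr.
rewrite /slash jE (expfz_autx (- kap) ds z0) mulrNz /autx; field.
exact: j0.
Qed.

Section IteratedSlash.
Variables (B : (R[i] -> R[i]) -> R[i] -> Prop) (s : 'M[R]_2) (U : set R[i]).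
Hypotheses (HB : slash_class B) (ds : \det s = 1).
Hypotheses (Uopen : open (U : set R[i]^o)) (UH : U `<=` upper_half_plane).

Lemma iter_dtau_slash kap phi r z : smooth_on B (mobius s @` U) phi -> U z ->
  dtau_iter r (slash s kap phi) z =
  (bol_poly kap (fun i => slash s (kap + (2 * i)%:Z) (dtau_iter i phi) z) r).[autx s z].
Proof.
move=> phis; rewrite horner_bol_poly; elim: r z => [|r IH] z Uz.
  by rewrite big_ord1 /bol_coef binn big_geq // !mul1r mulr1 muln0 addr0.
pose S i := slash s (kap + (2 * i)%:Z) (dtau_iter i phi).
have Sd i : is_dtau (S i) z ((kap + (2 * i)%:Z)%:~R * autx s z * S i z + S i.+1 z).
  have phid := sc_is_dtau HB (phis i _ (imageP _ Uz)).
  have := is_dtau_slash (kap + (2 * i)%:Z) ds (UH Uz) phid.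
  by rewrite -addrA (_ : (2 * i)%:Z + 2 = (2 * i.+1)%:Z) //; lia.
rewrite iterS; apply: (@dtau_eq_on _ _ Uopen (fun w => \sum_(i < r.+1)
    bol_coef _ kap r i * (S i w * autx s w ^+ (r - i)))) => // [w Uw|].
  by rewrite IH //; apply: eq_bigr => i _; rewrite mulrA.
apply: is_dtau_eq.
  apply: is_dtau_sum => i _; apply: is_dtauZ.
  exact: is_dtauM (Sd i) (is_dtauX (r - i) (is_dtau_autx ds (UH Uz))).
transitivity (\sum_(i < r.+1)
  (bol_coef _ kap r i * (kap + r%:Z + i%:Z)%:~R * S i z * autx s z ^+ (r.+1 - i)
   + bol_coef _ kap r i * S i.+1 z * autx s z ^+ (r - i))).
  apply: eq_bigr => i _; have ir : (i <= r)%N by rewrite -ltnS.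
  have -> : (r - i)%:R * autx s z ^+ 2 * autx s z ^+ (r - i).-1 =
      (r - i)%:R * autx s z ^+ (r - i).+1.
    by case: (r - i)%N => [|m]; rewrite ?mul0r //= -mulrA -exprD.
  by rewrite subSn // !intrD -!pmulrn natrB // natrM exprS; ring.
rewrite [RHS](eq_bigr (fun i : 'I_r.+2 =>
    bol_coef _ kap r i * (kap + r%:Z + i%:Z)%:~R * S i z * autx s z ^+ (r.+1 - i)
    + (if (i : nat) is i'.+1 then bol_coef _ kap r i' else 0)
      * S i z * autx s z ^+ (r.+1 - i))).
  rewrite !big_split /=; congr (_ + _).
    by rewrite [RHS]big_ord_recr /= bol_coef_small // !mul0r addr0.
  by rewrite [RHS]big_ord_recl /= !mul0r add0r.
by move=> i _; rewrite bol_coef_recr ?leq_ord // !mulrDl.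
Qed.

Lemma smooth_on_slash kap phi :
  smooth_on B (mobius s @` U) phi -> smooth_on B U (slash s kap phi).
Proof.
move=> phis r z Uz; apply: (sc_near HB (h := fun w =>
  (bol_poly kap (fun i => slash s (kap + (2 * i)%:Z) (dtau_iter i phi) w) r).[autx s w])).
  by apply: filterS (open_near Uopen Uz) => w Uw; rewrite iter_dtau_slash.
have z0 := UH Uz; have Bsum (n : nat) (h : 'I_n -> R[i] -> R[i]) :
    (forall i, B (h i) z) -> B (fun w => \sum_(i < n) h i w) z.
  elim: n h => [|n IHn] h Bh.
    by apply: (@eq_da _ (B^~ z) _ _ _ (sc_cst HB 0 z)) => w; rewrite big_ord0.
  apply: (@eq_da _ (B^~ z) _ _ _ (sc_add HB (IHn _ _) (Bh ord_max))) => [w|i].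
    by rewrite big_ord_recr.
  exact: Bh.
have Bautx m : B (fun w => autx s w ^+ m) z.
  elim: m => [|m IHm].
    by apply: (@eq_da _ (B^~ z) _ _ _ (sc_cst HB 1 z)) => w; rewrite expr0.
  apply: (@eq_da _ (B^~ z) _ _ _ (sc_mul HB (sc_mul HB (sc_cst HB (- autj' s) z)
    (sc_autjz HB (-1) ds z0)) IHm)) => w.
  by rewrite exprS.
apply: (@eq_da _ (B^~ z) _ _ (fun w => esym (horner_bol_poly _ _ _ _))).
apply: Bsum => i.
apply: (sc_mul HB); last exact: Bautx.
apply: (sc_mul HB); first exact: sc_cst.
apply: (sc_mul HB); first exact: sc_autjz.
by apply: (sc_mobius HB) => //; apply: phis; exact: imageP.
Qed.

Definition rc_bracket n (c : nat -> R[i]) phi psi z : R[i] :=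
  \sum_(r < n.+1) c r * dtau_iter r phi z * dtau_iter (n - r) psi z.

Lemma rc_bracket_slash kap lam n c phi psi z :
  rc_recurrence kap lam n c ->
  smooth_on B (mobius s @` U) phi -> smooth_on B (mobius s @` U) psi -> U z ->
  rc_bracket n c (slash s kap phi) (slash s lam psi) z =
  slash s (kap + lam + (2 * n)%:Z) (rc_bracket n c phi psi) z.
Proof.
move=> c_rec phis psis Uz; have j0 := autj_neq0 ds (UH Uz).
pose t i := slash s (kap + (2 * i)%:Z) (dtau_iter i phi) z.
pose u i := slash s (lam + (2 * i)%:Z) (dtau_iter i psi) z.
transitivity (rc_poly kap lam n c t u).[autx s z].
  rewrite horner_sum; apply: eq_bigr => r _.
  by rewrite hornerZ hornerM !iter_dtau_slash // mulrA.
rewrite rc_poly_const // hornerC /slash mulr_sumr; apply: eq_bigr => r _.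
rewrite /t /u /slash; have rn : (r <= n)%N by rewrite -ltnS.
have -> : - (kap + lam + (2 * n)%:Z) =
    - (kap + (2 * r)%:Z) + - (lam + (2 * (n - r))%:Z) by lia.
by rewrite expfzDr //; ring.
Qed.

End IteratedSlash.
End Slash.

(** * Families of functions *)

Section Families.
Variable R : realType.
Implicit Types (F G : nat -> R[i] -> R[i]) (s : 'M[R]_2) (k l : int) (d e n t : nat).
Implicit Types (z p q : R[i]) (U V : set R[i]) (c : nat -> R[i]).

(* The lift of the derivation to families that turns into the derivation itself
   when [(F_0, ..., F_d)] is replaced by the functions [polar d F p q]. *)
Definition family_dtau d F t : R[i] -> R[i] :=
  if t is t'.+1 then fun z => dtau_scalar (F t) z + (d%:R - t'%:R) * F t' z
  else dtau_scalar (F 0%N).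

Definition polar d F p q z : R[i] :=
  \sum_(t < d.+1) F t z * (q * z - p) ^+ (d - t) * q ^+ t.

Lemma polar_inj d F G z : (forall p q, polar d F p q z = polar d G p q z) ->
  forall t, (t <= d)%N -> F t z = G t z.
Proof.
move=> FG t td; pose P H : {poly R[i]} := \poly_(t < d.+1) H t z.
have PE H (i : nat) : (P H).[i%:R] = polar d H (i%:R * z - 1) i%:R z.
  rewrite horner_poly; apply: eq_bigr => r _.
  by rewrite opprB addrC subrK expr1n mulr1.
have : P F = P G.
  apply: (@poly_ext_inj _ _ _ (fun i => i%:R)) => [i j /eqP|i]; last by rewrite !PE FG.
  by rewrite eqr_nat => /eqP.
by move=> /(congr1 (fun Q : {poly R[i]} => Q`_t)); rewrite !coef_poly ltnS td.
Qed.

Lemma is_dtau_polar d F p q z : (forall t, (t <= d)%N -> dtau_derivable (F t) z) ->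
  is_dtau (polar d F p q) z (polar d (family_dtau d F) p q z).
Proof.
move=> Fd; set v := q * z - p.
apply: is_dtau_eq.
  apply: is_dtau_sum => t _; apply: is_dtauM (is_dtau_cst (q ^+ t) z).
  exact: is_dtauM (Fd t (leq_ord t)) (is_dtauX (d - t) (is_dtau_affine q (- p) z)).
pose drop t : R[i] := (d%:R - t%:R) * F t z * v ^+ (d - t.+1) * q ^+ t.+1.
transitivity (\sum_(t < d.+1) dtau_scalar (F t) z * v ^+ (d - t) * q ^+ t
    + \sum_(t < d) drop t).
  have <- : \sum_(t < d.+1) drop t = \sum_(t < d) drop t.
    by rewrite big_ord_recr /= /drop subrr !mul0r addr0.
  rewrite -big_split /=; apply: eq_bigr => t _; rewrite /drop -/v -natrB ?leq_ord //.
  by rewrite subnS exprS; ring.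
rewrite [RHS]big_ord_recl [X in X + _ = _]big_ord_recl -addrA; congr (_ + _).
rewrite -big_split; apply: eq_bigr => t _; rewrite /drop /= add0n /bump leq0n add1n.
by rewrite -/v; ring.
Qed.

Lemma family_dtau_da (P : (R[i] -> R[i]) -> Prop) d F j : diff_algebra P ->
  (forall t, (t <= d)%N -> P (F t)) ->
  forall t, (t <= d)%N -> P (iter j (family_dtau d) F t).
Proof.
move=> PA PF; elim: j => [|j IH] t td; first exact: PF.
case: t td => [|t] td; first exact: da_dtau PA _ (IH 0%N td).
apply: (da_add PA); first exact: da_dtau PA _ (IH t.+1 td).
by apply: (da_mul PA); [exact: da_cst|exact: IH (ltnW td)].
Qed.

Lemma iter_family_dtau0 d F j : iter j (family_dtau d) F 0%N = dtau_iter j (F 0%N).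
Proof. by elim: j => [//|j IH]; rewrite !iterS /= IH. Qed.

Definition family_mul d e F G t z : R[i] :=
  \sum_(a < d.+1) \sum_(b < e.+1 | (a + b == t)%N) F a z * G b z.

Lemma family_mul0 d e F G z : family_mul d e F G 0 z = F 0%N z * G 0%N z.
Proof.
rewrite /family_mul big_ord_recl [X in _ + X]big1 ?addr0.
  by rewrite (big_pred1 ord0) // => b; rewrite add0n.
by move=> a _; rewrite big1 // => b; rewrite /bump /= => /eqP; lia.
Qed.

Lemma polar_mul d e F G p q z :
  polar (d + e) (family_mul d e F G) p q z = polar d F p q z * polar e G p q z.
Proof.
rewrite /polar /family_mul mulr_suml; under eq_bigr do rewrite !mulr_suml.
rewrite exchange_big /=; apply: eq_bigr => a _; rewrite mulr_sumr.
under eq_bigr do rewrite !mulr_suml; rewrite (exchange_big_dep xpredT) //=.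
apply: eq_bigr => b _; have ad := leq_ord a; have be := leq_ord b.
have hab : (a + b < (d + e).+1)%N by lia.
rewrite (big_pred1 (Ordinal hab)) /=; last by move=> t; rewrite eq_sym.
have -> : (d + e - (a + b) = (d - a) + (e - b))%N by lia.
by rewrite !exprD; ring.
Qed.

Definition family_bracket d e n c F G t z : R[i] :=
  \sum_(r < n.+1)
    c r * family_mul d e (iter r (family_dtau d) F) (iter (n - r) (family_dtau e) G) t z.

Lemma family_bracket0 d e n c F G z :
  family_bracket d e n c F G 0 z = rc_bracket n c (F 0%N) (G 0%N) z.
Proof.
apply: eq_bigr => r _.
by rewrite family_mul0 !iter_family_dtau0 mulrA.
Qed.

Lemma family_bracket_da (P : (R[i] -> R[i]) -> Prop) d e n c F G : diff_algebra P ->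
  (forall t, (t <= d)%N -> P (F t)) -> (forall t, (t <= e)%N -> P (G t)) ->
  forall t, P (family_bracket d e n c F G t).
Proof.
move=> PA PF PG t; apply: da_sum => // r _; apply: (da_mul PA); first exact: da_cst.
apply: da_sum => // a _; apply: da_sum => // b _; apply: (da_mul PA).
  by apply: family_dtau_da => //; exact: leq_ord.
by apply: family_dtau_da => //; exact: leq_ord.
Qed.

Lemma smooth_on_affine U p q : smooth_on (@dtau_derivable R) U (fun z => p * z + q).
Proof.
have dE : dtau_scalar (fun z => p * z + q) = fun=> p.
  by apply/funext => z; rewrite (is_dtau_val (is_dtau_affine p q z)).
move=> [|j] z _; first exact: is_dtau_derivable (is_dtau_affine p q z).
by rewrite iterSr dE iter_dtau_cst; exact: is_dtau_derivable (is_dtau_cst _ z).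
Qed.

Section SmoothFamilies.
Variables (B : (R[i] -> R[i]) -> R[i] -> Prop) (U : set R[i]).
Hypotheses (HB : slash_class B) (Uopen : open (U : set R[i]^o)).

Lemma smooth_on_polar d F p q : (forall t, (t <= d)%N -> smooth_on B U (F t)) ->
  smooth_on (@dtau_derivable R) U (polar d F p q).
Proof.
move=> Fs; have UA := smooth_on_diff_algebra (@dtau_derivable_slash_class R) Uopen.
apply: da_sum => // t _; apply: (da_mul UA); last exact: (da_cst UA).
apply: (da_mul UA); first exact: (smooth_on_derivable HB (Fs t (leq_ord t))).
by apply: (da_exp _ UA); exact: smooth_on_affine.
Qed.

Lemma iter_dtau_polar d F p q j z : (forall t, (t <= d)%N -> smooth_on B U (F t)) ->
  U z -> dtau_iter j (polar d F p q) z = polar d (iter j (family_dtau d) F) p q z.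
Proof.
move=> Fs; elim: j z => [//|j IH] z Uz; rewrite iterS.
apply: (@dtau_eq_on _ _ Uopen (polar d (iter j (family_dtau d) F) p q)) => // [w Uw|].
  by rewrite IH.
apply: is_dtau_polar => t td; apply: (sc_is_dtau HB).
exact: (family_dtau_da j (smooth_on_diff_algebra HB Uopen) Fs td 0).
Qed.

Lemma polar_bracket d e n c F G p q z :
  (forall t, (t <= d)%N -> smooth_on B U (F t)) ->
  (forall t, (t <= e)%N -> smooth_on B U (G t)) -> U z ->
  polar (d + e) (family_bracket d e n c F G) p q z =
  rc_bracket n c (polar d F p q) (polar e G p q) z.
Proof.
move=> Fs Gs Uz; transitivity (\sum_(r < n.+1) c r *
    polar (d + e) (family_mul d e (iter r (family_dtau d) F)
                                  (iter (n - r) (family_dtau e) G)) p q z).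
  rewrite /polar /family_bracket; under eq_bigr do rewrite !mulr_suml.
  rewrite exchange_big; apply: eq_bigr => r _; rewrite mulr_sumr.
  by apply: eq_bigr => t _; rewrite !mulrA.
by apply: eq_bigr => r _; rewrite polar_mul !iter_dtau_polar // mulrA.
Qed.

Lemma rc_bracket_eq_on n c (phi psi phi' psi' : R[i] -> R[i]) z :
  smooth_on B U phi -> smooth_on B U psi ->
  (forall w, U w -> phi' w = phi w) -> (forall w, U w -> psi' w = psi w) ->
  U z -> rc_bracket n c phi' psi' z = rc_bracket n c phi psi z.
Proof.
move=> phis psis phiE psiE Uz; apply: eq_bigr => r _; congr (_ * _ * _).
  by apply: (iter_dtau_eq_on HB Uopen) => // w /phiE.
by apply: (iter_dtau_eq_on HB Uopen) => // w /psiE.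
Qed.

Lemma rc_bracket_linear n c (I J : finType) (a : I -> R[i]) (b : J -> R[i])
    (phi : I -> R[i] -> R[i]) (psi : J -> R[i] -> R[i]) h g z :
  (forall i, smooth_on B U (phi i)) -> (forall j, smooth_on B U (psi j)) ->
  (forall w, U w -> h w = \sum_i a i * phi i w) ->
  (forall w, U w -> g w = \sum_j b j * psi j w) -> U z ->
  rc_bracket n c h g z = \sum_i \sum_j a i * b j * rc_bracket n c (phi i) (psi j) z.
Proof.
move=> phis psis hE gE Uz; have UA := smooth_on_diff_algebra HB Uopen.
have iterE (K : finType) (x : K -> R[i]) (f : K -> R[i] -> R[i]) f0 r :
    (forall i, smooth_on B U (f i)) -> (forall w, U w -> f0 w = \sum_i x i * f i w) ->
    dtau_iter r f0 z = \sum_i x i * dtau_iter r (f i) z.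
  move=> fs fE; rewrite -(iter_dtau_linear HB Uopen x r fs Uz).
  apply: (iter_dtau_eq_on HB Uopen) Uz => [w Uw|]; first by rewrite fE.
  by apply: da_sum => // i _; apply: (da_mul UA) => //; exact: da_cst.
transitivity (\sum_(r < n.+1) \sum_i \sum_j
    a i * b j * (c r * dtau_iter r (phi i) z * dtau_iter (n - r) (psi j) z)).
  apply: eq_bigr => r _; rewrite (iterE _ _ _ _ _ phis hE) (iterE _ _ _ _ _ psis gE).
  rewrite -mulrA big_distrlr /= mulr_sumr; apply: eq_bigr => i _.
  by rewrite mulr_sumr; apply: eq_bigr => j _; ring.
rewrite exchange_big; apply: eq_bigr => i _; rewrite exchange_big.
by apply: eq_bigr => j _; rewrite mulr_sumr.
Qed.

End SmoothFamilies.

Definition slash_family s k d F t z : R[i] :=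
  \sum_(r < d.+1) 'C(r, t)%:R * (- autj' s) ^+ (r - t)
    * slash s (k - r%:Z - t%:Z) (F r) z.

Lemma polar_slash_family s k d F p q z : \det s = 1 -> upper_half_plane z ->
  polar d (slash_family s k d F) p q z =
  slash s (k - d%:Z) (polar d F ((s 0 0)%:C * p + (s 0 1)%:C * q)
                                ((s 1 0)%:C * p + (s 1 1)%:C * q)) z.
Proof.
move=> ds z0; have j0 := autj_neq0 ds z0; set j := autj s z in j0 *.
set q' := (s 1 0)%:C * p + _; set p' := (s 0 0)%:C * p + _.
pose v := q * z - p; pose cc := autj' s.
have q'E : q' = - (cc * v) + q * j by rewrite /q' /v /cc /j /autj /autj'; ring.
have v'E : q' * mobius s z - p' = v / j.
  have D : (s 0 0)%:C * (s 1 1)%:C - (s 0 1)%:C * (s 1 0)%:C = 1 :> R[i].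
    by rewrite -!rmorphM -rmorphB -det_mx22 ds.
  apply: (mulIf j0); rewrite divfK // mulrBl -mulrA [mobius s z * _]divfK //.
  by rewrite -[RHS]mul1r -D /q' /p' /v /j /autj; ring.
have q'X r : (r <= d)%N -> q' ^+ r =
    \sum_(t < d.+1) 'C(r, t)%:R * (- (cc * v)) ^+ (r - t) * (q * j) ^+ t.
  move=> rd; rewrite q'E exprDn (big_ord_widen d.+1 (fun t =>
    (- (cc * v)) ^+ (r - t) * (q * j) ^+ t *+ 'C(r, t))) // big_mkcond.
  apply: eq_bigr => t _; case: ltnP => [_|rt]; first by rewrite -mulr_natl mulrA.
  by rewrite bin_small // !mul0r.
rewrite /polar /slash_family /slash; under eq_bigr do rewrite !mulr_suml.
rewrite exchange_big mulr_sumr; apply: eq_bigr => r _ /=; have rd := leq_ord r.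
rewrite v'E -/j -/cc -/v q'X // !mulr_sumr; apply: eq_bigr => t _.
have [tr|rt] := leqP t r; last by rewrite bin_small // !(mul0r, mulr0).
have -> : j ^ (- (k - r%:Z - t%:Z)) = j ^ (- (k - d%:Z)) * (j ^+ t / j ^+ (d - r)).
  rewrite (exprnP j t) exprnN -!expfzDr //.
  by congr (j ^ _); lia.
have -> : (d - t = (d - r) + (r - t))%N by lia.
by rewrite exprD !exprMn -mulNr exprMn exprVn; ring.
Qed.

End Families.

Section SlashedBrackets.
Variables (R : realType) (B : (R[i] -> R[i]) -> R[i] -> Prop) (V : set R[i]).
Hypotheses (HB : slash_class B) (Vopen : open (V : set R[i]^o)).
Implicit Types (F G : nat -> R[i] -> R[i]) (s : 'M[R]_2) (k l : int) (d e n t : nat).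
Implicit Types (z p q : R[i]) (c : nat -> R[i]).

Definition mobius_preimage s (U : set R[i]) : set R[i] :=
  [set z | upper_half_plane z /\ U (mobius s z)].

Lemma open_mobius_preimage s :
  \det s = 1 -> open (mobius_preimage s V : set R[i]^o).
Proof.
move=> ds; rewrite openE => z [z0 Vz].
apply: filterS2 (open_near (@open_upper_half_plane R) z0)
  (mobius_near ds z0 (open_near Vopen Vz)).
by move=> w.
Qed.

Lemma mobius_image_preimage s : mobius s @` mobius_preimage s V `<=` V.
Proof. by move=> _ [z [_ Vz] <-]. Qed.

Lemma mobius_preimage_upper s : mobius_preimage s V `<=` upper_half_plane.
Proof. by move=> z []. Qed.

Section Slashed.
Variable s : 'M[R]_2.
Hypothesis ds : \det s = 1.

Let U := mobius_preimage s V.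
Let Uopen : open (U : set R[i]^o) := open_mobius_preimage ds.
Let UH : U `<=` upper_half_plane := @mobius_preimage_upper s.

Lemma smooth_on_slash_preimage (D : (R[i] -> R[i]) -> R[i] -> Prop) (kap : int) phi :
  slash_class D -> smooth_on D V phi -> smooth_on D U (slash s kap phi).
Proof.
move=> HD phis; apply: (smooth_on_slash HD ds Uopen UH).
exact: smooth_on_subset (@mobius_image_preimage s) phis.
Qed.

Lemma smooth_on_slash_family k d F : (forall t, (t <= d)%N -> smooth_on B V (F t)) ->
  forall t, smooth_on B U (slash_family s k d F t).
Proof.
move=> Fs t; have UA := smooth_on_diff_algebra HB Uopen.
apply: da_sum => // r _; apply: (da_mul UA); first exact: (da_cst UA).
by apply: smooth_on_slash_preimage => //; apply: Fs; exact: leq_ord.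
Qed.

Lemma slash_family_bracket k l d e n c F G t z :
  rc_recurrence (k - d%:Z) (l - e%:Z) n c ->
  (forall t, (t <= d)%N -> smooth_on B V (F t)) ->
  (forall t, (t <= e)%N -> smooth_on B V (G t)) ->
  U z -> (t <= d + e)%N ->
  slash_family s (k + l + (2 * n)%:Z) (d + e) (family_bracket d e n c F G) t z =
  family_bracket d e n c (slash_family s k d F) (slash_family s l e G) t z.
Proof.
move=> c_rec Fs Gs Uz tde; apply: (@polar_inj _ (d + e)) tde => p q.
have [z0 Vz] := Uz; have HD := @dtau_derivable_slash_class R.
set p' := (s 0 0)%:C * p + (s 0 1)%:C * q; set q' := (s 1 0)%:C * p + (s 1 1)%:C * q.
have sF := smooth_on_polar HB Vopen p' q' Fs.
have sG := smooth_on_polar HB Vopen p' q' Gs.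
rewrite polar_slash_family // (polar_bracket HB Uopen) //; last first.
- by move=> i _; exact: smooth_on_slash_family.
- by move=> i _; exact: smooth_on_slash_family.
rewrite (@rc_bracket_eq_on _ _ _ HD Uopen n c (slash s (k - d%:Z) (polar d F p' q'))
  (slash s (l - e%:Z) (polar e G p' q'))) //.
- rewrite (rc_bracket_slash HD ds Uopen UH c_rec) //.
  + rewrite /slash (polar_bracket HB Vopen) //; congr (autj s z ^ _ * _); lia.
  + exact: smooth_on_subset (@mobius_image_preimage s) sF.
  + exact: smooth_on_subset (@mobius_image_preimage s) sG.
- exact: smooth_on_slash_preimage.
- exact: smooth_on_slash_preimage.
- by move=> w [w0 _]; rewrite polar_slash_family.
- by move=> w [w0 _]; rewrite polar_slash_family.
Qed.

End Slashed.
End SlashedBrackets.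

Section VectorFamilies.
Variable R : realType.

Definition coordinate m (F : nat -> R[i] -> 'cV[R[i]]_m) i t z : R[i] := F t z i 0.

Lemma at_cusp_coordinate m s k d (F : nat -> R[i] -> 'cV[R[i]]_m) t z i :
  at_cusp s k d F t z i 0 = slash_family s k d (coordinate F i) t z.
Proof.
rewrite /at_cusp /slash_family summxE big_mkcond; apply: eq_bigr => r _.
case: ifP => [_|tr]; last by rewrite bin_small ?mul0r //; lia.
rewrite mxE /slash /coordinate mulrA; congr (_ * autj s z ^ _ * _); lia.
Qed.

Definition bracket_family d e n (c : nat -> R[i]) m p
    (F : nat -> R[i] -> 'cV[R[i]]_m) (G : nat -> R[i] -> 'cV[R[i]]_p) t z :
    'cV[R[i]]_(m * p) :=
  \col_i family_bracket d e n c (coordinate F (mxtens_unindex i).1)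
                                (coordinate G (mxtens_unindex i).2) t z.

Lemma coordinate_bracket_family d e n c m p (F : nat -> R[i] -> 'cV[R[i]]_m)
    (G : nat -> R[i] -> 'cV[R[i]]_p) i :
  coordinate (bracket_family d e n c F G) i =
  family_bracket d e n c (coordinate F (mxtens_unindex i).1)
                         (coordinate G (mxtens_unindex i).2).
Proof. by apply/funext => t; apply/funext => z; rewrite /coordinate mxE. Qed.

Lemma iter_dtau_coordinate m (f : R[i] -> 'cV[R[i]]_m) i j :
  iter j (@dtau_scalar R) (fun z => f z i 0) = fun z => iter j (@dtau R m) f z i 0.
Proof.
elim: j => [//|j IH]; rewrite !iterS IH.
by apply/funext => z; rewrite mxE.
Qed.

Lemma bracket_family0 d e n (c : 'rV[R[i]]_n.+1) (c' : nat -> R[i]) m p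
    (F : nat -> R[i] -> 'cV[R[i]]_m) (G : nat -> R[i] -> 'cV[R[i]]_p) :
  (forall r : 'I_n.+1, c 0 r = c' r) ->
  bracket_family d e n c' F G 0%N = bracket c (F 0%N) (G 0%N).
Proof.
move=> cE; apply/funext => z; apply/matrixP => i j.
rewrite ord1 mxE family_bracket0 summxE; apply: eq_bigr => r _.
by rewrite !iter_dtau_coordinate cE [RHS]mxE [in RHS]mxE !ord1 mulrA.
Qed.

Section Law.
Variables (s : 'M[R]_2) (ds : \det s = 1).

(* The quasi-modular transformation law at [s] only involves these polar functions. *)
Definition polar_at d (F : nat -> R[i] -> R[i]) : R[i] -> R[i] :=
  polar d F (- (s 1 1)%:C) (autj' s).

Lemma quasimodular_lawP m (k : int) d (F : nat -> R[i] -> 'cV[R[i]]_m)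
    (A : 'M[R[i]]_m) z : upper_half_plane z ->
  F 0%N (mobius s z) =
    \sum_(r < d.+1) (autj s z ^ (k - r%:Z) * autj' s ^+ r) *: (A *m F r z) <->
  forall i, slash s (k - d%:Z) (coordinate F i 0) z =
    \sum_j A i j * polar_at d (coordinate F j) z.
Proof.
move=> z0; have j0 := autj_neq0 ds z0.
have lawE i : (\sum_(r < d.+1) (autj s z ^ (k - r%:Z) * autj' s ^+ r)
      *: (A *m F r z)) i 0 =
    autj s z ^ (k - d%:Z) * \sum_j A i j * polar_at d (coordinate F j) z.
  rewrite summxE; under [in RHS]eq_bigr do rewrite mulr_sumr.
  rewrite [X in _ = _ * X]exchange_big mulr_sumr; apply: eq_bigr => r _.
  rewrite !mxE !mulr_sumr; apply: eq_bigr => j _; have rd := leq_ord r.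
  have -> : k - r%:Z = k - d%:Z + (d - r)%N%:Z by lia.
  by rewrite expfzDr // opprK /coordinate -/(autj s z) -exprnP; ring.
have jK : autj s z ^ (- (k - d%:Z)) * autj s z ^ (k - d%:Z) = 1.
  by rewrite -expfzDr // addNr.
split=> [law i|law].
  by rewrite /slash {1}/coordinate law lawE mulrA jK mul1r.
apply/matrixP => i j; rewrite ord1 lawE -law /slash mulrA.
by rewrite [_ ^ _ * _ ^ _]mulrC jK mul1r.
Qed.

Variables (B : (R[i] -> R[i]) -> R[i] -> Prop) (V : set R[i]).
Hypotheses (HB : slash_class B) (Vopen : open (V : set R[i]^o)).
Hypothesis VH : V `<=` upper_half_plane.
Variables (k l : int) (d e n m p : nat) (c : nat -> R[i]).
Variables (F : nat -> R[i] -> 'cV[R[i]]_m) (G : nat -> R[i] -> 'cV[R[i]]_p).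
Variables (A : 'M[R[i]]_m) (A' : 'M[R[i]]_p).
Hypothesis c_rec : rc_recurrence (k - d%:Z) (l - e%:Z) n c.
Hypothesis Fs : forall i t, (t <= d)%N -> smooth_on B V (coordinate F i t).
Hypothesis Gs : forall i t, (t <= e)%N -> smooth_on B V (coordinate G i t).
Hypothesis F_law : forall z, V z -> V (mobius s z) -> F 0%N (mobius s z) =
  \sum_(r < d.+1) (autj s z ^ (k - r%:Z) * autj' s ^+ r) *: (A *m F r z).
Hypothesis G_law : forall z, V z -> V (mobius s z) -> G 0%N (mobius s z) =
  \sum_(r < e.+1) (autj s z ^ (l - r%:Z) * autj' s ^+ r) *: (A' *m G r z).

Lemma bracket_family_law z : V z -> V (mobius s z) ->
  bracket_family d e n c F G 0%N (mobius s z) =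
  \sum_(r < (d + e).+1) (autj s z ^ (k + l + (2 * n)%:Z - r%:Z) * autj' s ^+ r)
    *: ((A *t A') *m bracket_family d e n c F G r z).
Proof.
move=> Vz Vsz; have HD := @dtau_derivable_slash_class R.
apply/(quasimodular_lawP _ _ _ _ (VH Vz)) => i; rewrite coordinate_bracket_family.
set i1 := (mxtens_unindex i).1; set i2 := (mxtens_unindex i).2.
pose U := mobius_preimage s V `&` V.
have Uopen : open (U : set R[i]^o) by apply: openI => //; exact: open_mobius_preimage.
have UH : U `<=` upper_half_plane by move=> w [_ /VH].
have Uz : U z by split=> //; split=> //; exact: VH.
have sUV : mobius s @` U `<=` V by move=> _ [w [[_ Vw] _] <-].
have polarF j : smooth_on (@dtau_derivable R) U (polar_at d (coordinate F j)).
  by apply: (smooth_on_subset (@subIsetr _ _ _)); apply: smooth_on_polar (Fs j).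
have polarG j : smooth_on (@dtau_derivable R) U (polar_at e (coordinate G j)).
  by apply: (smooth_on_subset (@subIsetr _ _ _)); apply: smooth_on_polar (Gs j).
transitivity (rc_bracket n c (slash s (k - d%:Z) (coordinate F i1 0))
                             (slash s (l - e%:Z) (coordinate G i2 0)) z).
  rewrite (rc_bracket_slash HD ds Uopen UH c_rec) //.
  - by rewrite /slash family_bracket0; congr (autj s z ^ _ * _); lia.
  - by apply: smooth_on_subset sUV _; exact: (smooth_on_derivable HB (Fs _ _)).
  - by apply: smooth_on_subset sUV _; exact: (smooth_on_derivable HB (Gs _ _)).
rewrite (rc_bracket_linear HD Uopen n c (a := A i1) (b := A' i2) polarF polarG) //;
  last first.
- by move=> w [[w0 Vsw] Vw]; exact: ((quasimodular_lawP l e G A' w0).1 (G_law Vw Vsw) i2).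
- by move=> w [[w0 Vsw] Vw]; exact: ((quasimodular_lawP k d F A w0).1 (F_law Vw Vsw) i1).
rewrite [RHS](reindex (@mxtens_index m p)) /=; last first.
  by exists (@mxtens_unindex m p) => q _; rewrite ?mxtens_indexK ?mxtens_unindexK.
rewrite pair_big; apply: eq_bigr => -[j j'] _ /=.
rewrite coordinate_bracket_family mxE mxtens_indexK /polar_at.
by rewrite (polar_bracket HB Vopen); [|exact: Fs|exact: Gs|].
Qed.

End Law.
End VectorFamilies.

(** * Growth at infinity *)

Section Growth.
Variable R : realType.
Implicit Types (h g phi psi : R[i] -> R[i]) (z w : R[i]) (M N Y : R).

Definition ioo : set_system R[i] :=
  [set P | exists Y, forall z, Y <= complex.Im z -> P z].

Global Instance ioo_filter : ProperFilter ioo.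
Proof.
split=> [[Y /(_ (0 +i* Y)%C)]|]; first by apply => /=.
split=> [|P Q [Y PY] [Y' QY]|P Q PQ [Y PY]]; first by exists 0.
  exists (Num.max Y Y') => z; rewrite ge_max => /andP[Yz Y'z].
  by split; [exact: PY|exact: QY].
by exists Y => z /PY; exact: PQ.
Qed.

Lemma near_ioo_ge Y : \forall z \near ioo, Y <= complex.Im z.
Proof. by exists Y. Qed.

Lemma near_ioo_square r (P : R[i] -> Prop) : (\forall z \near ioo, P z) ->
  \forall z \near ioo, forall w, square z r w -> P w.
Proof.
move=> [Y PY]; exists (Y + r) => z Yz w [_]; rewrite raddfB /= ler_norml => /andP[wz _].
by apply: PY; lra.
Qed.

Definition high Y : set R[i] := [set z | Y < complex.Im z].

Lemma open_high Y : open (high Y : set R[i]^o).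
Proof.
rewrite openE => z Yz; apply/nbhs_normcP.
exists (complex.Im z - Y); first by rewrite subr_gt0.
move=> w hw; rewrite /high /= raddfD /=; have := normIm_le w.
by rewrite ler_norml => /andP[]; move: hw Yz; rewrite /high /=; lra.
Qed.

Definition dominated M h : Prop :=
  exists B, \forall z \near ioo, normc (h z) <= B * expR (M * complex.Im z).

Definition vanishing h : Prop :=
  forall eps, 0 < eps -> \forall z \near ioo, normc (h z) <= eps.

Lemma dominated0P h :
  dominated 0 h <-> exists B, \forall z \near ioo, normc (h z) <= B.
Proof.
by split=> -[B hB]; exists B; apply: filterS hB => z; rewrite mul0r expR0 mulr1.
Qed.

Lemma dominated_near M h g :
  (\forall z \near ioo, h z = g z) -> dominated M h -> dominated M g.
Proof. by move=> hg [B hB]; exists B; apply: filterS2 hg hB => z ->. Qed.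

Lemma vanishing_near h g : (\forall z \near ioo, h z = g z) -> vanishing h -> vanishing g.
Proof. by move=> hg hv eps /hv; apply: filterS2 hg => z ->. Qed.

Lemma dominated_ge0 M h : dominated M h -> exists2 B, 0 <= B &
  \forall z \near ioo, normc (h z) <= B * expR (M * complex.Im z).
Proof.
move=> [B hB]; exists `|B| => //; apply: filterS hB => z /le_trans; apply.
by rewrite ler_wpM2r ?expR_ge0 // ler_norm.
Qed.

Lemma dominated_le M N h : M <= N -> dominated M h -> dominated N h.
Proof.
move=> MN /dominated_ge0[B B0 hB]; exists B.
apply: filterS2 (near_ioo_ge 0) hB => z z0 /le_trans; apply.
by rewrite ler_wpM2l // ler_expR ler_wpM2r.
Qed.

Lemma dominated_cst c : dominated 0 (fun=> c).
Proof. by apply/dominated0P; exists (normc c); exact: nearW. Qed.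

Lemma dominatedD M h g :
  dominated M h -> dominated M g -> dominated M (fun z => h z + g z).
Proof.
move=> [B hB] [C gC]; exists (B + C); apply: filterS2 hB gC => z hz gz.
by apply: le_trans (le_normcD _ _) _; rewrite mulrDl lerD.
Qed.

Lemma dominatedM M N h g :
  dominated M h -> dominated N g -> dominated (M + N) (fun z => h z * g z).
Proof.
move=> [B hB] [C gC]; exists (B * C); apply: filterS2 hB gC => z hz gz.
by rewrite normcM mulrDl expRD mulrACA ler_pM ?normc_ge0.
Qed.

Definition smooth_ioo h : Prop := exists Y, smooth_on (@taylor R) (high Y) h.

Lemma smooth_ioo_da : diff_algebra smooth_ioo.
Proof.
have HA Y := smooth_on_diff_algebra (@taylor_slash_class R) (@open_high Y).
have high_max Y Y' : high (Num.max Y Y') `<=` high Y /\ high (Num.max Y Y') `<=` high Y'.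
  by split=> z; rewrite /high /= gt_max => /andP[].
split.
- by move=> c; exists 0; exact: (da_cst (HA 0)).
- move=> h g [Y hs] [Y' gs]; exists (Num.max Y Y'); have [hY hY'] := high_max Y Y'.
  by apply: (da_add (HA _)); [exact: smooth_on_subset hs|exact: smooth_on_subset gs].
- move=> h g [Y hs] [Y' gs]; exists (Num.max Y Y'); have [hY hY'] := high_max Y Y'.
  by apply: (da_mul (HA _)); [exact: smooth_on_subset hs|exact: smooth_on_subset gs].
- by move=> h [Y hs]; exists Y; exact: (da_dtau (HA Y)).
Qed.

Lemma smooth_ioo_cauchy_estimate h r (b : R[i] -> R) : smooth_ioo h -> 0 < r ->
  (\forall z \near ioo, forall w, square z r w -> normc (h w) <= b z) ->
  \forall z \near ioo, normc (dtau_scalar h z) <= 2 * b z / r.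
Proof.
move=> [Y hs] r0 hb; have hT : \forall z \near ioo, taylor_at 4 h z.
  by exists (Y + 1) => z Yz; apply: (hs 0%N z _ 3); rewrite /high /=; lra.
apply: filterS2 (near_ioo_square r hT) hb => z; exact: cauchy_estimate.
Qed.

Lemma dominated_dtau M h : 0 <= M -> smooth_ioo h -> dominated M h ->
  dominated M (dtau_scalar h).
Proof.
move=> M0 hs /dominated_ge0[B B0 hB]; exists (2 * B * expR M).
have hb : \forall z \near ioo, forall w, square z 1 w ->
    normc (h w) <= B * expR (M * (complex.Im z + 1)).
  apply: filterS (near_ioo_square 1 hB) => z hz w sq; apply: le_trans (hz w sq) _.
  rewrite ler_wpM2l // ler_expR ler_wpM2l //; move: sq => [_].
  by rewrite raddfB /= ler_norml => /andP[]; lra.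
apply: filterS (smooth_ioo_cauchy_estimate hs ltr01 hb) => z.
by rewrite divr1 mulrDr mulr1 expRD -!mulrA (mulrC (expR M)).
Qed.

Definition bounded_ioo h : Prop := smooth_ioo h /\ dominated 0 h.

Definition exp_growth_ioo h : Prop := smooth_ioo h /\ exists M, dominated M h.

Lemma bounded_ioo_da : diff_algebra bounded_ioo.
Proof.
have SA := smooth_ioo_da; split.
- by move=> c; split; [exact: (da_cst SA)|exact: dominated_cst].
- by move=> h g [hs hd] [gs gd]; split; [exact: (da_add SA)|exact: dominatedD].
- move=> h g [hs hd] [gs gd]; split; first exact: (da_mul SA).
  by rewrite -[X in dominated X](addr0 0); exact: dominatedM.
- by move=> h [hs hd]; split; [exact: (da_dtau SA)|exact: dominated_dtau].
Qed.

Lemma exp_growth_ioo_da : diff_algebra exp_growth_ioo.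
Proof.
have SA := smooth_ioo_da; split.
- by move=> c; split; [exact: (da_cst SA)|exists 0; exact: dominated_cst].
- move=> h g [hs [M hd]] [gs [N gd]]; split; first exact: (da_add SA).
  exists (Num.max M N); apply: dominatedD;
    [apply: dominated_le hd|apply: dominated_le gd].
    by rewrite le_max lexx.
  by rewrite le_max lexx orbT.
- move=> h g [hs [M hd]] [gs [N gd]]; split; first exact: (da_mul SA).
  by exists (M + N); exact: dominatedM.
- move=> h [hs [M hd]]; split; first exact: (da_dtau SA).
  by exists `|M|; apply: dominated_dtau => //; apply: dominated_le hd; exact: ler_norm.
Qed.

Lemma bounded_dtau_vanishing h : bounded_ioo h -> vanishing (dtau_scalar h).
Proof.
move=> [hs /dominated0P[B hB]] eps eps0; set r := (2 * `|B|) / eps + 1.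
have r0 : 0 < r by rewrite ltr_wpDl // divr_ge0 ?mulr_ge0 // ltW.
apply: filterS (smooth_ioo_cauchy_estimate hs r0 (near_ioo_square r hB)) => z /le_trans.
apply; rewrite ler_pdivrMr // /r mulrDr mulr1 mulrCA divff ?gt_eqF // mulr1.
by have := ler_norm B; lra.
Qed.

Lemma vanishing0 : vanishing (fun=> 0).
Proof. by move=> eps eps0; apply: nearW => z; rewrite [normc _]normc0 ltW. Qed.

Lemma vanishingD h g : vanishing h -> vanishing g -> vanishing (fun z => h z + g z).
Proof.
move=> hv gv eps eps0; have eps2 : 0 < eps / 2 by rewrite divr_gt0.
apply: filterS2 (hv _ eps2) (gv _ eps2) => z hz gz.
by apply: le_trans (le_normcD _ _) _; lra.
Qed.

Lemma vanishing_sum (I : Type) (s : seq I) (h : I -> R[i] -> R[i]) :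
  (forall i, vanishing (h i)) -> vanishing (fun z => \sum_(i <- s) h i z).
Proof.
move=> hv; elim: s => [|i s IH].
  by apply: vanishing_near vanishing0; apply: nearW => z; rewrite big_nil.
by apply: vanishing_near (vanishingD (hv i) IH); apply: nearW => z; rewrite big_cons.
Qed.

Lemma vanishingM h g : vanishing h -> dominated 0 g -> vanishing (fun z => h z * g z).
Proof.
move=> hv /dominated0P[B gB] eps eps0; have B0 : 0 < `|B| + 1 by rewrite ltr_wpDl.
apply: filterS2 (hv _ (divr_gt0 eps0 B0)) gB => z hz gz; rewrite normcM.
rewrite -[leRHS](divfK (lt0r_neq0 B0)) ler_pM ?normc_ge0 //.
by have := ler_norm B; lra.
Qed.

Lemma rc_bracket_vanishing n c phi psi : bounded_ioo phi -> bounded_ioo psi ->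
  (0 < n)%N \/ vanishing phi -> vanishing (rc_bracket n c phi psi).
Proof.
move=> phib psib nphi; have BA := bounded_ioo_da.
have dtau_bounded h j : bounded_ioo h -> bounded_ioo (dtau_iter j h).
  by move=> hb; elim: j => [//|j IH]; rewrite iterS; exact: (da_dtau BA).
have dtau_vanishing h j : bounded_ioo h -> (0 < j)%N -> vanishing (dtau_iter j h).
  case: j => // j hb _; rewrite iterS; apply: bounded_dtau_vanishing.
  exact: dtau_bounded.
apply: vanishing_sum => r.
have [r0|r0] := posnP r; first case: nphi => [n0|phiv].
- apply: (@vanishing_near (fun z => dtau_iter (n - r) psi z * (c r * dtau_iter r phi z))).
    by apply: nearW => z; rewrite mulrC.
  apply: vanishingM; first by apply: dtau_vanishing => //; rewrite r0 subn0.
  by have [_] := da_mul BA (da_cst BA (c r)) (dtau_bounded _ r phib).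
- apply: (@vanishing_near (fun z => phi z * (c r * dtau_iter (n - r) psi z))).
    by apply: nearW => z; rewrite r0 /= mulrCA mulrA.
  apply: vanishingM => //.
  by have [_] := da_mul BA (da_cst BA (c r)) (dtau_bounded _ (n - r)%N psib).
apply: (@vanishing_near (fun z => dtau_iter r phi z * (c r * dtau_iter (n - r) psi z))).
  by apply: nearW => z; rewrite mulrCA mulrA.
apply: vanishingM; first exact: dtau_vanishing.
by have [_] := da_mul BA (da_cst BA (c r)) (dtau_bounded _ (n - r)%N psib).
Qed.

Section Coordinates.
Variables (m : nat) (h : R[i] -> 'cV[R[i]]_m).

Lemma ler_sum_norm (M : 'I_m -> R) i : M i <= \sum_i `|M i|.
Proof.
apply: le_trans (ler_norm _) _; rewrite (bigD1 i) //= lerDl.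
by apply: sumr_ge0.
Qed.

Lemma bounded_at_iooP : bounded_at_ioo h <-> forall i, dominated 0 (fun z => h z i 0).
Proof.
split=> [[B [Y hB]] i|hd].
  by apply/dominated0P; exists B, Y => z /hB /(_ i); rewrite lecR.
have /choice[B hB] : forall i, exists B, \forall z \near ioo, normc (h z i 0) <= B.
  by move=> i; exact/dominated0P.
have /(filter_forall _)[Y hY] := hB.
exists (\sum_i `|B i|), Y => z /hY hz i; rewrite lecR.
exact: le_trans (hz i) (ler_sum_norm B i).
Qed.

Lemma exp_growth_at_iooP :
  exp_growth_at_ioo h <-> forall i, exists M, dominated M (fun z => h z i 0).
Proof.
split=> [[B [M [Y hB]]] i|/choice[M hM]].
  by exists M, B, Y => z /hB /(_ i); rewrite lecR.
have /choice[B hB] : forall i, exists B, \forall z \near ioo,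
    normc (h z i 0) <= B * expR ((\sum_i `|M i|) * complex.Im z).
  by move=> i; exact: dominated_le (ler_sum_norm M i) (hM i).
have /(filter_forall _)[Y hY] := hB.
exists (\sum_i `|B i|), (\sum_i `|M i|), Y => z /hY hz i; rewrite lecR.
by apply: le_trans (hz i) _; rewrite ler_wpM2r ?expR_ge0 // ler_sum_norm.
Qed.

Lemma vanishing_at_iooP : vanishing_at_ioo h <-> forall i, vanishing (fun z => h z i 0).
Proof.
split=> [hv i eps /hv[Y hY]|hv eps eps0].
  by exists Y => z /hY /(_ i); rewrite lecR.
have /(filter_forall _)[Y hY] := fun i => hv i eps eps0.
by exists Y => z /hY hz i; rewrite lecR.
Qed.

End Coordinates.
End Growth.
Arguments ioo : clear implicits.

(** * Preservation of quasi-modularity *)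

Section RegularityAlgebras.
Variable R : realType.
Implicit Types (h g : R[i] -> R[i]) (a z w : R[i]) (S U : set R[i]) (star : regularity).

Lemma analytic_da (xy : coordinates R) a : diff_algebra (analytic xy ^~ a).
Proof.
split.
- by move=> c; exact: analytic_cst.
- by move=> h g; exact: analyticD.
- by move=> h g; exact: analyticM.
- by move=> h; exact: analytic_dtau.
Qed.

Lemma holo_subX a b n : holo (fun z => (z - b) ^+ n) a.
Proof.
have HA := analytic_da (holomorphic_coords R) a; apply: (da_exp _ HA).
apply: (da_add HA); last exact: (da_cst HA).
by apply: analytic_ext (analytic_coordx (holomorphic_coords R) a) => z;
  exact: real_linear_id.
Qed.

Lemma meromorphicP h a : meromorphic_at h a <-> exists N h0, holo h0 a /\
  \forall z \near (a : R[i]^o), z != a -> h z = h0 z / (z - a) ^+ N.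
Proof.
split=> [[N [h0 [eps [eps0 /holomorphicP h0a hE]]]]|[N [h0 [h0a hE]]]].
  exists N, h0; split=> //; apply/nbhs_normcP; exists eps => // w weps wa.
  by apply: hE => //; rewrite (addrC a) addrK -[`|_|]/((normc _)%:C) ltcR.
have [eps eps0 {}hE] := (nbhs_normcP _ _).1 hE.
exists N, h0, eps; split=> [//||z za zeps]; first exact/holomorphicP.
have := hE (z - a); rewrite [a + _]addrC subrK; apply => //.
by rewrite -ltcR.
Qed.

Lemma meromorphic_da a : diff_algebra (meromorphic_at^~ a).
Proof.
have HA := analytic_da (holomorphic_coords R) a.
split=> [c|h g|h g|h].
- apply/meromorphicP; exists 0%N, (fun=> c); split; first exact: (da_cst HA).
  by apply: (@nearW _ (nbhs (a : R[i]^o))) => z _; rewrite expr0 divr1.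
- move=> /meromorphicP[N [h0 [h0a hE]]] /meromorphicP[N' [g0 [g0a gE]]];
    apply/meromorphicP.
  exists (N + N')%N, (fun z => h0 z * (z - a) ^+ N' + g0 z * (z - a) ^+ N); split.
    by apply: (da_add HA); apply: (da_mul HA); [|exact: holo_subX| |exact: holo_subX].
  apply: filterS2 hE gE => z hE gE za; have za0 : z - a != 0 by rewrite subr_eq0.
  by rewrite hE // gE // exprD; field; rewrite !expf_neq0.
- move=> /meromorphicP[N [h0 [h0a hE]]] /meromorphicP[N' [g0 [g0a gE]]];
    apply/meromorphicP.
  exists (N + N')%N, (fun z => h0 z * g0 z); split; first exact: (da_mul HA).
  apply: filterS2 hE gE => z hE gE za; have za0 : z - a != 0 by rewrite subr_eq0.
  by rewrite hE // gE // exprD; field; rewrite !expf_neq0.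
- move=> /meromorphicP[N [h0 [h0a hE]]]; apply/meromorphicP.
  exists N.+1, (fun z => dtau_scalar h0 z * (z - a) + (- N%:R) * h0 z); split.
    apply: (da_add HA); apply: (da_mul HA);
      [exact: (da_dtau HA)| |exact: (da_cst HA)|by []].
    by apply: (analytic_ext _ (holo_subX a a 1)) => z; rewrite expr1.
  apply: filterS2 (near_join hE) (analytic_is_dtau h0a) => z hE' h0d za.
  have za0 : z - a != 0 by rewrite subr_eq0.
  have zaN : (z - a) ^+ N != 0 by rewrite expf_neq0.
  have sub_dtau := is_dtauD (is_dtau_id z) (is_dtau_cst (- a) z).
  apply: is_dtau_val; apply: is_dtau_eq.
    apply: (@is_dtau_near _ (fun w => h0 w / (w - a) ^+ N)); last first.
      have dV := @is_dtauV _ (fun w => (w - a) ^+ N) z _ zaN (is_dtauX N sub_dtau).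
      exact: is_dtauM h0d dV.
    have z_ne : \forall w \near (z : R[i]^o), w != a.
      apply/nbhs_normcP; exists (normc (z - a)); first by rewrite normc_gt0.
      by move=> w wz; apply/eqP => wa; move: wz; rewrite -wa opprD addNKr normcN ltxx.
    by apply: filterS2 hE' z_ne => w hE' wa; rewrite hE'.
  rewrite addr0 mulr1; case: (N) => [|k]; first by rewrite !expr0 expr1; field.
  by rewrite /= !exprS; field; rewrite za0 expf_neq0.
Qed.

Definition regular_off star S a h : Prop :=
  match star with
  | an | sing => ~ S a -> real_ana h a
  | mer | merc => (~ S a -> holo h a) /\ meromorphic_at h a
  | hol | cusp | wh => holo h a
  end.

Lemma regular_off_da star S a : diff_algebra (regular_off star S a).
Proof.
have HA := analytic_da (holomorphic_coords R) a; have MA := meromorphic_da a.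
have RA := da_imp (~ S a) (analytic_da (ReIm_coords R) a).
by case: star => //=; exact: da_and (da_imp _ HA) MA.
Qed.

Lemma regular_offS star S U a h :
  S `<=` U -> regular_off star S a h -> regular_off star U a h.
Proof.
move=> SU; have off : ~ U a -> ~ S a by apply: contra_not; exact: SU.
by case: star => //= [ha /off|ha /off|[ha ?]|[ha ?]] //; split=> // /off.
Qed.

Lemma regularity_on_HP star S m (f : R[i] -> 'cV[R[i]]_m) :
  regularity_on_H star S f <->
  forall a i, upper_half_plane a -> regular_off star S a (fun z => f z i 0).
Proof.
split=> [fr a i a0|fr a a0]; last first.
  case: star fr => fr /=.
  - by move=> Sa i; exact/real_analyticP/(fr a i a0).
  - by move=> Sa i; exact/real_analyticP/(fr a i a0).
  - split=> [Sa|] i; first exact/holomorphicP/(fr a i a0).1.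
    exact: (fr a i a0).2.
  - split=> [Sa|] i; first exact/holomorphicP/(fr a i a0).1.
    exact: (fr a i a0).2.
  - by move=> i; exact/holomorphicP/(fr a i a0).
  - by move=> i; exact/holomorphicP/(fr a i a0).
  - by move=> i; exact/holomorphicP/(fr a i a0).
have {fr} := fr a a0; case: star => /=.
- by move=> fr Sa; exact/real_analyticP/(fr Sa i).
- by move=> fr Sa; exact/real_analyticP/(fr Sa i).
- by move=> [fr fm]; split=> [Sa|]; [exact/holomorphicP/(fr Sa i)|exact: fm].
- by move=> [fr fm]; split=> [Sa|]; [exact/holomorphicP/(fr Sa i)|exact: fm].
- by move=> fr; exact/holomorphicP/(fr i).
- by move=> fr; exact/holomorphicP/(fr i).
- by move=> fr; exact/holomorphicP/(fr i).
Qed.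

Definition holomorphic_off star : bool :=
  match star with an | sing => false | _ => true end.

Lemma regular_off_holo star S a h : holomorphic_off star -> ~ S a ->
  regular_off star S a h -> holo h a.
Proof. by case: star => // _ Sa [/(_ Sa)]. Qed.

Lemma smooth_on_analytic (xy : coordinates R) U h :
  (forall z, U z -> analytic xy h z) -> smooth_on (@dtau_derivable R) U h.
Proof.
move=> ha j z Uz; suff : analytic xy (iter j (@dtau_scalar R) h) z.
  by move=> /analytic_is_dtau /nbhs_singleton.
by elim: j => [|j IH]; [exact: ha|rewrite iterS; exact: analytic_dtau].
Qed.

Lemma smooth_on_regular_off star S U h :
  (forall z, U z -> ~ S z /\ regular_off star S z h) -> smooth_on (@dtau_derivable R) U h.
Proof.
case: star => /= hr; [
    apply: (@smooth_on_analytic (ReIm_coords R))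
  | apply: (@smooth_on_analytic (ReIm_coords R))
  | apply: (@smooth_on_analytic (holomorphic_coords R)) ..]; move=> z /hr[Sz].
- exact.
- exact.
- by move=> [/(_ Sz)].
- by move=> [/(_ Sz)].
- by [].
- by [].
- by [].
Qed.

Lemma smooth_on_holo U h : (forall z, U z -> holo h z) -> smooth_on (@taylor R) U h.
Proof.
move=> ha j z Uz N; apply: holomorphic_taylor.
by elim: j => [|j IH]; [exact: ha|rewrite iterS; exact: analytic_dtau].
Qed.

Lemma singular_setU star S U : singular_set star S -> singular_set star U ->
  singular_set star (S `|` U).
Proof.
have discU : discrete_in_H S -> discrete_in_H U -> discrete_in_H (S `|` U).
  move=> Sd Ud a a0 lim; have := Sd a a0; rewrite not_limit_pointE => -[V nV SV].
  have := Ud a a0; rewrite not_limit_pointE => -[W nW UW].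
  have [y [ya SUy [Vy Wy]]] := lim (V `&` W) (filterI nV nW).
  by case: SUy => [Sy|Uy]; move/eqP: ya; apply; [exact: (SV y)|exact: (UW y)].
by case: star => //= -> ->; rewrite setU0.
Qed.

Lemma open_regular_domain star S : singular_set star S ->
  open (upper_half_plane `\` S : set R[i]^o).
Proof.
move=> SS; rewrite openE => a [a0 Sa].
suff nS : \forall z \near (a : R[i]^o), ~ S z.
  by apply: filterS2 (open_near (@open_upper_half_plane R) a0) nS => z.
have disc : discrete_in_H S -> \forall z \near (a : R[i]^o), ~ S z.
  move=> /(_ a a0); rewrite not_limit_pointE => -[V nV SV].
  by apply: filterS nV => z Vz Sz; apply: Sa; rewrite -(SV z).
by case: star SS => //= ->; apply: (@nearW _ (nbhs (a : R[i]^o))) => z.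
Qed.

End RegularityAlgebras.

Section BracketAtCusp.
Variables (R : realType) (s : 'M[R]_2) (V : set R[i]).
Hypotheses (ds : \det s = 1) (Vopen : open (V : set R[i]^o)).
Hypothesis near_V : \forall z \near ioo R, V (mobius s z).
Variables (k l : int) (d e n m p : nat) (c : nat -> R[i]).
Variables (F : nat -> R[i] -> 'cV[R[i]]_m) (G : nat -> R[i] -> 'cV[R[i]]_p).
Hypothesis c_rec : rc_recurrence (k - d%:Z) (l - e%:Z) n c.
Hypothesis Fs : forall i t, (t <= d)%N -> smooth_on (@taylor R) V (coordinate F i t).
Hypothesis Gs : forall i t, (t <= e)%N -> smooth_on (@taylor R) V (coordinate G i t).

Let B := bracket_family d e n c F G.
Let K := k + l + (2 * n)%:Z.

Lemma at_cusp_bracket_near i t : (t <= d + e)%N -> \forall z \near ioo R,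
  family_bracket d e n c (slash_family s k d (coordinate F (mxtens_unindex i).1))
    (slash_family s l e (coordinate G (mxtens_unindex i).2)) t z =
  at_cusp s K (d + e) B t z i 0.
Proof.
move=> tde; apply: filterS2 (near_ioo_ge 1) near_V => z z1 Vz.
rewrite at_cusp_coordinate coordinate_bracket_family.
rewrite (slash_family_bracket (@taylor_slash_class R) Vopen ds c_rec);
  [by []|exact: Fs|exact: Gs| |exact: tde].
by split=> //; rewrite /upper_half_plane /=; lra.
Qed.

Lemma slash_family_smooth_ioo q (k' : int) d' (H : nat -> R[i] -> 'cV[R[i]]_q) i t :
  (forall t, (t <= d')%N -> smooth_on (@taylor R) V (coordinate H i t)) ->
  smooth_ioo (slash_family s k' d' (coordinate H i) t).
Proof.
move=> Hs; have [Y VY] := near_V; exists (Num.max Y 0).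
have := smooth_on_slash_family (@taylor_slash_class R) Vopen ds k' Hs t.
apply: smooth_on_subset => z; rewrite /high /= gt_max => /andP[Yz z0].
by split=> //; exact/VY/ltW.
Qed.

Lemma at_cusp_bounded_ioo q (k' : int) d' (H : nat -> R[i] -> 'cV[R[i]]_q) i t :
  (forall t, (t <= d')%N -> smooth_on (@taylor R) V (coordinate H i t)) ->
  bounded_at_ioo (at_cusp s k' d' H t) ->
  bounded_ioo (slash_family s k' d' (coordinate H i) t).
Proof.
move=> Hs /bounded_at_iooP/(_ i) Hb; split; first exact: slash_family_smooth_ioo.
by apply: dominated_near Hb; apply: nearW => z; exact: at_cusp_coordinate.
Qed.

Lemma at_cusp_exp_growth_ioo q (k' : int) d' (H : nat -> R[i] -> 'cV[R[i]]_q) i t :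
  (forall t, (t <= d')%N -> smooth_on (@taylor R) V (coordinate H i t)) ->
  exp_growth_at_ioo (at_cusp s k' d' H t) ->
  exp_growth_ioo (slash_family s k' d' (coordinate H i) t).
Proof.
move=> Hs /exp_growth_at_iooP/(_ i)[M Hd]; split; first exact: slash_family_smooth_ioo.
by exists M; apply: dominated_near Hd; apply: nearW => z; exact: at_cusp_coordinate.
Qed.

Lemma exp_growth_at_cusp_bracket t :
  (forall t, (t <= d)%N -> exp_growth_at_ioo (at_cusp s k d F t)) ->
  (forall t, (t <= e)%N -> exp_growth_at_ioo (at_cusp s l e G t)) ->
  (t <= d + e)%N -> exp_growth_at_ioo (at_cusp s K (d + e) B t).
Proof.
move=> Fg Gg tde; apply/exp_growth_at_iooP => i.
have Fg' j : (j <= d)%N ->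
    exp_growth_ioo (slash_family s k d (coordinate F (mxtens_unindex i).1) j).
  by move=> /Fg; exact: at_cusp_exp_growth_ioo (Fs _).
have Gg' j : (j <= e)%N ->
    exp_growth_ioo (slash_family s l e (coordinate G (mxtens_unindex i).2) j).
  by move=> /Gg; exact: at_cusp_exp_growth_ioo (Gs _).
have [_ [M BM]] := family_bracket_da n c (@exp_growth_ioo_da R) Fg' Gg' t.
by exists M; apply: dominated_near (at_cusp_bracket_near i tde) BM.
Qed.

Section Bounded.
Hypothesis Fb : forall t, (t <= d)%N -> bounded_at_ioo (at_cusp s k d F t).
Hypothesis Gb : forall t, (t <= e)%N -> bounded_at_ioo (at_cusp s l e G t).

Lemma bounded_at_cusp_bracket t :
  (t <= d + e)%N -> bounded_at_ioo (at_cusp s K (d + e) B t).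
Proof.
move=> tde; apply/bounded_at_iooP => i.
have Fb' j : (j <= d)%N ->
    bounded_ioo (slash_family s k d (coordinate F (mxtens_unindex i).1) j).
  by move=> /Fb; exact: at_cusp_bounded_ioo (Fs _).
have Gb' j : (j <= e)%N ->
    bounded_ioo (slash_family s l e (coordinate G (mxtens_unindex i).2) j).
  by move=> /Gb; exact: at_cusp_bounded_ioo (Gs _).
have [_ BM] := family_bracket_da n c (@bounded_ioo_da R) Fb' Gb' t.
exact: dominated_near (at_cusp_bracket_near i tde) BM.
Qed.

Lemma vanishing_at_cusp_bracket :
  (0 < n)%N \/ vanishing_at_ioo (at_cusp s k d F 0) ->
  vanishing_at_ioo (at_cusp s K (d + e) B 0).
Proof.
move=> nF; apply/vanishing_at_iooP => i.
apply: vanishing_near (at_cusp_bracket_near i (leq0n _)) _.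
set f := slash_family s k d _; set g := slash_family s l e _.
apply: (@vanishing_near _ (rc_bracket n c (f 0%N) (g 0%N))).
  by apply: nearW => z; rewrite family_bracket0.
apply: rc_bracket_vanishing.
- exact: at_cusp_bounded_ioo (Fs _) (Fb (leq0n d)).
- exact: at_cusp_bounded_ioo (Gs _) (Gb (leq0n e)).
- case: nF => [n0|/vanishing_at_iooP/(_ (mxtens_unindex i).1) Fv]; [by left|right].
  by apply: vanishing_near Fv; apply: nearW => z; exact: at_cusp_coordinate.
Qed.

End Bounded.
End BracketAtCusp.

Section BracketPreservation.
Variables (R : realType) (Gamma : set 'M[R]_2) (star : regularity).
Variables (k l : int) (d e n m p : nat) (c : nat -> R[i]).
Variables (rho : 'M[R]_2 -> 'M[R[i]]_m) (eta : 'M[R]_2 -> 'M[R[i]]_p).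
Variables (F : nat -> R[i] -> 'cV[R[i]]_m) (G : nat -> R[i] -> 'cV[R[i]]_p).
Variables (S T : set R[i]).
Hypothesis det_Gamma : forall g, Gamma g -> \det g = 1.
Hypothesis c_rec : rc_recurrence (k - d%:Z) (l - e%:Z) n c.
Hypotheses (S_sing : singular_set star S) (T_sing : singular_set star T).
Hypothesis F_reg : forall r, (r <= d)%N -> regularity_on_H star S (F r).
Hypothesis G_reg : forall r, (r <= e)%N -> regularity_on_H star T (G r).

Let B := bracket_family d e n c F G.
Let V : set R[i] := upper_half_plane `\` (S `|` T).

Let Vopen : open (V : set R[i]^o).
Proof. exact: open_regular_domain (singular_setU S_sing T_sing). Qed.

Lemma regularity_bracket t : regularity_on_H star (S `|` T) (B t).
Proof.
apply/regularity_on_HP => a i a0.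
have -> : (fun z => B t z i 0) = family_bracket d e n c
    (coordinate F (mxtens_unindex i).1) (coordinate G (mxtens_unindex i).2) t.
  by rewrite -coordinate_bracket_family.
apply: (family_bracket_da _ _ (regular_off_da star (S `|` T) a)) => [r rd|r re].
  apply: regular_offS (@subsetUl _ _ _) _.
  exact: (regularity_on_HP _ _ _).1 (F_reg rd) _ _ a0.
apply: regular_offS (@subsetUr _ _ _) _.
exact: (regularity_on_HP _ _ _).1 (G_reg re) _ _ a0.
Qed.

Lemma smooth_on_domain_F i t : holomorphic_off star -> (t <= d)%N ->
  smooth_on (@taylor R) V (coordinate F i t).
Proof.
move=> star_holo td; apply: smooth_on_holo => w [w0 Sw].
apply: (regular_off_holo star_holo (S := S)); first by move=> Sw'; apply: Sw; left.
exact: (regularity_on_HP _ _ _).1 (F_reg td) _ _ w0.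
Qed.

Lemma smooth_on_domain_G i t : holomorphic_off star -> (t <= e)%N ->
  smooth_on (@taylor R) V (coordinate G i t).
Proof.
move=> star_holo te; apply: smooth_on_holo => w [w0 Sw].
apply: (regular_off_holo star_holo (S := T)); first by move=> Sw'; apply: Sw; right.
exact: (regularity_on_HP _ _ _).1 (G_reg te) _ _ w0.
Qed.

Lemma near_ioo_domain s : \det s = 1 -> S = set0 -> T = set0 ->
  \forall z \near ioo R, V (mobius s z).
Proof.
move=> ds S0 T0; apply: filterS (near_ioo_ge 1) => z z1; split;
  last by rewrite S0 T0 => -[].
by apply: mobius_upper => //; rewrite /upper_half_plane /=; lra.
Qed.

Lemma condition_at_cusps_bracket :
  condition_at_cusps Gamma star k d S F -> condition_at_cusps Gamma star l e T G ->
  condition_at_cusps Gamma star (k + l + (2 * n)%:Z) (d + e) (S `|` T) B.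
Proof.
move=> Fc Gc s s_cusp; have [ds _] := s_cusp.
have Fs i t (h : holomorphic_off star) := @smooth_on_domain_F i t h.
have Gs i t (h : holomorphic_off star) := @smooth_on_domain_G i t h.
have V_cusp := @near_ioo_domain s ds.
case: star S_sing T_sing Fs Gs (Fc s s_cusp) (Gc s s_cusp) => //=.
- move=> _ _ Fs Gs [[Y SY] Fg] [[Y' TY'] Gg].
  have ST : exists Y, forall z, Y <= complex.Im z -> ~ (S `|` T) (mobius s z).
    exists (Num.max Y Y') => z; rewrite ge_max => /andP[Yz Y'z].
    by case; [exact: SY|exact: TY'].
  split=> [//|t tde]; apply: (exp_growth_at_cusp_bracket ds Vopen _ c_rec) => //.
  + have [Y'' STY] := ST; apply: filterS2 (near_ioo_ge 1) (near_ioo_ge Y'').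
    move=> z z1 /STY Sz.
    by split=> //; apply: mobius_upper => //; rewrite /upper_half_plane /=; lra.
  + by move=> i j; exact: Fs.
  + by move=> i j; exact: Gs.
- move=> S0 T0 Fs Gs Fb Gb t tde.
  apply: (bounded_at_cusp_bracket ds Vopen (V_cusp S0 T0) c_rec) => //.
  + by move=> i j; exact: Fs.
  + by move=> i j; exact: Gs.
- move=> S0 T0 Fs Gs [Fb Fv] [Gb _]; split=> [t tde|].
    apply: (bounded_at_cusp_bracket ds Vopen (V_cusp S0 T0) c_rec) => //.
      by move=> i j; exact: Fs.
    by move=> i j; exact: Gs.
  apply: (vanishing_at_cusp_bracket ds Vopen (V_cusp S0 T0) c_rec) => //; last by right.
    by move=> i j; exact: Fs.
  by move=> i j; exact: Gs.
- move=> S0 T0 Fs Gs Fg Gg t tde.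
  apply: (exp_growth_at_cusp_bracket ds Vopen (V_cusp S0 T0) c_rec) => //.
    by move=> i j; exact: Fs.
  by move=> i j; exact: Gs.
Qed.

Lemma condition_at_cusps_bracket_hol : star = hol -> (0 < n)%N ->
  condition_at_cusps Gamma hol k d S F -> condition_at_cusps Gamma hol l e T G ->
  condition_at_cusps Gamma cusp (k + l + (2 * n)%:Z) (d + e) (S `|` T) B.
Proof.
move=> starE n0 Fc Gc s s_cusp; have [ds _] := s_cusp.
have [S0 T0] : S = set0 /\ T = set0 by move: S_sing T_sing; rewrite starE.
have star_holo : holomorphic_off star by rewrite starE.
have Vs := near_ioo_domain ds S0 T0.
have Fs i t : (t <= d)%N -> _ := @smooth_on_domain_F i t star_holo.
have Gs i t : (t <= e)%N -> _ := @smooth_on_domain_G i t star_holo.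
have Fb := Fc s s_cusp; have Gb := Gc s s_cusp.
split; first exact: (bounded_at_cusp_bracket ds Vopen Vs c_rec Fs Gs Fb Gb).
by apply: (vanishing_at_cusp_bracket ds Vopen Vs c_rec Fs Gs Fb Gb); left.
Qed.

Hypothesis F_law : forall g z, Gamma g -> upper_half_plane z -> ~ S z ->
  ~ S (mobius g z) -> F 0%N (mobius g z) =
  \sum_(r < d.+1) (autj g z ^ (k - r%:Z) * autj' g ^+ r) *: (rho g *m F r z).
Hypothesis G_law : forall g z, Gamma g -> upper_half_plane z -> ~ T z ->
  ~ T (mobius g z) -> G 0%N (mobius g z) =
  \sum_(r < e.+1) (autj g z ^ (l - r%:Z) * autj' g ^+ r) *: (eta g *m G r z).

Lemma bracket_law g z : Gamma g -> upper_half_plane z -> ~ (S `|` T) z ->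
  ~ (S `|` T) (mobius g z) -> B 0%N (mobius g z) = \sum_(r < (d + e).+1)
    (autj g z ^ (k + l + (2 * n)%:Z - r%:Z) * autj' g ^+ r)
      *: (tensor_rep rho eta g *m B r z).
Proof.
move=> Gg z0 Sz Sgz; have dg := det_Gamma Gg.
apply: (bracket_family_law dg (@dtau_derivable_slash_class R) Vopen _ c_rec).
- by move=> w [].
- move=> i t td; apply: (@smooth_on_regular_off _ star S) => w [w0 Sw].
  split; first by move=> Sw'; apply: Sw; left.
  exact: (regularity_on_HP _ _ _).1 (F_reg td) _ _ w0.
- move=> i t te; apply: (@smooth_on_regular_off _ star T) => w [w0 Sw].
  split; first by move=> Sw'; apply: Sw; right.
  exact: (regularity_on_HP _ _ _).1 (G_reg te) _ _ w0.
- by move=> w [w0 Sw] [_ Sgw]; apply: F_law => // Sw'; [apply: Sw|apply: Sgw]; left.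
- by move=> w [w0 Sw] [_ Sgw]; apply: G_law => // Sw'; [apply: Sw|apply: Sgw]; right.
- by [].
- by split=> //; exact: mobius_upper.
Qed.

End BracketPreservation.

Section QuasimodularBrackets.
Variables (R : realType) (Gamma : set 'M[R]_2) (k l : int) (d e n m p : nat).
Variables (rho : 'M[R]_2 -> 'M[R[i]]_m) (eta : 'M[R]_2 -> 'M[R[i]]_p).
Variables (f : R[i] -> 'cV[R[i]]_m) (g : R[i] -> 'cV[R[i]]_p).
Variables (c : 'rV[R[i]]_n.+1) (c' : nat -> R[i]).
Hypothesis det_Gamma : forall g, Gamma g -> \det g = 1.
Hypothesis c_rec : rc_recurrence (k - d%:Z) (l - e%:Z) n c'.
Hypothesis cE : forall r : 'I_n.+1, c 0 r = c' r.

Lemma bracket_quasimodular star :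
  quasimodular Gamma rho star k d f -> quasimodular Gamma eta star l e g ->
  quasimodular Gamma (tensor_rep rho eta) star (k + l + (2 * n)%:Z) (d + e)
    (bracket c f g).
Proof.
move=> [F [S [F0 S_sing F_reg F_law F_cusp]]] [G [T [G0 T_sing G_reg G_law G_cusp]]].
have B0 := bracket_family0 d e F G cE; rewrite F0 G0 in B0.
rewrite -F0 in F_law; rewrite -G0 in G_law.
exists (bracket_family d e n c' F G), (S `|` T); split=> [//||t _||].
- exact: singular_setU.
- exact: (regularity_bracket n c' F_reg G_reg).
- move=> h z Gh z0 Sz Sgz; rewrite -B0.
  exact: (bracket_law det_Gamma c_rec S_sing T_sing F_reg G_reg F_law G_law).
- exact: condition_at_cusps_bracket.
Qed.

Lemma bracket_quasimodular_cusp : (0 < n)%N ->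
  quasimodular Gamma rho hol k d f -> quasimodular Gamma eta hol l e g ->
  quasimodular Gamma (tensor_rep rho eta) cusp (k + l + (2 * n)%:Z) (d + e)
    (bracket c f g).
Proof.
move=> n0 [F [S [F0 S_sing F_reg F_law F_cusp]]] [G [T [G0 T_sing G_reg G_law G_cusp]]].
have B0 := bracket_family0 d e F G cE; rewrite F0 G0 in B0.
rewrite -F0 in F_law; rewrite -G0 in G_law.
exists (bracket_family d e n c' F G), (S `|` T); split=> [//||t _||].
- exact: (@singular_setU _ hol).
- exact: (regularity_bracket n c' F_reg G_reg).
- move=> h z Gh z0 Sz Sgz; rewrite -B0.
  exact: (bracket_law det_Gamma c_rec S_sing T_sing F_reg G_reg F_law G_law).
- exact: (condition_at_cusps_bracket_hol c_rec S_sing T_sing F_reg G_reg).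
Qed.

End QuasimodularBrackets.

(** * The modular group *)

Section ModularGroup.
Variable R : realType.
Implicit Types (g h : 'M[R]_2) (z w : R[i]).

Definition SL2Z : set 'M[R]_2 :=
  [set g | \det g = 1 /\ forall i j, g i j \is a Num.int].

Definition mx22 (a b c d : R) : 'M[R]_2 :=
  \matrix_(i, j) nth 0 (nth [::] [:: [:: a; b]; [:: c; d]] i) j.

Lemma mx22E a b c d : (mx22 a b c d 0 0 = a) * (mx22 a b c d 0 1 = b) *
  (mx22 a b c d 1 0 = c) * (mx22 a b c d 1 1 = d).
Proof. by rewrite !mxE. Qed.

Lemma forall_ord2 (P : 'I_2 -> Prop) : P 0 -> P 1 -> forall i, P i.
Proof.
move=> P0 P1 [[|[|//]] lt_i].
  by rewrite (_ : Ordinal lt_i = 0) //; exact: val_inj.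
by rewrite (_ : Ordinal lt_i = 1) //; exact: val_inj.
Qed.

Lemma invmx22 g : \det g = 1 -> invmx g = mx22 (g 1 1) (- g 0 1) (- g 1 0) (g 0 0).
Proof.
move=> dg; have ug := det1_unitmx dg; apply: (can_inj (mulKmx ug)); rewrite mulmxV //.
have := det_mx22 g; rewrite dg => D.
apply/matrixP; apply: forall_ord2; apply: forall_ord2; rewrite mulmx22E !mx22E mxE /=.
- by rewrite D; ring.
- by ring.
- by ring.
- by rewrite D; ring.
Qed.

Lemma SL2Z_mx22 a b c d : a \is a Num.int -> b \is a Num.int -> c \is a Num.int ->
  d \is a Num.int -> a * d - b * c = 1 -> SL2Z (mx22 a b c d).
Proof.
move=> ha hb hc hd D; split; first by rewrite det_mx22 !mx22E.
by apply: forall_ord2; apply: forall_ord2; rewrite mx22E.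
Qed.

Lemma SL2Z_subgroup : SL2_subgroup SL2Z.
Proof.
split.
- by move=> g [].
- by split; [exact: det1|move=> i j; rewrite mxE rpredMn // rpred1].
- move=> g h [dg ig] [dh ih]; split; first by rewrite det_mulmx dg dh mulr1.
  by move=> i j; rewrite mulmx22E rpredD // rpredM.
- move=> g [dg ig]; rewrite invmx22 //; apply: SL2Z_mx22; rewrite ?rpredN //.
  by have := det_mx22 g; rewrite dg => ->; ring.
Qed.

Lemma SL2Z_inv g : SL2Z g -> SL2Z (invmx g).
Proof. by have [_ _ _] := SL2Z_subgroup; apply. Qed.

Lemma SL2Z_mul g h : SL2Z g -> SL2Z h -> SL2Z (g *m h).
Proof. by have [_ _ + _] := SL2Z_subgroup; apply. Qed.

Lemma int_eq_dist_lt1 (a b : R) :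
  a \is a Num.int -> b \is a Num.int -> `|a - b| < 1 -> a = b.
Proof.
move=> /intrP[m ->] /intrP[n ->]; rewrite -intrB -intr_norm -[1]/(1%:~R) ltr_int => mn.
by congr (_%:~R); lia.
Qed.

Lemma SL2Z_discrete : SL2Z `<=` isolated SL2Z.
Proof.
move=> g Gg; split; first by rewrite inE.
exists (ball g (1 : R)); first exact: nbhsx_ballx.
apply/seteqP; split=> [h [[_ /= gh] [dh ih]]|h ->] /=; last by split=> //; exact: ballxx.
by apply/matrixP => i j; apply/esym/int_eq_dist_lt1 => //; [exact: Gg.2|exact: gh].
Qed.

Lemma lattice_coord_le z (r c d : R) : upper_half_plane z ->
  normc (c%:C * z + d%:C) <= r ->
  `|c| <= r / complex.Im z /\ `|d| <= r + r / complex.Im z * `|complex.Re z|.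
Proof.
rewrite /upper_half_plane /= => z0 hr.
have := le_trans (normIm_le _) hr; have := le_trans (normRe_le _) hr.
case: z z0 hr => x y /= y0 _.
rewrite !mul0r subr0 !addr0 (normrM c y) (gtr0_norm y0) => hRe hIm.
have cy : `|c| <= r / y by rewrite ler_pdivlMr.
split=> //; have := ler_normB (c * x + d) (c * x); rewrite addrAC subrr add0r normrM.
by have := ler_wpM2r (normr_ge0 x) cy; lra.
Qed.

Lemma lattice_normc_argmin z (P : int -> int -> Prop) : upper_half_plane z ->
  (exists c d, P c d) ->
  exists c d, P c d /\ forall c' d', P c' d' ->
    normc (c%:~R * z + d%:~R) <= normc (c'%:~R * z + d'%:~R).
Proof.
move=> z0 [c0 [d0 P0]]; pose f c d : R := normc (c%:~R * z + d%:~R); set r := f c0 d0.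
have [B boxB] : exists B : nat, forall c d, f c d <= r -> (`|c| <= B)%N /\ (`|d| <= B)%N.
  pose K := Num.max (r / complex.Im z) (r + r / complex.Im z * `|complex.Re z|).
  exists (Num.truncn K) => c d fr.
  have [|cr dr] := @lattice_coord_le z r c%:~R d%:~R z0; first by rewrite !rmorph_int.
  have absK a : `|a%:~R| <= K -> (`|a| <= Num.truncn K)%N.
    move=> aK; rewrite truncn_ge_nat ?(le_trans (normr_ge0 _) aK) //.
    by rewrite natr_absz intr_norm.
  by split; apply: absK; rewrite le_max ?cr ?dr ?orbT.
pose val (i : 'I_(B + B).+1) : int := i%:Z - B%:Z.
have valP a : (`|a| <= B)%N -> exists i, a = val i.
  move=> aB; have ia : (absz (a + B%:Z)%R < (B + B).+1)%N by lia.
  by exists (Ordinal ia); rewrite /val /=; lia.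
pose Q (q : 'I_(B + B).+1 * 'I_(B + B).+1) := `[< P (val q.1) (val q.2) >].
have [[i0 c0E] [j0 d0E]] : (exists i, c0 = val i) /\ (exists j, d0 = val j).
  by have [/valP ? /valP ?] := boxB _ _ (lexx r).
have Q0 : Q (i0, j0) by apply/asboolP; rewrite /= -c0E -d0E.
case: (arg_minP (fun q => f (val q.1) (val q.2)) Q0) => q /asboolP Pq q_min.
exists (val q.1), (val q.2); split=> // c d Pcd; rewrite -!/(f _ _).
have [fr|/ltW rf] := lerP (f c d) r; last first.
  by apply: le_trans rf; have := q_min _ Q0; rewrite /= -c0E -d0E.
have [/valP[i cE] /valP[j dE]] := boxB _ _ fr.
by have := q_min (i, j); rewrite /= -cE -dE; apply; apply/asboolP; rewrite /= -cE -dE.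
Qed.

Lemma SL2Z_autj_argmin z : upper_half_plane z ->
  exists2 g, SL2Z g & forall h, SL2Z h -> normc (autj g z) <= normc (autj h z).
Proof.
move=> z0; pose P (c d : int) := exists2 g, SL2Z g & g 1 0 = c%:~R /\ g 1 1 = d%:~R.
have [_ S1 _ _] := SL2Z_subgroup.
have [|c [d [[g Gg [gc gd]] g_min]]] := @lattice_normc_argmin z P z0.
  by exists 0, 1; exists 1%:M => //; rewrite !mxE.
exists g => // h Gh; have [/intrP[c' hc] /intrP[d' hd]] := (Gh.2 1 0, Gh.2 1 1).
have := g_min c' d' (ex_intro2 _ _ h Gh (conj hc hd)).
by rewrite /autj gc gd hc hd !rmorph_int.
Qed.

(* Half of the boundary is removed, so that every orbit is met exactly once. *)
Definition modular_domain : set R[i] :=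
  [set z | [/\ - 2^-1 <= complex.Re z, complex.Re z < 2^-1, upper_half_plane z &
    1 < normc z ^+ 2 \/ (normc z ^+ 2 = 1 /\ complex.Re z <= 0)]].

Lemma int_form_ge1 (c d x : R) : c \is a Num.int -> d \is a Num.int -> (c, d) != (0, 0) ->
  - 2^-1 <= x <= 2^-1 -> 1 <= c ^+ 2 + 2 * c * d * x + d ^+ 2.
Proof.
move=> /intrP[m ->] /intrP[n ->] mn /andP[x1 x2].
have {}mn : (m != 0) || (n != 0).
  by rewrite -negb_and; apply: contra mn => /andP[/eqP -> /eqP ->].
have formD : (1 <= m ^+ 2 + m * n + n ^+ 2)%R by move: mn; rewrite !expr2; nia.
have formB : (1 <= m ^+ 2 - m * n + n ^+ 2)%R by move: mn; rewrite !expr2; nia.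
move: formD formB; rewrite -!(ler_int R) !intrD !intrN !intrM => formD formB.
have [mn0|/ltW mn0] := lerP 0 (m%:~R * n%:~R : R).
  by have := ler_wpM2l mn0 x1; lra.
by have := ler_wnM2l mn0 x2; lra.
Qed.

Lemma sqr_normc_autj g z : normc (autj g z) ^+ 2 =
  (g 1 0) ^+ 2 * normc z ^+ 2 + 2 * g 1 0 * g 1 1 * complex.Re z + (g 1 1) ^+ 2.
Proof. by rewrite !sqr_normcE Re_autj Im_autj; ring. Qed.

Lemma modular_domain_normc_ge1 z : modular_domain z -> 1 <= normc z ^+ 2.
Proof. by move=> [_ _ _ [/ltW|[->]]]. Qed.

Lemma SL2Z_row_neq0 g : SL2Z g -> (g 1 0, g 1 1) != (0, 0).
Proof.
move=> [dg _]; apply/eqP => -[c0 d0]; move: dg; rewrite det_mx22 c0 d0 !mulr0 subrr.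
by move=> /esym/eqP; rewrite oner_eq0.
Qed.

Lemma modular_domain_autj_ge g z : SL2Z g -> modular_domain z ->
  1 + (g 1 0) ^+ 2 * (normc z ^+ 2 - 1) <= normc (autj g z) ^+ 2.
Proof.
move=> Gg [x1 x2 _ _]; rewrite sqr_normc_autj.
have := int_form_ge1 (x := complex.Re z) (Gg.2 1 0) (Gg.2 1 1) (SL2Z_row_neq0 Gg).
by rewrite x1 ltW // => /(_ isT); lra.
Qed.

Lemma modular_domain_autj_eq1 g z : SL2Z g -> modular_domain z ->
  modular_domain (mobius g z) ->
  [/\ normc (autj g z) ^+ 2 = 1, g 1 0 ^+ 2 * (normc z ^+ 2 - 1) = 0
    & g 1 0 ^+ 2 * (normc (mobius g z) ^+ 2 - 1) = 0].
Proof.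
move=> Gg zD gzD; have [dg _] := Gg; have [_ _ z0 _] := zD.
have := modular_domain_autj_ge Gg zD; have := modular_domain_autj_ge (SL2Z_inv Gg) gzD.
rewrite autj_invmx // normcV exprVn invmx22 // mx22E sqrrN.
set c2 := g 1 0 ^+ 2; set j2 := normc (autj g z) ^+ 2.
have c2z : 0 <= c2 * (normc z ^+ 2 - 1).
  by rewrite mulr_ge0 ?sqr_ge0 // subr_ge0 modular_domain_normc_ge1.
have c2gz : 0 <= c2 * (normc (mobius g z) ^+ 2 - 1).
  by rewrite mulr_ge0 ?sqr_ge0 // subr_ge0 modular_domain_normc_ge1.
move=> hgz hz; have j1 : 1 <= j2 by lra.
have jV1 : j2^-1 <= 1 by rewrite invf_le1 // (lt_le_trans ltr01).
have j2E : j2 = 1.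
  apply/eqP; rewrite eq_le j1 andbT -[leLHS]invrK invf_le1; first by lra.
  by rewrite invr_gt0 (lt_le_trans ltr01).
by move: hgz hz; rewrite j2E invr1; split; lra.
Qed.

Lemma complex_eq z w :
  complex.Re z = complex.Re w -> complex.Im z = complex.Im w -> z = w.
Proof. by case: z w => [a b] [c d] /= -> ->. Qed.

Lemma modular_domain_translate z (n : R) : n \is a Num.int ->
  modular_domain z -> modular_domain (z + n%:C) -> z + n%:C = z.
Proof.
move=> n_int [x1 x2 _ _] [u1 u2 _ _]; suff -> : n = 0 by rewrite addr0.
apply: int_eq_dist_lt1 => //.
by move: u1 u2; rewrite raddfD /= subr0 ltr_norml => u1 u2; apply/andP; split; lra.
Qed.

Lemma SL2Z_triangular_mobius g z : SL2Z g -> g 1 0 = 0 -> upper_half_plane z ->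
  normc (autj g z) ^+ 2 = 1 -> mobius g z = z + (g 0 1 / g 1 1)%:C.
Proof.
move=> [dg _] c0 z0; have := det_mx22 g; rewrite dg c0 mulr0 subr0 => ad.
rewrite /autj /mobius c0 mul0r !add0r normc_real real_normK ?num_real // => d1.
have d0 : g 1 1 != 0 by apply: contra_eq_neq d1 => ->; rewrite expr0n eq_sym oner_eq0.
have -> : g 0 0 = g 1 1.
  by apply: (mulIf d0); rewrite -expr2 d1.
by rewrite mulrDl mulrAC divff ?mul1r ?fmorph_div // fmorph_eq0.
Qed.

Lemma modular_domain_unique g z : SL2Z g ->
  modular_domain z -> modular_domain (mobius g z) -> mobius g z = z.
Proof.
move=> Gg zD gzD; have [dg gint] := Gg; have [_ _ z0 zB] := zD; have [_ _ _ gzB] := gzD.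
have [j1 c2z c2gz] := modular_domain_autj_eq1 Gg zD gzD.
have ImE : complex.Im (mobius g z) = complex.Im z by rewrite Im_mobius // j1 divr1.
case: (eqVneq (g 1 0) 0) => [c0|c0].
  move: gzD; rewrite SL2Z_triangular_mobius // => gzD.
  apply: modular_domain_translate => //.
  have d1 : g 1 1 ^+ 2 = 1 by move: j1; rewrite sqr_normc_autj c0; lra.
  have d0 : g 1 1 != 0 by apply: contra_eq_neq d1 => ->; rewrite expr0n eq_sym oner_eq0.
  have -> : (g 1 1)^-1 = g 1 1 by apply: (mulIf d0); rewrite mulVf // -expr2.
  by rewrite rpredM.
have unit_norm w : g 1 0 ^+ 2 * (normc w ^+ 2 - 1) = 0 -> normc w ^+ 2 = 1.
  by move=> /eqP; rewrite mulf_eq0 expf_eq0 (negbTE c0) /= subr_eq0 => /eqP.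
have {c2z} nz := unit_norm _ c2z; have {c2gz} ngz := unit_norm _ c2gz.
have x0 : complex.Re z <= 0 by case: zB => [|[]//]; rewrite nz ltxx.
have gx0 : complex.Re (mobius g z) <= 0 by case: gzB => [|[]//]; rewrite ngz ltxx.
apply: complex_eq => //; have : complex.Re (mobius g z) ^+ 2 = complex.Re z ^+ 2.
  by have := sqr_normcE (mobius g z); rewrite ngz -nz sqr_normcE ImE; lra.
by move/eqP; rewrite eqf_sqr => /orP[/eqP//|/eqP]; lra.
Qed.

Lemma mobius_mx22_translation (n : R) z : mobius (mx22 1 n 0 1) z = z + n%:C.
Proof. by rewrite /mobius !mx22E mul1r mul0r add0r divr1. Qed.

Lemma mobius_mx22_inversion z : mobius (mx22 0 (-1) 1 0) z = - z^-1.
Proof. by rewrite /mobius !mx22E !mul0r mul1r add0r addr0 rmorphN1 mulN1r. Qed.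

Lemma unit_normc_oppV z : normc z ^+ 2 = 1 -> - z^-1 = (- complex.Re z) +i* complex.Im z.
Proof.
move=> nz; have z0 : z != 0.
  by apply: contra_eq_neq nz => ->; rewrite [normc _]normc0 expr0n eq_sym oner_eq0.
apply: (mulIf z0); rewrite mulNr mulVf //; move: nz; rewrite sqr_normcE.
by case: (z) => a b /= nz; apply: complex_eq; rewrite /=;
  [move: nz; rewrite !expr2; lra|ring].
Qed.

Lemma modular_domain_exists z : upper_half_plane z ->
  exists2 g, SL2Z g & modular_domain (mobius g z).
Proof.
move=> z0; have [g Gg g_min] := SL2Z_autj_argmin z0; have [dg _] := Gg.
set w := mobius g z; have w0 : upper_half_plane w by exact: mobius_upper.
have w_min h : SL2Z h -> 1 <= normc (autj h w) ^+ 2.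
  move=> Gh; rewrite -[leLHS](expr1n _ 2) ler_pXn2r ?nnegrE ?normc_ge0 //.
  have := g_min _ (SL2Z_mul Gh Gg); rewrite autjM // normcM -/w.
  by rewrite -[leLHS]mul1r ler_pM2r // normc_gt0 autj_neq0.
pose n : R := - (Num.floor (complex.Re w + 2^-1))%:~R; pose v := w + n%:C.
have n_int : n \is a Num.int by rewrite rpredN intr_int.
have [v1 v2] : - 2^-1 <= complex.Re v /\ complex.Re v < 2^-1.
  rewrite /v raddfD /= /n.
  by have := floor_itv (complex.Re w + 2^-1); rewrite intrD => /andP[]; lra.
pose T := mx22 1 n 0 1; pose S := mx22 0 (-1) 1 0.
have GT : SL2Z T by apply: SL2Z_mx22; rewrite ?rpred0 ?rpred1 //; ring.
have GS : SL2Z S by apply: SL2Z_mx22; rewrite ?rpredN ?rpred0 ?rpred1 //; ring.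
have vE : v = mobius (T *m g) z by rewrite mobiusM ?GT.1 // mobius_mx22_translation.
have v0 : upper_half_plane v by rewrite vE; apply: mobius_upper => //;
  exact: (SL2Z_mul GT Gg).1.
have nv : 1 <= normc v ^+ 2.
  have := w_min _ (SL2Z_mul GS GT); rewrite autjM ?GT.1 // mobius_mx22_translation -/v.
  by rewrite normcM exprMn !sqr_normc_autj !mx22E; lra.
have [nv1|nv1] := ltrP 1 (normc v ^+ 2).
  by exists (T *m g); [exact: SL2Z_mul|rewrite -vE; split=> //; left].
have {nv nv1} nv : normc v ^+ 2 = 1 by apply/eqP; rewrite eq_le nv nv1.
have [xv|xv] := lerP (complex.Re v) 0.
  by exists (T *m g); [exact: SL2Z_mul|rewrite -vE; split=> //; right].
have GTg := SL2Z_mul GT Gg; exists (S *m (T *m g)); first exact: SL2Z_mul.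
rewrite mobiusM ?GS.1 ?GTg.1 // -vE mobius_mx22_inversion unit_normc_oppV //.
have nSv : normc ((- complex.Re v) +i* complex.Im v) ^+ 2 = 1.
  by rewrite sqr_normcE /= sqrrN -sqr_normcE.
by split=> /=; [lra|lra|exact: v0|right; split; [exact: nSv|lra]].
Qed.

End ModularGroup.

Section FiniteCovolume.
Variable R : realType.
Local Open Scope ereal_scope.
Local Notation mu := (@lebesgue_measure R).
Local Notation mu2 := (mu \x mu)%E.

Definition modular_domain2 : set (R * R) := [set p | modular_domain (p.1 +i* p.2)%C].

Lemma measurable_modular_domain2 : measurable modular_domain2.
Proof.
pose nsq (p : R * R) : R := (p.1 ^+ 2 + p.2 ^+ 2)%R.
have m1 : measurable_fun setT (fst : R * R -> R) by exact: measurable_fst.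
have m2 : measurable_fun setT (snd : R * R -> R) by exact: measurable_snd.
have mn : measurable_fun setT nsq.
  by apply: measurable_funD;
    [exact: (measurable_funX 2 m1)|exact: (measurable_funX 2 m2)].
have pre (f : R * R -> R) (B : set R) :
    measurable_fun setT f -> measurable B -> measurable (f @^-1` B).
  by move=> mf mB; rewrite -[X in measurable X]setTI; exact: mf.
have -> : modular_domain2 =
    (fst @^-1` `[(- 2^-1)%R, 2^-1%R[%classic `&` snd @^-1` `]0%R, +oo[%classic)
   `&` (nsq @^-1` `]1%R, +oo[%classic
        `|` (nsq @^-1` [set 1%R] `&` fst @^-1` `]-oo, 0%R]%classic)).
  apply/seteqP; split=> -[x y];
    rewrite /modular_domain2 /modular_domain /upper_half_plane;
    rewrite /= sqr_sqrtr ?addr_ge0 ?sqr_ge0 // !in_itv /= !andbT.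
    by move=> [-> -> -> [?|[? ?]]]; split=> //; [left|right].
  by move=> [[/andP[? ?] ?] [?|[? ?]]]; split=> //; [left|right].
apply: measurableI; first by apply: measurableI; apply: pre => //; exact: measurable_itv.
apply: measurableU; first by apply: pre => //; exact: measurable_itv.
by apply: measurableI; apply: pre => //; exact: measurable_itv.
Qed.

Lemma modular_domain_Im_ge (x y : R) : modular_domain (x +i* y)%C -> (2^-1 <= y)%R.
Proof.
move=> xyD; have := modular_domain_normc_ge1 xyD; rewrite sqr_normcE /= => n1.
have [/= x1 x2 y0 _] := xyD; rewrite /upper_half_plane /= in y0.
rewrite leNgt; apply/negP => y2.
have : (x ^+ 2 <= 4^-1)%R by nra.
have : (y ^+ 2 < 4^-1)%R by nra.
by lra.
Qed.

Lemma integral_prod_fun (a b : R -> R) :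
  measurable_fun setT a -> measurable_fun setT b ->
  (forall x, 0 <= a x)%R -> (forall y, 0 <= b y)%R ->
  \int[mu2]_p (a p.1 * b p.2)%:E = \int[mu]_x (a x)%:E * \int[mu]_y (b y)%:E.
Proof.
move=> ma mb a0 b0; pose ab p := (a p.1 * b p.2)%:E.
rewrite -[LHS]/(\int[mu2]_p ab p) fubini_tonelli1; last 2 first.
- apply/measurable_EFinP; apply: measurable_funM.
    exact: (measurableT_comp ma measurable_fst).
  exact: (measurableT_comp mb measurable_snd).
- by move=> p; rewrite lee_fin mulr_ge0.
rewrite muleC -ge0_integralZl; first last.
- by apply: integral_ge0 => y _; rewrite lee_fin.
- by move=> x _; rewrite lee_fin.
- exact/measurable_EFinP.
- exact: measurableT.
apply: eq_integral => x _; rewrite /fubini_F muleC.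
transitivity (\int[mu]_y ((a x)%:E * (b y)%:E)).
  by apply: eq_integral => y _; rewrite -EFinM.
rewrite ge0_integralZl; first by [].
- exact: measurableT.
- exact/measurable_EFinP.
- by move=> y _; rewrite lee_fin.
- by rewrite lee_fin.
Qed.

Definition strip (x : R) : R := \1_(`[(- 2^-1)%R, 2^-1%R]%classic) x.

Definition height_weight (y : R) : R := (\1_(`[0%R, +oo[%classic) y * (5 / oneDsqr y))%R.

Lemma strip_ge0 x : (0 <= strip x)%R.
Proof. by rewrite /strip indicE ler0n. Qed.

Lemma height_weight_ge0 y : (0 <= height_weight y)%R.
Proof.
by rewrite mulr_ge0 ?indicE ?ler0n // divr_ge0 // (le_trans ler01) // oneDsqr_ge1.
Qed.

Lemma measurable_strip : measurable_fun setT strip.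
Proof. by apply: measurable_indic; exact: measurable_itv. Qed.

Lemma measurable_oneDsqrV : measurable_fun setT (fun y : R => (5 / oneDsqr y)%R).
Proof.
apply: measurable_funM; first exact: measurable_cst.
by apply: continuous_measurable_fun; exact: continuous_oneDsqrV.
Qed.

Lemma measurable_height_weight : measurable_fun setT height_weight.
Proof.
apply: measurable_funM measurable_oneDsqrV.
by apply: measurable_indic; exact: measurable_itv.
Qed.

Lemma integral_strip : \int[mu]_x (strip x)%:E = 1.
Proof.
rewrite integral_indic // setIT.
transitivity (lebesgue_measure (`[(- 2^-1)%R, 2^-1%R]%classic : set R)); first by [].
rewrite lebesgue_measure_itv /= lte_fin ifT; last by lra.
by rewrite -EFinB; congr (_%:E); lra.
Qed.

Lemma integral_height_weight : \int[mu]_y (height_weight y)%:E = (5 * (pi / 2))%:E.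
Proof.
transitivity (\int[mu]_(y in `[0%R, +oo[) (5 / oneDsqr y)%:E).
  rewrite [RHS]integral_mkcond; apply: eq_integral => y _.
  by rewrite /height_weight patchE indicE; case: ifP => _; rewrite ?mul1r ?mul0r.
under eq_integral do rewrite EFinM.
rewrite ge0_integralZl ?integral0y_oneDsqr //.
apply: measurable_funTS; apply/measurable_EFinP; apply: continuous_measurable_fun.
exact: continuous_oneDsqrV.
Qed.

Lemma hyperbolic_density_le p : modular_domain2 p ->
  ((p.2 : R) ^- 2 <= strip p.1 * height_weight p.2)%R.
Proof.
case: p => x y pD; have y2 := modular_domain_Im_ge pD; have [/= x1 x2 y0 _] := pD.
rewrite /upper_half_plane /= in y0 y2.
rewrite /strip /height_weight !indicE !mem_set /=; last 2 first.
- by rewrite in_itv /= ltW.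
- by rewrite in_itv /= x1 ltW.
rewrite !mul1r /oneDsqr.
have p1 : (0 < 1 + y ^+ 2)%R by rewrite ltr_pwDl // sqr_ge0.
have p2 : (0 < y ^+ 2)%R by rewrite exprn_gt0.
by rewrite ler_pdivlMr // mulrC ler_pdivrMr //; nra.
Qed.

Lemma measurable_hyperbolic_density :
  measurable_fun modular_domain2 (fun p : R * R => (p.2 ^- 2)%R).
Proof.
rewrite (_ : (fun p => _) = (fun y : R => (y ^- 2)%R) \o snd) //.
apply: (measurable_comp (F := (`]0%R, +oo[%classic : set R))).
- exact: measurable_itv.
- by move=> _ [p [_ _ p0 _] <-]; rewrite /= in_itv /= andbT.
- apply: open_continuous_measurable_fun; first exact: interval_open.
  move=> y; rewrite inE /= in_itv /= andbT => y0; apply: cvgV;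
    first by rewrite expf_neq0 ?gt_eqF.
  exact: exprn_continuous.
- exact: measurable_funTS measurable_snd.
Qed.

Lemma modular_domain_area_finite : \int[mu2]_(p in modular_domain2) ((p.2 ^- 2)%:E) < +oo.
Proof.
have mD := measurable_modular_domain2.
have dom_ge0 p : 0 <= (strip p.1 * height_weight p.2)%:E.
  by rewrite lee_fin mulr_ge0 ?strip_ge0 ?height_weight_ge0.
have m_dom : measurable_fun setT (fun p => (strip p.1 * height_weight p.2)%:E).
  apply/measurable_EFinP; apply: measurable_funM.
    exact: (measurableT_comp measurable_strip measurable_fst).
  exact: (measurableT_comp measurable_height_weight measurable_snd).
apply: (@le_lt_trans _ _
    (\int[mu2]_(p in modular_domain2) (strip p.1 * height_weight p.2)%:E)).
  apply: ge0_le_integral => //.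
  - by move=> p [_ _ p0 _]; rewrite lee_fin invr_ge0 exprn_ge0 // ltW.
  - by apply/measurable_EFinP; exact: measurable_hyperbolic_density.
  - exact: measurable_funTS.
  - by move=> p pD; rewrite lee_fin hyperbolic_density_le.
apply: (@le_lt_trans _ _ (\int[mu2]_p (strip p.1 * height_weight p.2)%:E)).
  by apply: ge0_subset_integral.
rewrite integral_prod_fun.
- by rewrite integral_strip integral_height_weight mul1e ltry.
- exact: measurable_strip.
- exact: measurable_height_weight.
- exact: strip_ge0.
- exact: height_weight_ge0.
Qed.

Lemma SL2Z_fuchsian : fuchsian (@SL2Z R).
Proof.
split; [exact: SL2Z_subgroup|exact: SL2Z_discrete|].
exists modular_domain2; last exact: modular_domain_area_finite.
split; first exact: measurable_modular_domain2.
  by move=> p [].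
move=> z z0; have [g Gg gzD] := modular_domain_exists z0; have [dg _] := Gg.
exists (complex.Re (mobius g z), complex.Im (mobius g z)); split.
  rewrite /modular_domain2 /= (_ : (_ +i* _)%C = mobius g z); last exact: complex_eq.
  by split=> //; exists g.
move=> [x y] [pD [h Gh /= pE]]; have [dh _] := Gh; have [dgi _] := SL2Z_inv Gg.
have hgE : mobius (h *m invmx g) (mobius g z) = (x +i* y)%C.
  by rewrite mobiusM ?mobiusK //; exact: mobius_upper.
have := modular_domain_unique (SL2Z_mul Gh (SL2Z_inv Gg)) gzD.
by rewrite hgE => /(_ pD) <-.
Qed.

End FiniteCovolume.

(** * Uniqueness *)

Section SymmetricPower.
Variable R : realType.
Implicit Types (g h : 'M[R]_2) (z w : R[i]) (m i : nat).

Definition veronese m z : 'cV[R[i]]_m.+1 := \col_i z ^+ i.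

Definition sym_row m g i : {poly R[i]} :=
  ((g 0 0)%:C *: 'X + (g 0 1)%:C%:P) ^+ i * ((g 1 0)%:C *: 'X + (g 1 1)%:C%:P) ^+ (m - i).

Definition sym_rep m g : 'M[R[i]]_m.+1 := \matrix_(i, j) (sym_row m g i)`_j.

Lemma size_affine_le2 (a b : R[i]) : (size (a *: 'X + b%:P)%R <= 2)%N.
Proof.
rewrite -mul_polyC size_MXaddC; case: ifP => // _.
by rewrite ltnS size_polyC_leq1.
Qed.

Lemma size_affine_exp_le (a b : R[i]) n : (size ((a *: 'X + b%:P) ^+ n)%R <= n.+1)%N.
Proof.
apply: leq_trans (size_poly_exp_leq _ _) _; rewrite ltnS -[leqRHS]mul1n leq_mul2r.
by have := size_affine_le2 a b; case: (size _) => [|[|[|]]] // _; rewrite orbT.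
Qed.

Lemma size_sym_row m g i : (i <= m)%N -> (size (sym_row m g i) <= m.+1)%N.
Proof.
move=> im; apply: leq_trans (size_polyMleq _ _) _.
have := size_affine_exp_le (g 0 0)%:C (g 0 1)%:C i.
have := size_affine_exp_le (g 1 0)%:C (g 1 1)%:C (m - i).
by move: (size _) (size _) => a b; lia.
Qed.

Lemma sym_rep_veronese m g z : autj g z != 0 ->
  sym_rep m g *m veronese m z = autj g z ^+ m *: veronese m (mobius g z).
Proof.
move=> j0; apply/matrixP => i j; rewrite ord1 !mxE; under eq_bigr do rewrite !mxE.
have im := leq_ord i.
rewrite -(horner_coef_wide _ (size_sym_row g im)) hornerM !horner_exp !hornerE.
have -> : autj g z ^+ m = autj g z ^+ i * autj g z ^+ (m - i) by rewrite -exprD subnKC.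
rewrite /mobius -/(autj g z) expr_div_n; field.
by rewrite expf_neq0.
Qed.

Lemma veronese_separating m q (A B : 'M[R[i]]_(q, m.+1)) :
  (forall z, upper_half_plane z -> A *m veronese m z = B *m veronese m z) -> A = B.
Proof.
move=> AB; apply/matrixP => i j.
pose P (M : 'M[R[i]]_(q, m.+1)) : {poly R[i]} := \poly_(r < m.+1) M i (inord r).
have PE (M : 'M[R[i]]_(q, m.+1)) z : (P M).[z] = (M *m veronese m z) i 0.
  by rewrite horner_poly mxE; apply: eq_bigr => r _; rewrite !mxE inord_val.
have : P A = P B.
  apply: (@poly_ext_inj _ _ _ (fun a => a%:R +i* 1)) => [a b [] /eqP|a].
    by rewrite eqr_nat => /eqP.
  by rewrite !PE AB // /upper_half_plane /= ltr01.
move=> /(congr1 (fun p : {poly R[i]} => p`_j)); rewrite !coef_poly ltn_ord.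
by rewrite inord_val.
Qed.

Lemma sym_rep1 m : sym_rep m 1%:M = 1%:M.
Proof.
apply: veronese_separating => z z0.
by rewrite sym_rep_veronese autj1 ?oner_neq0 // mobius1 mul1mx expr1n scale1r.
Qed.

Lemma sym_repM m g h : \det g = 1 -> \det h = 1 ->
  sym_rep m (g *m h) = sym_rep m g *m sym_rep m h.
Proof.
move=> dg dh; apply: veronese_separating => z z0.
have dgh : \det (g *m h) = 1 by rewrite det_mulmx dg dh mulr1.
rewrite -mulmxA !sym_rep_veronese ?autj_neq0 // -scalemxAr sym_rep_veronese; last first.
  by apply: autj_neq0 => //; exact: mobius_upper.
by rewrite autjM // mobiusM // scalerA exprMn mulrC.
Qed.

Lemma affine_conjc (a b : R) z : a%:C * conjc z + b%:C = conjc (a%:C * z + b%:C).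
Proof. by apply: complex_eq; case: z => x y /=; ring. Qed.

Lemma autj_conjc g z : autj g (conjc z) = conjc (autj g z).
Proof. exact: affine_conjc. Qed.

Lemma mobius_conjc g z : mobius g (conjc z) = conjc (mobius g z).
Proof. by rewrite /mobius !affine_conjc -conjc_inv -rmorphM. Qed.

End SymmetricPower.

Section TensorVectors.
Variable K : comNzRingType.

Lemma tensmx_colE m p q r (A : 'M[K]_(q, m)) (B : 'M[K]_(r, p))
    (v : 'cV[K]_m) (u : 'cV[K]_p) :
  (A *t B) *m (v *t u : 'cV[K]_(m * p)) = (A *m v) *t (B *m u) :> 'cV[K]_(q * r).
Proof.
change ((A *t B) *m (v *t u) = (A *m v) *t (B *m u)).
by rewrite tensmx_mul.
Qed.

Lemma tensmx_rowE m p q r (A : 'M[K]_(m, q)) (B : 'M[K]_(p, r))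
    (v : 'rV[K]_m) (u : 'rV[K]_p) :
  (v *t u : 'rV[K]_(m * p)) *m (A *t B) = (v *m A) *t (u *m B) :> 'rV[K]_(q * r).
Proof.
change ((v *t u) *m (A *t B) = (v *m A) *t (u *m B)).
by rewrite tensmx_mul.
Qed.

Lemma tensmx_colZ m p (a b : K) (v : 'cV[K]_m) (u : 'cV[K]_p) :
  ((a *: v) *t (b *: u) : 'cV[K]_(m * p)) = (a * b) *: (v *t u : 'cV[K]_(m * p)).
Proof. by apply/matrixP => i j; rewrite !mxE mulrACA. Qed.

Lemma tensmx_row_col m p (L : 'rV[K]_m) (M : 'rV[K]_p) (v : 'cV[K]_m) (u : 'cV[K]_p) :
  ((L *t M : 'rV[K]_(m * p)) *m (v *t u : 'cV[K]_(m * p))) 0 0 =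
  (L *m v) 0 0 * (M *m u) 0 0.
Proof.
have := congr1 (fun N : 'cV[K]_(1 * 1) => N 0 0) (tensmx_colE L M v u).
by rewrite [RHS]mxE !ord1 => <-.
Qed.

Lemma tensmx11 m p : (1%:M : 'M[K]_m) *t (1%:M : 'M[K]_p) = 1%:M.
Proof.
apply/matrixP => i j; rewrite -(mxtens_unindexK i) -(mxtens_unindexK j).
case: (mxtens_unindex i) (mxtens_unindex j) => [i1 i2] [j1 j2].
by rewrite tensmxE !mxE -natrM mulnb (can_eq (@mxtens_indexK m p)).
Qed.

End TensorVectors.

Section ImaginaryPart.
Variable R : realType.
Implicit Types (g : 'M[R]_2) (z w a : R[i]).

Definition imC z : R[i] := (complex.Im z)%:C.

Lemma imC_neq0 z : upper_half_plane z -> imC z != 0.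
Proof. by rewrite /upper_half_plane /= => z0;
  rewrite -normc_gt0 normc_real normr_gt0 gt_eqF. Qed.

Lemma imC_mobius g z : \det g = 1 -> upper_half_plane z ->
  imC (mobius g z) = imC z / (autj g z * conjc (autj g z)).
Proof.
move=> dg z0; rewrite /imC Im_mobius // rmorphM fmorphV /=; congr (_ / _).
by rewrite -sqr_normc rmorphXn.
Qed.

Lemma conjc_autj g z : conjc (autj g z) = autj g z + (- (2 * 'i%C * imC z)) * autj' g.
Proof.
have := subcJ (autj g z); rewrite Im_autj rmorphM /= -/(imC z) -/(autj' g) => subJ.
transitivity (autj g z - (autj g z - conjc (autj g z))); first by ring.
by rewrite subJ; ring.
Qed.

Lemma real_ana_imC a : real_ana imC a.
Proof. by apply: analytic_ext (analytic_coordy _ a) => w; exact: real_linear_Im. Qed.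

Lemma real_ana_id a : real_ana id a.
Proof.
have HA := analytic_da (ReIm_coords R) a.
apply: analytic_ext (da_add HA (analytic_coordx _ a)
  (da_mul HA (da_cst HA 'i%C) (analytic_coordy _ a))) => w.
by rewrite real_linear_Re real_linear_Im -complexE.
Qed.

Lemma real_ana_conjc a : real_ana (@conjc R) a.
Proof.
have HA := analytic_da (ReIm_coords R) a.
apply: analytic_ext (da_add HA (analytic_coordx _ a)
  (da_mul HA (da_cst HA (- 'i%C)) (analytic_coordy _ a))) => w.
by rewrite real_linear_Re real_linear_Im; apply: complex_eq; case: w => x y /=; ring.
Qed.

Lemma geometric_invD (b y : R[i]) n : b != 0 -> b + y != 0 ->
  \sum_(j < n) (-1) ^+ j * b ^- j.+1 * y ^+ j =
  (b + y)^-1 - (b + y)^-1 * (- y / b) ^+ n.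
Proof.
move=> b0 by0; elim: n => [|n IH]; first by rewrite big_ord0 expr0 mulr1 subrr.
rewrite big_ord_recr /= IH !exprS !exprMn !exprVn -!(mulN1r y) !exprMn; field.
by rewrite expf_neq0 // b0 by0.
Qed.

Lemma real_ana_imCV a : upper_half_plane a -> real_ana (fun z => (imC z)^-1) a.
Proof.
rewrite /upper_half_plane /=; set b := complex.Im a => b0.
have bC0 : b%:C != 0 by rewrite -normc_gt0 normc_real normr_gt0 gt_eqF.
pose A i j : R[i] := if i is 0 then (-1) ^+ j * b%:C ^- j.+1 else 0.
have A0 i j : A i.+1 j = 0 by [].
exists A, (b / 2), (b^-1 * 2); split; first by rewrite divr_gt0.
  move=> n; rewrite sqsum_row0 => [|i j]; last by rewrite A0 [normc _]normc0 mul0r.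
  apply: le_trans (ler_wpM2l _ (half_expr_sum_le2 R n)); last by rewrite invr_ge0 ltW.
  rewrite mulr_sumr; apply: ler_sum => j _.
  rewrite normcM normcX normcN normc1 expr1n mul1r normcV normcX normc_real gtr0_norm //.
  by rewrite add0n exprMn exprS invfM -mulrA mulKf // expf_neq0 // gt_eqF.
move=> w _; rewrite real_linear_Re real_linear_Im normc_real => yb.
set y := complex.Im w in yb *; have y2 := ler_normlW yb.
have by0 : b%:C + y%:C != 0.
  rewrite -rmorphD -normc_gt0 normc_real normr_gt0 gt_eqF //.
  by move: yb; rewrite ler_norml => /andP[]; lra.
have -> : imC (a + w) = b%:C + y%:C by rewrite /imC raddfD rmorphD.
apply: (cvgc_geometric (C := normc (b%:C + y%:C)^-1)) (cvgc_cst _) => n.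
rewrite [dseries _ _ _ _]sqsum_row0 => [|i j]; last by rewrite A0 !mul0r.
under eq_bigr do rewrite expr0 mulr1.
rewrite geometric_invD // addrC addKr normcN normcM normcX ler_wpM2l ?normc_ge0 //.
rewrite lerXn2r ?nnegrE ?normc_ge0 // normcM normcN normcV !normc_real (gtr0_norm b0).
by rewrite ler_pdivrMr // mulrC.
Qed.

End ImaginaryPart.

Section VanishingOrder.
Variables (R : realType) (U : set R[i]).
Hypothesis Uopen : open (U : set R[i]^o).
Implicit Types (h : R[i] -> R[i]) (z : R[i]).

Local Notation smooth := (smooth_on (@dtau_derivable R) U).

Lemma iter_dtau_subM z0 h j z : smooth h -> U z ->
  dtau_iter j (fun w => (w - z0) * h w) z =
  (z - z0) * dtau_iter j h z + j%:R * dtau_iter j.-1 h z.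
Proof.
have HD := @dtau_derivable_slash_class R.
move=> hs; elim: j z => [|j IH] z Uz; first by rewrite mul0r addr0.
rewrite iterS; apply: (@dtau_eq_on _ _ Uopen
  (fun w => (w - z0) * dtau_iter j h w + j%:R * dtau_iter j.-1 h w)) => [w Uw||].
- by rewrite IH.
- exact: Uz.
have sub_dtau := is_dtauD (is_dtau_id z) (is_dtau_cst (- z0) z).
apply: is_dtau_eq (is_dtauD (is_dtauM sub_dtau (smooth_on_is_dtau HD j hs Uz))
  (is_dtauZ j%:R (smooth_on_is_dtau HD j.-1 hs Uz))) _.
rewrite -natr1 -[j.+1.-1]/j; case: j {IH} => [|j]; first by rewrite !mul0r; ring.
rewrite -[j.+1.-1]/j; set x := dtau_iter j h z; set y := dtau_iter j.+1 h z.
by set y' := dtau_iter j.+2 h z; ring.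
Qed.

Lemma smooth_on_subX z0 a h : smooth h -> smooth (fun w => (w - z0) ^+ a * h w).
Proof.
have HD := @dtau_derivable_slash_class R; have UA := smooth_on_diff_algebra HD Uopen.
move=> hs; apply: (da_mul UA) hs; apply: (da_exp _ UA).
apply: (@smooth_on_eq _ _ _ HD Uopen (fun w => 1 * w - z0)) => [w _|].
  by rewrite mul1r.
exact: smooth_on_affine.
Qed.

Lemma iter_dtau_subX z0 a h j : smooth h -> U z0 ->
  dtau_iter j (fun w => (w - z0) ^+ a * h w) z0 = (j ^_ a)%:R * dtau_iter (j - a) h z0.
Proof.
move=> hs Uz0; elim: a j => [|a IH] j.
  by rewrite subn0 mul1r; congr (dtau_iter _ _ _); apply/funext => w; rewrite mul1r.
transitivity (dtau_iter j (fun w => (w - z0) * ((w - z0) ^+ a * h w)) z0).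
  by congr (dtau_iter _ _ _); apply/funext => w; rewrite exprS mulrA.
rewrite (iter_dtau_subM _ _ (smooth_on_subX _ _ hs) Uz0).
rewrite subrr mul0r add0r IH; case: j => [|j]; first by rewrite !mul0r.
by rewrite ffactSS natrM -mulrA.
Qed.

End VanishingOrder.

Section Pairings.
Variable R : realType.
Implicit Types (z w : R[i]).

Local Notation H := (@upper_half_plane R).
Local Notation smooth := (smooth_on (@dtau_derivable R) H).

Definition pairing q (L : 'rV[R[i]]_q) (f : R[i] -> 'cV[R[i]]_q) z : R[i] :=
  (L *m f z) 0 0.

Lemma smooth_on_pairing q (L : 'rV[R[i]]_q) (f : R[i] -> 'cV[R[i]]_q) :
  (forall i, smooth (fun w => f w i 0)) -> smooth (pairing L f).
Proof.
have HD := @dtau_derivable_slash_class R.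
have HA := smooth_on_diff_algebra HD (@open_upper_half_plane R).
move=> fs; apply: (smooth_on_eq HD (@open_upper_half_plane R)
  (h := fun w => \sum_i L 0 i * f w i 0)).
  by move=> w _; rewrite /pairing mxE.
by apply: da_sum => // i _; apply: (da_mul HA); [exact: (da_cst HA)|exact: fs].
Qed.

Lemma iter_dtau_pairing q (L : 'rV[R[i]]_q) (f : R[i] -> 'cV[R[i]]_q) j z :
  (forall i, smooth (fun w => f w i 0)) -> H z ->
  dtau_iter j (pairing L f) z = (L *m iter j (@dtau R q) f z) 0 0.
Proof.
have HD := @dtau_derivable_slash_class R.
move=> fs z0; transitivity (dtau_iter j (fun w => \sum_i L 0 i * f w i 0) z).
  by congr (dtau_iter _ _ _); apply/funext => w; rewrite /pairing mxE.
rewrite (iter_dtau_linear HD (@open_upper_half_plane R) _ _ fs z0) mxE.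
by apply: eq_bigr => i _; rewrite iter_dtau_coordinate.
Qed.

Lemma bracket_pairing q r n (c : 'rV[R[i]]_n.+1) (L : 'rV[R[i]]_q) (M : 'rV[R[i]]_r)
    (f : R[i] -> 'cV[R[i]]_q) (g : R[i] -> 'cV[R[i]]_r) z :
  (forall i, smooth (fun w => f w i 0)) -> (forall i, smooth (fun w => g w i 0)) -> H z ->
  pairing (L *t M : 'rV[R[i]]_(q * r)) (bracket c f g) z =
  rc_bracket n (fun r => c 0 (inord r)) (pairing L f) (pairing M g) z.
Proof.
move=> fs gs z0; rewrite /pairing /bracket mulmx_sumr summxE; apply: eq_bigr => i _.
rewrite -scalemxAr mxE [X in _ * X]tensmx_row_col inord_val mulrA.
by rewrite -!iter_dtau_pairing.
Qed.

End Pairings.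

(* Functions of weight [kap + d] and depth [d] obtained from a transformation
   law with an antiholomorphic factor. *)
Section TwistedForms.
Variables (R : realType) (q : nat) (rho : 'M[R]_2 -> 'M[R[i]]_q) (kap : int) (d : nat).
Variable f : R[i] -> 'cV[R[i]]_q.
Implicit Types (s : 'M[R]_2) (L : 'rV[R[i]]_q) (w : R[i]).

Local Notation H := (@upper_half_plane R).

Hypothesis f_smooth : forall i, smooth_on (@dtau_derivable R) H (fun w => f w i 0).
Hypothesis f_law : forall g z, \det g = 1 -> H z ->
  f (mobius g z) = (autj g z ^ kap * conjc (autj g z) ^+ d) *: (rho g *m f z).

Lemma slash_pairing L s w : \det s = 1 -> H w ->
  slash s kap (pairing L f) w = conjc (autj s w) ^+ d * pairing (L *m rho s) f w.
Proof.
move=> ds w0; have j0 := autj_neq0 ds w0.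
rewrite /slash /pairing f_law // -scalemxAr mulmxA [X in _ * X = _]mxE mulrA.
by rewrite mulrA -expfzDr // addNr mul1r.
Qed.

Lemma is_dtau_conjc_autjX s w : is_dtau (fun w => conjc (autj s w) ^+ d) w 0.
Proof.
have conj_autj_dtau : is_dtau (fun w => conjc (autj s w)) w 0.
  have := is_dtauD (is_dtauZ (s 1 0)%:C (is_dtau_conj w)) (is_dtau_cst (s 1 1)%:C w).
  by rewrite mulr0 addr0; apply: is_dtau_ext => v; exact: affine_conjc.
by apply: is_dtau_eq (is_dtauX d conj_autj_dtau) _; rewrite mulr0 mul0r.
Qed.

Lemma iter_dtau_twisted L s w r : \det s = 1 -> H w ->
  conjc (autj s w) ^+ d * dtau_iter r (pairing (L *m rho s) f) w =
  (bol_poly kap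
    (fun i => slash s (kap + (2 * i)%:Z) (dtau_iter i (pairing L f)) w) r).[autx s w].
Proof.
move=> ds w0; have HD := @dtau_derivable_slash_class R.
have Hopen := @open_upper_half_plane R.
have sH : mobius s @` H `<=` H by move=> _ [v v0 <-]; exact: mobius_upper.
have Ls := smooth_on_pairing L f_smooth; have Lss := smooth_on_subset sH Ls.
rewrite -(iter_dtau_slash HD ds Hopen (@subset_refl _ _) kap r Lss w0).
rewrite -(iter_dtau_antiholomorphic HD Hopen r (fun v _ => is_dtau_conjc_autjX s v)
  (smooth_on_pairing _ f_smooth) w0).
apply: (iter_dtau_eq_on HD Hopen) w0 => [v v0|]; first by rewrite slash_pairing.
exact: (smooth_on_slash HD ds Hopen (@subset_refl _ _) kap Lss).
Qed.

End TwistedForms.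

Section TwistedBrackets.
Variables (R : realType) (q r : nat) (kap lam : int) (d e n : nat) (c : 'rV[R[i]]_n.+1).
Variables (rho : 'M[R]_2 -> 'M[R[i]]_q) (eta : 'M[R]_2 -> 'M[R[i]]_r).
Variables (f : R[i] -> 'cV[R[i]]_q) (g : R[i] -> 'cV[R[i]]_r).
Variables (L : 'rV[R[i]]_q) (M : 'rV[R[i]]_r) (z0 : R[i]).
Implicit Types (h : 'M[R]_2).

Local Notation H := (@upper_half_plane R).

Hypothesis f_smooth : forall i, smooth_on (@dtau_derivable R) H (fun w => f w i 0).
Hypothesis g_smooth : forall i, smooth_on (@dtau_derivable R) H (fun w => g w i 0).
Hypothesis f_law : forall h z, \det h = 1 -> H z ->
  f (mobius h z) = (autj h z ^ kap * conjc (autj h z) ^+ d) *: (rho h *m f z).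
Hypothesis g_law : forall h z, \det h = 1 -> H z ->
  g (mobius h z) = (autj h z ^ lam * conjc (autj h z) ^+ e) *: (eta h *m g z).
Hypothesis z0H : H z0.

Let c' r := c 0 (inord r).

Definition pairing_rc_poly : {poly R[i]} := rc_poly kap lam n c'
  (fun j => dtau_iter j (pairing L f) z0) (fun j => dtau_iter j (pairing M g) z0).

Lemma rc_bracket_twisted h : \det h = 1 ->
  rc_bracket n c' (pairing (L *m rho (invmx h)) f) (pairing (M *m eta (invmx h)) g)
    (mobius h z0) =
  conjc (autj h z0) ^+ (d + e) * autj h z0 ^ (kap + lam + (2 * n)%:Z)
    * pairing_rc_poly.[autj' h / autj h z0].
Proof.
move=> dh; set s := invmx h; set w := mobius h z0; set j := autj h z0.
have ds : \det s = 1 by rewrite det_inv dh invr1.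
have wH : H w by exact: mobius_upper.
have j0 : j != 0 by exact: autj_neq0.
have J0 : conjc j ^+ (d + e) != 0 by rewrite expf_neq0 // conjc_eq0.
have sw : autj s w = j^-1 by exact: autj_invmx.
have slashE kap' phi i :
    slash s (kap' + (2 * i)%:Z) phi w = j ^ (kap' + (2 * i)%:Z) * phi z0.
  by rewrite /slash sw -exprz_inv invrK mobiusK.
apply: (mulfI (invr_neq0 J0)).
rewrite -[X in _ = _ * X]mulrA mulKf //.
have -> : conjc j ^- (d + e) = conjc (autj s w) ^+ (d + e) by rewrite sw fmorphV exprVn.
transitivity (rc_poly kap lam n c'
    (fun i => slash s (kap + (2 * i)%:Z) (dtau_iter i (pairing L f)) w)
    (fun i => slash s (lam + (2 * i)%:Z) (dtau_iter i (pairing M g)) w)).[autx s w].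
  rewrite exprD horner_sum mulr_sumr; apply: eq_bigr => i _.
  rewrite hornerZ hornerM -(iter_dtau_twisted f_smooth f_law) //.
  by rewrite -(iter_dtau_twisted g_smooth g_law) //; ring.
have -> : autx s w = autj' h / j * j ^+ 2.
  by rewrite /autx sw invrK /s /autj' invmx22 // mx22E rmorphN opprK expr2 mulrA divfK.
have -> : (fun i => slash s (kap + (2 * i)%:Z) (dtau_iter i (pairing L f)) w) =
    fun i => j ^ (kap + (2 * i)%:Z) * dtau_iter i (pairing L f) z0.
  by apply/funext => i; rewrite slashE.
have -> : (fun i => slash s (lam + (2 * i)%:Z) (dtau_iter i (pairing M g)) w) =
    fun i => j ^ (lam + (2 * i)%:Z) * dtau_iter i (pairing M g) z0.
  by apply/funext => i; rewrite slashE.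
exact: (horner_rc_poly_scale kap lam n c' _ _ _ j0).
Qed.

Variable B : nat -> R[i] -> 'cV[R[i]]_(q * r).
Hypotheses (rho_rep : representation (@SL2Z R) rho).
Hypotheses (eta_rep : representation (@SL2Z R) eta).
Hypothesis B_law : forall h, SL2Z h -> bracket c f g (mobius h z0) =
  \sum_(t < (d + e).+1)
    (autj h z0 ^ (kap + lam + (2 * n)%:Z + (d + e)%:Z - t%:Z) * autj' h ^+ t)
      *: (tensor_rep rho eta h *m B t z0).

Let al : R[i] := - (2 * 'i%C * imC z0).

Lemma pairing_rc_poly_law h : SL2Z h ->
  (1 + al * (autj' h / autj h z0)) ^+ (d + e) * pairing_rc_poly.[autj' h / autj h z0] =
  \sum_(t < (d + e).+1)
    pairing (L *t M : 'rV[R[i]]_(q * r)) (B t) z0 * (autj' h / autj h z0) ^+ t.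
Proof.
move=> Gh; have [dh _] := Gh; set j := autj h z0; have j0 : j != 0 by exact: autj_neq0.
set s := invmx h; set x := autj' h / j; set K := kap + lam + (2 * n)%:Z.
have LMs : (L *t M : 'rV_(q * r)) *m tensor_rep rho eta s =
    (L *m rho s) *t (M *m eta s) :> 'rV_(q * r).
  exact: tensmx_rowE.
have repK t : pairing ((L *t M : 'rV_(q * r)) *m tensor_rep rho eta s)
    (fun z => tensor_rep rho eta h *m B t z) z0 = pairing (L *t M : 'rV_(q * r)) (B t) z0.
  rewrite /pairing -mulmxA (mulmxA (tensor_rep _ _ s)) /tensor_rep tensmx_mul.
  have Gs := SL2Z_inv Gh.
  rewrite -(rho_rep.2 _ _ Gs Gh) -(eta_rep.2 _ _ Gs Gh) mulVmx ?det1_unitmx //.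
  by rewrite rho_rep.1 eta_rep.1 tensmx11 mul1mx.
have := congr1 (fun v => ((L *t M : 'rV_(q * r)) *m tensor_rep rho eta s *m v) 0 0)
  (B_law Gh).
rewrite LMs -/(pairing _ (bracket c f g) _).
rewrite (bracket_pairing c _ _ f_smooth g_smooth (mobius_upper dh z0H)).
rewrite rc_bracket_twisted // -/j -/x.
have jE : conjc j = j * (1 + al * x) by rewrite /j conjc_autj -/j /x /al; field.
rewrite jE exprMn mulmx_sumr summxE.
have jK0 : j ^+ (d + e) * j ^ K != 0 by rewrite mulf_neq0 ?expf_neq0 ?expfz_neq0.
move=> law; apply: (mulfI jK0); transitivity (j ^+ (d + e) * (1 + al * x) ^+ (d + e) *
    j ^ K * pairing_rc_poly.[x]); first by ring.
rewrite {}law mulr_sumr; apply: eq_bigr => t _.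
rewrite -scalemxAr mxE -LMs [X in _ * X]repK.
have -> : j ^ (K + (d + e)%:Z - t%:Z) = j ^+ (d + e) * j ^ K / j ^+ t.
  by rewrite exprnP exprnN -!expfzDr //; congr (_ ^ _); lia.
by rewrite /x expr_div_n; ring.
Qed.

Lemma size_pairing_rc_poly : (size pairing_rc_poly <= 1)%N.
Proof.
have [-> |Q0] := eqVneq pairing_rc_poly 0; first by rewrite size_poly0.
pose ga (t : nat) : 'M[R]_2 := mx22 1 0 t%:R 1.
have Gga t : SL2Z (ga t).
  by apply: SL2Z_mx22; rewrite ?rpred0 ?rpred1 ?rpred_nat // mulr1 mul0r subr0.
pose x t : R[i] := autj' (ga t) / autj (ga t) z0.
have x_inj : injective x.
  move=> t t' /eqP; have [dt _] := Gga t; have [dt' _] := Gga t'.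
  have j0 := autj_neq0 dt z0H; have j'0 := autj_neq0 dt' z0H.
  rewrite /x eqr_div // /autj' /autj !mx22E !rmorph_nat rmorph1 => /eqP tt'.
  apply/eqP; rewrite -(eqr_nat R[i]) -subr_eq0; apply/eqP.
  transitivity (t%:R * (t'%:R * z0 + 1) - t'%:R * (t%:R * z0 + 1)); first by ring.
  by rewrite tt' subrr.
have PE : (al *: 'X + 1) ^+ (d + e) * pairing_rc_poly =
    \poly_(t < (d + e).+1) pairing (L *t M : 'rV[R[i]]_(q * r)) (B t) z0.
  apply: (poly_ext_inj x_inj) => t.
  rewrite hornerM horner_exp hornerD hornerZ hornerX -polyC1 hornerC addrC horner_poly.
  exact: (pairing_rc_poly_law (Gga t)).
have al0 : al != 0.
  rewrite oppr_eq0 !mulf_neq0 ?imC_neq0 ?pnatr_eq0 //.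
  by rewrite eq_complex /= oner_eq0 andbF.
have := size_poly (d + e).+1 (fun t => pairing (L *t M : 'rV[R[i]]_(q * r)) (B t) z0).
by rewrite -PE size_affine_exp_mul // -addn1 leq_add2l.
Qed.

End TwistedBrackets.

Section TestForms.
Variable R : realType.
Implicit Types (g : 'M[R]_2) (z : R[i]) (m p d a : nat).

Lemma representation_tensor (Gamma : set 'M[R]_2) m p
    (rho : 'M[R]_2 -> 'M[R[i]]_m) (eta : 'M[R]_2 -> 'M[R[i]]_p) :
  representation Gamma rho -> representation Gamma eta ->
  representation Gamma (tensor_rep rho eta).
Proof.
move=> [rho1 rhoM] [eta1 etaM]; split; first by rewrite /tensor_rep rho1 eta1 tensmx11.
by move=> g h Gg Gh; rewrite /tensor_rep rhoM // etaM // tensmx_mul.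
Qed.

Definition test_rep m p : 'M[R]_2 -> 'M[R[i]]_(m.+1 * p.+1) :=
  tensor_rep (@sym_rep R m) (@sym_rep R p).

Lemma test_rep_representation m p : representation (@SL2Z R) (test_rep m p).
Proof.
have sym_repP q : representation (@SL2Z R) (@sym_rep R q).
  by split=> [|g h [dg _] [dh _]]; [exact: sym_rep1|exact: sym_repM].
exact: representation_tensor.
Qed.

(* Real analytic of weight [2d + p - m] and depth [d] for all of [SL_2(R)]; the
   factor [conj j^d] left by the power of [y] is expanded in powers of [j'/j]. *)
Definition test_form m p d z : 'cV[R[i]]_(m.+1 * p.+1) :=
  imC z ^- (d + p) *: (veronese m z *t veronese p (conjc z)).

Lemma test_form_law m p d g z : \det g = 1 -> upper_half_plane z ->
  test_form m p d (mobius g z) =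
  (autj g z ^ ((d + p)%:Z - m%:Z) * conjc (autj g z) ^+ d)
    *: (test_rep m p g *m test_form m p d z).
Proof.
move=> dg z0; have j0 := autj_neq0 dg z0.
have J0 : conjc (autj g z) != 0 by rewrite conjc_eq0.
rewrite /test_form /test_rep /tensor_rep -scalemxAr tensmx_colE.
rewrite !sym_rep_veronese ?autj_conjc // mobius_conjc tensmx_colZ !scalerA.
congr (_ *: _).
set j := autj g z in j0 J0 *; set J := conjc j in J0 *.
have -> : imC (mobius g z) ^- (d + p) = imC z ^- (d + p) * (j ^+ (d + p) * J ^+ (d + p)).
  by rewrite imC_mobius // -/j -/J expr_div_n invf_div exprMn mulrC.
have <- : j ^ ((d + p)%:Z - m%:Z) * j ^+ m = j ^+ (d + p).
  by rewrite [X in _ * X]exprnP -expfzDr // subrK.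
by rewrite !exprD; ring.
Qed.

Lemma real_ana_imC_exprV a z : upper_half_plane z -> real_ana (fun w => imC w ^- a) z.
Proof.
move=> z0; have HA := analytic_da (ReIm_coords R) z.
by apply: analytic_ext (da_exp a HA (real_ana_imCV z0)) => w; rewrite exprVn.
Qed.

Lemma real_ana_test_form m p d i z : upper_half_plane z ->
  real_ana (fun w => test_form m p d w i 0) z.
Proof.
move=> z0; have HA := analytic_da (ReIm_coords R) z.
apply: analytic_ext (da_mul HA (real_ana_imC_exprV (d + p) z0) (da_mul HA
  (da_exp (mxtens_unindex i).1 HA (real_ana_id z))
  (da_exp (mxtens_unindex i).2 HA (real_ana_conjc z)))) => w.
by rewrite /test_form !mxE.
Qed.

Lemma smooth_on_test_form m p d i :
  smooth_on (@dtau_derivable R) upper_half_plane (fun w => test_form m p d w i 0).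
Proof. by apply: smooth_on_analytic => z; exact: real_ana_test_form. Qed.

Lemma test_form_quasimodular m p d (k : int) : k = (d + d + p)%:Z - m%:Z ->
  quasimodular (@SL2Z R) (test_rep m p) an k d (test_form m p d).
Proof.
move=> kE.
pose F r z := ('C(d, r)%:R * (- (2 * 'i%C * imC z)) ^+ r) *: test_form m p d z.
exists F, set0; rewrite {}/F; split.
- by apply/funext => z; rewrite bin0 expr0 mulr1 scale1r.
- by [].
- move=> r rd; apply/regularity_on_HP => z i z0 _.
  have HA := analytic_da (ReIm_coords R) z.
  have twist : real_ana (fun w => (- (2 * 'i%C) * imC w) ^+ r) z.
    by apply: (da_exp r HA); apply: (da_mul HA); [exact: (da_cst HA)|exact: real_ana_imC].
  have scalar := da_mul HA (da_cst HA 'C(d, r)%:R) twist.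
  apply: analytic_ext (da_mul HA scalar (real_ana_test_form d i z0)) => w.
  by rewrite !mxE mulNr.
- move=> g z [dg _] z0 _ _; have j0 := autj_neq0 dg z0.
  rewrite test_form_law // conjc_autj exprDn mulr_sumr scaler_suml; apply: eq_bigr => r _.
  rewrite -(scalemxAr ('C(d, r)%:R * _)) scalerA; congr (_ *: _); have rd := leq_ord r.
  have -> : autj g z ^ (k - r%:Z) = autj g z ^ ((d + p)%:Z - m%:Z) * autj g z ^+ (d - r).
    by rewrite [X in _ * X]exprnP -expfzDr //; congr (_ ^ _); lia.
  by rewrite exprMn mulrnAr -mulr_natr; ring.
- by [].
Qed.

Definition test_covector m p a (z0 : R[i]) : 'rV[R[i]]_(m.+1 * p.+1) :=
  (\row_(i < m.+1) (('X - z0%:P) ^+ a)`_i) *t (delta_mx 0 0 : 'rV[R[i]]_p.+1).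

Lemma pairing_test_form m p d a (z0 z : R[i]) : (a <= m)%N ->
  pairing (test_covector m p a z0) (test_form m p d) z = (z - z0) ^+ a * imC z ^- (d + p).
Proof.
move=> am; rewrite /pairing /test_form -scalemxAr mxE mulrC; congr (_ * _).
rewrite [LHS]tensmx_row_col -rowE !mxE expr0 mulr1; under eq_bigr do rewrite !mxE.
by rewrite -horner_coef_wide ?size_exp_XsubC // !hornerE.
Qed.

Lemma iter_dtau_pairing_test_form m p d a (z0 : R[i]) j :
  (a <= m)%N -> upper_half_plane z0 ->
  iter j (@dtau_scalar R) (pairing (test_covector m p a z0) (test_form m p d)) z0 =
  (j ^_ a)%:R * iter (j - a) (@dtau_scalar R) (fun w => imC w ^- (d + p)) z0.
Proof.
move=> am z0H; rewrite -(iter_dtau_subX (@open_upper_half_plane R)) //.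
  by congr (iter j _ _ _); apply/funext => z; exact: pairing_test_form.
by apply: smooth_on_analytic => z; exact: real_ana_imC_exprV.
Qed.

Lemma iter_dtau_pairing_test_form_neq0 m p d a (z0 : R[i]) :
  (a <= m)%N -> upper_half_plane z0 ->
  iter a (@dtau_scalar R) (pairing (test_covector m p a z0) (test_form m p d)) z0 != 0.
Proof.
move=> am z0H; rewrite iter_dtau_pairing_test_form // subnn ffactnn.
by rewrite mulf_neq0 ?pnatr_eq0 -?lt0n ?fact_gt0 // invr_eq0 expf_neq0 // imC_neq0.
Qed.

End TestForms.

Section Uniqueness.
Variables (R : realType) (k l : int) (d e n : nat) (c : 'rV[R[i]]_n.+1).

Lemma preserves_quasimodularity_recurrence : preserves_quasimodularity k l d e c ->
  rc_recurrence (k - d%:Z) (l - e%:Z) n (fun r => c 0 (inord r)).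
Proof.
move=> c_pres a lt_an; set b := (n - a.+1)%N.
pose z0 : R[i] := 'i%C.
have z0H : upper_half_plane z0 by rewrite /upper_half_plane /= ltr01.
have weightE (k' : int) d' : exists m p, (n <= m)%N /\ k' = (d' + d' + p)%:Z - m%:Z.
  pose m := (n + absz (k' - (2 * d')%:Z)%R)%N.
  by exists m, (absz (m%:Z + k' - (2 * d')%:Z)%R); rewrite /m; split; lia.
have [m [p [nm kE]]] := weightE k d; have [m' [p' [nm' lE]]] := weightE l e.
have rhoP := @test_rep_representation R m p.
have etaP := @test_rep_representation R m' p'.
have [B [S [B0 S0 _ B_law _]]] := c_pres _ _ _ _ _ an _ _ (@SL2Z_fuchsian R) rhoP etaP I
  (test_form_quasimodular R kE) (test_form_quasimodular R lE).
rewrite /= in S0; rewrite {}S0 in B_law.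
have kapE : k - d%:Z = (d + p)%:Z - m%:Z by lia.
have lamE : l - e%:Z = (e + p')%:Z - m'%:Z by lia.
rewrite kapE lamE.
pose L := test_covector m p a z0; pose M := test_covector m' p' b z0.
have Q_size := @size_pairing_rc_poly _ _ _ _ _ _ _ _ c _ _ _ _ L M _
  (@smooth_on_test_form R m p d) (@smooth_on_test_form R m' p' e)
  (@test_form_law R m p d) (@test_form_law R m' p' e) z0H B rhoP etaP.
apply: (@rc_defect_eq0 _ _ _ _ _ _ _ a b _ _ _ _ _ (Q_size _)).
- by rewrite /b; lia.
- by move=> j ja; rewrite iter_dtau_pairing_test_form ?ffact_small ?mul0r //; lia.
- by move=> j jb; rewrite iter_dtau_pairing_test_form ?ffact_small ?mul0r //; lia.
- by apply: iter_dtau_pairing_test_form_neq0 => //; lia.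
- by apply: iter_dtau_pairing_test_form_neq0 => //; lia.
- move=> h Gh; rewrite (B_law h _ Gh z0H (@id False) (@id False)); apply: eq_bigr => t _.
  by congr ((_ ^ _ * _) *: _); lia.
Qed.

End Uniqueness.

Theorem theorem1p2 (R : realType) (k l : int) (d e n : nat)
    (not_excluded :
      ~ [/\ 0 <= d%:Z - k, 0 <= e%:Z - l, d%:Z - k < n%:Z, e%:Z - l < n%:Z
          & n%:Z <= d%:Z + e%:Z - k - l + 1]) :
  [/\ rc_coef k l d e n != 0 :> 'rV[R[i]]_n.+1,
      preserves_quasimodularity k l d e (rc_coef k l d e n : 'rV[R[i]]_n.+1),
      forall c : 'rV[R[i]]_n.+1,
        c != 0 -> preserves_quasimodularity k l d e c ->
        exists2 a : R[i], a != 0 & c = a *: rc_coef k l d e n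
    & forall (Gamma : set 'M[R]_2) (m p : nat)
        (rho : 'M[R]_2 -> 'M[R[i]]_m) (eta : 'M[R]_2 -> 'M[R[i]]_p)
        (f : R[i] -> 'cV[R[i]]_m) (g : R[i] -> 'cV[R[i]]_p),
      fuchsian Gamma -> has_cusps Gamma -> (1 <= n)%N ->
      representation Gamma rho -> representation Gamma eta ->
      quasimodular Gamma rho hol k d f -> quasimodular Gamma eta hol l e g ->
      quasimodular Gamma (tensor_rep rho eta) cusp (k + l + (2 * n)%:Z) (d + e)
        (bracket (rc_coef k l d e n) f g)].
Proof.
have [r0 r0_pivot] := rc_pivot_exists not_excluded.
have rc_coefE r : rc_coef k l d e n 0 r = rc_coefficient R[i] (k - d%:Z) (l - e%:Z) n r.
  by rewrite mxE.
have c_rec := @rc_coefficient_recurrence R[i] (k - d%:Z) (l - e%:Z) n.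
split.
- have [r0n _ _] := r0_pivot; have := rc_coefficient_pivot_neq0 R[i] r0_pivot.
  apply: contra_neq => /matrixP/(_ 0 (inord r0)).
  by rewrite rc_coefE inordK // mxE.
- move=> Gamma m p rho eta star f g [[det_Gamma _ _ _] _ _] _ _ _.
  exact: (bracket_quasimodular det_Gamma c_rec rc_coefE).
- move=> c c0 /preserves_quasimodularity_recurrence.
  move=> /(rc_recurrence_unique r0_pivot) cE; set a := _ / _ in cE.
  have {}cE : c = a *: rc_coef k l d e n.
    by apply/rowP => r; rewrite mxE rc_coefE -cE ?leq_ord // inord_val.
  by exists a => //; apply: contraNneq c0 => a0; rewrite cE a0 scale0r.
- move=> Gamma m p rho eta f g [[det_Gamma _ _ _] _ _] _ n1 _ _.
  exact: (bracket_quasimodular_cusp det_Gamma c_rec rc_coefE n1).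
Qed.
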